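(* There is an absolute constant $C$ such that for any ideal marking $\mathcal I=(I_1,\dots,I_p)$ of $\mathbb D$ with $p\ge4$, $$\mathbf W(\mathbb D,\mathcal I)-Cp\ \le\ 2\sum_{\{m,n\}}\mathcal W_{mn}\ \le\ \mathbf W(\mathbb D,\mathcal I),$$ where the sum is over unordered pairs $\{m,n\}$ of non-adjacent indices.
   Context: An ideal marking of $\mathbb D$ of cardinality $p$ is a tiling of the unit circle $\mathbb T$ into closed arcs $I_1,\dots,I_p$ in cyclic order, indices in $\mathbb Z/p\mathbb Z$; $m,n$ are non-adjacent if $|m-n|>1$ in $\mathbb Z/p\mathbb Z$. Widths are extremal widths (reciprocals of extremal lengths) of path families in $\mathbb D$. $\overline{\mathcal W}_{mn}$ is the width of the family of paths in $\mathbb D$ joining $I_m$ to $I_n$, and $\mathcal W_{mn}=\max(\overline{\mathcal W}_{mn}-2,0)$. $\overline{\mathcal W}_n$ is the width of the family of paths in $\mathbb D$ joining $I_n$ to the union of all intervals non-adjacent to $I_n$ (i.e. to $\mathbb T\setminus(I_{n-1}\cup I_n\cup I_{n+1})$), the local weight is $\mathcal W_n=\max(\overline{\mathcal W}_n-2,0)$, and the total weight is $\mathbf W(\mathbb D,\mathcal I)=\sum_{n}\mathcal W_n$. *)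

(* Defs.v *)
From HB Require Import structures.
From mathcomp Require Import all_boot all_order all_algebra.
From mathcomp Require Import all_classical all_reals all_analysis.
From mathcomp Require Import measurable_realfun.
Set Implicit Arguments. Unset Strict Implicit. Unset Printing Implicit Defensive.
Import Order.TTheory GRing.Theory Num.Theory numFieldNormedType.Exports.
Local Open Scope classical_set_scope.
Local Open Scope ring_scope.

Section ExtremalWidth.
Variable R : realType.

Definition area : set (R * R) -> \bar R :=
  (@lebesgue_measure R \x @lebesgue_measure R)%E.

Definition disk : set (R * R) := [set z | z.1 ^+ 2 + z.2 ^+ 2 < 1].

Definition circ_pt (t : R) : R * R := (cos t, sin t).

(* An ideal marking of cardinality p: cut points th 0 < th 1 < ... < th p
   = th 0 + 2 pi; the k-th closed arc (k < p) is {e^{it} : th k <= t <= th (k+1)}.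
   Indices are taken modulo p. *)
Definition ideal_marking (p : nat) (th : nat -> R) : Prop :=
  (forall k, (k < p)%N -> th k < th k.+1) /\ th p = th 0%N + 2 * pi.

Definition arc (p : nat) (th : nat -> R) (k : nat) : set (R * R) :=
  circ_pt @` `[th (k %% p)%N, th (k %% p).+1].

(* m, n (in 0..p-1) are non-adjacent: |m - n| > 1 in Z/pZ *)
Definition nonadj (p m n : nat) : bool :=
  [&& m != n, m != (n.+1 %% p)%N & n != (m.+1 %% p)%N].

Definition dist2 (z w : R * R) : R :=
  Num.sqrt ((z.1 - w.1) ^+ 2 + (z.2 - w.2) ^+ 2).

(* locally Lipschitz on the open interval ]0,1[ : this is exactly the class of
   (reparametrizations of) locally rectifiable curves *)
Definition loc_lipschitz01 (g : R -> R * R) : Prop :=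
  forall c d : R, 0 < c -> d < 1 ->
    exists K : R, forall s t : R, c <= s <= d -> c <= t <= d ->
      dist2 (g s) (g t) <= K * `|s - t|.

Definition path_joining (E F : set (R * R)) (g : R -> R * R) : Prop :=
  [/\ {within `[0, 1], continuous g}, E (g 0), F (g 1),
      (forall t : R, 0 < t < 1 -> disk (g t)) & loc_lipschitz01 g].

Definition speed (g : R -> R * R) (t : R) : R :=
  Num.sqrt ((derive1 (fst \o g) t) ^+ 2 + (derive1 (snd \o g) t) ^+ 2).

Definition rho_length (rho : R * R -> \bar R) (g : R -> R * R) : \bar R :=
  (\int[@lebesgue_measure R]_(t in `]0%R, 1%R[) (rho (g t) * (speed g t)%:E))%E.

Definition admissible (Gam : set (R -> R * R)) (rho : R * R -> \bar R) : Prop :=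
  [/\ measurable_fun setT rho, (forall z, (0 <= rho z)%E) &
      forall g, Gam g -> (1 <= rho_length rho g)%E].

(* extremal width (= modulus = 1 / extremal length) of a path family in D *)
Definition width (Gam : set (R -> R * R)) : \bar R :=
  ereal_inf [set (\int[area]_(z in disk) (rho z * rho z))%E | rho in admissible Gam].

Definition Wbar_pair (p : nat) (th : nat -> R) (m n : nat) : \bar R :=
  width (path_joining (arc p th m) (arc p th n)).
Definition W_pair (p : nat) (th : nat -> R) (m n : nat) : \bar R :=
  Order.max (Wbar_pair p th m n - 2%:E)%E 0%E.

Definition nonadj_union (p : nat) (th : nat -> R) (n : nat) : set (R * R) :=
  \bigcup_(k in [set k : nat | (k < p)%N /\ nonadj p k n]) arc p th k.
Definition Wbar_loc (p : nat) (th : nat -> R) (n : nat) : \bar R :=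
  width (path_joining (arc p th n) (nonadj_union p th n)).
Definition W_loc (p : nat) (th : nat -> R) (n : nat) : \bar R :=
  Order.max (Wbar_loc p th n - 2%:E)%E 0%E.

Definition total_weight (p : nat) (th : nat -> R) : \bar R :=
  (\sum_(n < p) W_loc p th n)%E.

Definition pair_sum (p : nat) (th : nat -> R) : \bar R :=
  (\sum_(m < p) \sum_(n < p | (m < n)%N && nonadj p m n) W_pair p th m n)%E.

End ExtremalWidth.

(* Main.v *)
(* Send one endpoint of the second arc to infinity by a Cayley transform, so
   that the two arcs become [p, q] and [r, oo] with p < q < r, and use
   logarithmic polar coordinates centred at (q + r) / 2.  The half-circles
   between the radii l = (r - q) / 2 and L = (q + r) / 2 - p bound the width
   below by ln (L / l) / pi.  The angle function, cut off exponentially outside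
   these radii, bounds it above by ln (L / l) / pi + g with an explicit g
   (less than 1).  Here L / l = 2 X - 1, X the cross-ratio of the endpoints.
   For fixed n, the cross-ratios X_mn over the m not adjacent to n multiply to
   the cross-ratio X_n of the local family (telescoping).
   Right inequality: if only one W_mn is positive, monotonicity suffices;
   otherwise (2 X - 1) (2 Y - 1) <= 2 (2 X Y - 1) and ln 2 / pi + 2 g <= 2 show
   that the subtracted 2's absorb all the errors.
   Left inequality: ln X_mn / pi exceeds W_mn by at most 4 (1 - 1 / X_mn), and
   the sum of 1 - 1 / X_mn over all nonadjacent pairs is at most 4 p, by
   induction on the number of points. *)

Require Import Defs.
From HB Require Import structures.
From mathcomp Require Import all_boot all_order all_algebra.
From mathcomp Require Import all_classical all_reals all_analysis.
From mathcomp Require Import measurable_realfun.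
From mathcomp Require Import zify ring lra.
Import Order.TTheory GRing.Theory Num.Theory numFieldNormedType.Exports.
Local Open Scope classical_set_scope.
Local Open Scope ring_scope.
Set Implicit Arguments.
Unset Strict Implicit.
Unset Printing Implicit Defensive.

(** * Lipschitz functions and their derivatives *)

(** The right inequality carries no error term, so it leaves little room between the two bounds for
    a width: the gap g has to satisfy ln 2 / pi + 2 g <= 2. Hence the explicit metric in the upper
    bound. The angle divided by pi, plus 1/2, rises from 0 to 1 between the two arcs, but its energy
    diverges at the centre of the coordinates and at infinity; the cutoffs replace each divergence
    by a finite amount, and these two amounts are g. Admissibility concerns every locally Lipschitz
    path. Along such a path the test function is derivable only almost everywhere, and its
    increments must still be bounded by the integral of its derivative; the path meets the arcs only
    at its ends, so its values there are reached as limits. The quantity 1 - 1 / X serves as error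
    term because it is comparable with ln X when X is near 1 and stays away from 0 when X is large,
    where it pays for the subtracted constant 2. *)

Lemma lipschitz_ae_derivable (R : realType) (f : R -> R) (c d : R) :
  c < d -> (forall x y, `|f x - f y| <= `|x - y| / 2) ->
  exists h : R -> R, [/\ lebesgue_measure.-integrable `[c, d] (EFin \o h),
    (\int[lebesgue_measure]_(x in `[c, d]) (h x)%:E = (f d - f c)%:E)%E &
    {ae lebesgue_measure, forall x, c < x < d -> derivable f x 1 /\ derive1 f x = h x}].
Proof.
move=> cd fL.
(* The slope bound 1/2 makes [x / 2 + f x] and [x / 2 - f x] nondecreasing with sum [x], so each
   defines a Stieltjes measure. *)
have key s : (s = 1 \/ s = -1) ->
  exists F : cumulative R R, forall x, F x = x / 2 + s * f x.
  move=> hs.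
  have s1 : `|s| = 1 by case: hs => ->; rewrite ?normrN normr1.
  have nd : nondecreasing (fun x => x / 2 + s * f x).
    move=> x y xy; have := fL y x; rewrite (ger0_norm (_ : 0 <= y - x)) ?subr_ge0//.
    have : `|s * (f y - f x)| = `|f y - f x| by rewrite normrM s1 mul1r.
    move=> <-; rewrite ler_norml => /andP[+ _]; lra.
  have cf : continuous f.
    move=> x; apply/cvgrPdist_le => e e0; near=> y.
    apply: (le_trans (fL x y)); rewrite ler_pdivrMr//.
    apply: (@le_trans _ _ e); last by lra.
    by apply: ltW; near: y; apply: cvgr_dist_lt.
  have rc : right_continuous (fun x => x / 2 + s * f x).
    apply: right_continuousW => x; apply: cvgD.
      by apply: cvgM; [exact: cvg_id|exact: cvg_cst].
    by apply: cvgM; [exact: cvg_cst|exact: cf].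
  pose F : cumulative R R := HB.pack (fun x => x / 2 + s * f x)
    (isCumulative.Build R _ R _ nd rc).
  by exists F.
have [F1 F1E] := key 1 (or_introl erefl).
have [F2 F2E] := key (-1) (or_intror erefl).
have LSE (F : cumulative R R) a b : a <= b ->
    (lebesgue_stieltjes_measure F `]a, b])%E = (F b - F a)%:E.
  move=> ab; rewrite /lebesgue_stieltjes_measure /measure_extension.
  rewrite measurable_mu_extE/=; last exact: is_ocitv.
  by rewrite wlength_itv_bnd.
pose m1 := lebesgue_stieltjes_measure F1.
pose m2 := lebesgue_stieltjes_measure F2.
(* The two Stieltjes measures add up to Lebesgue measure, so each is dominated by it. The density of
   the first, minus 1/2, is the required derivative of [f], by Lebesgue differentiation. *)
have m12 A : measurable A -> (lebesgue_measure A = m1 A + m2 A)%E.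
  move=> mA.
  rewrite (@lebesgue_measure_unique _ (measure_add m1 m2))//.
    exact: measure_addE.
  move=> X oX; rewrite [RHS]measure_addE.
  have [->|[[a b] /= ab ->]] := (ocitvP X).1 oX; first by rewrite !measure0 adde0.
  rewrite /lebesgue_measure /m1 /m2 !LSE ?ltW//= -EFinD !F1E !F2E; congr EFin; lra.
have mcd : measurable (`]c, d]%classic : set (measurableTypeR R)) by exact: measurable_itv.
have m1E a b : a <= b -> m1 (`]a, b]%classic : set R) = (F1 b - F1 a)%:E by exact: LSE.
have fin1 : (m1 (`]c, d]%classic : set R) < +oo)%E by rewrite m1E ?ltW// ltry.
pose nu0 : {finite_measure set (measurableTypeR R) -> \bar R} :=
  @mfrestr _ (measurableTypeR R) R _ m1 mcd fin1.
pose nu := charge_of_finite_measure nu0.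
have dom : nu `<< (@lebesgue_measure R).
  apply/null_content_dominatesP => A mA A0.
  rewrite /nu /charge_of_finite_measure /nu0 /mfrestr /mrestr /=.
  apply/eqP; rewrite eq_le measure_ge0 andbT.
  apply: (@le_trans _ _ (m1 A)); first by apply: le_measure; rewrite ?inE//; exact: measurableI.
  by rewrite -A0 [leRHS]m12// leeDl.
pose h0 := Radon_Nikodym nu (@lebesgue_measure R).
pose g (x : R) : R := fine (h0 x).
have gE : EFin \o g = h0.
  by apply/funext => x /=; rewrite fineK// Radon_Nikodym_fin_num.
have ig : lebesgue_measure.-integrable setT (EFin \o g).
  by rewrite gE; exact: Radon_Nikodym_integrable.
have gint x : c <= x <= d ->
   (\int[lebesgue_measure]_(t in `]c, x]) (g t)%:E = (F1 x - F1 c)%:E)%E.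
  move=> /andP[cx xd].
  rewrite -m1E// (_ : (fun t => (g t)%:E) = h0)//.
  have mcx : measurable (`]c, x]%classic : set (measurableTypeR R)) by exact: measurable_itv.
  apply: (etrans (esym (Radon_Nikodym_integral dom mcx))).
  rewrite /nu /charge_of_finite_measure /nu0 /mfrestr /mrestr /=; congr (m1 _).
  apply/setIidl => t /=; rewrite !in_itv/= => /andP[-> tx] /=.
  exact: le_trans tx xd.
exists (fun x => g x - 1 / 2); split.
- have -> : EFin \o (fun x => g x - 1 / 2) = ((EFin \o g) \- cst (1/2)%:E)%E by [].
  apply: integrableB; first exact: measurable_itv.
    by apply: integrableS ig; [exact: measurableT|exact: measurable_itv|].
  apply: continuous_compact_integrable; first exact: segment_compact.
  by apply: continuous_subspaceT => x; exact: cvg_cst.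
- have igcd : lebesgue_measure.-integrable `[c, d] (EFin \o g).
    by apply: integrableS ig; [exact: measurableT|exact: measurable_itv|].
  under eq_integral do rewrite EFinB.
  rewrite integralB_EFin//; last first.
    apply: continuous_compact_integrable; first exact: segment_compact.
    by apply: continuous_subspaceT => x; exact: cvg_cst.
  rewrite integral_cst//= lebesgue_measure_itv/= lte_fin cd.
  rewrite -integral_itv_obnd_cbnd; last first.
    by apply: measurable_funTS; case/integrableP: ig.
  rewrite gint ?lexx ?ltW//= !F1E; congr EFin; lra.
- have lg : locally_integrable [set: R] g by apply: open_integrable_locally; [exact: openT|exact: ig].
  have gi y : lebesgue_measure.-integrable [set` Interval (BRight c) (BRight y)] (EFin \o g).
    by apply: integrableS ig; [exact: measurableT|exact: measurable_itv|].
  have := @FTC1 R g (BRight c) gi lg.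
  apply: filterS; first exact: (ae_filter_ringOfSetsType lebesgue_measure).
  move=> x /= + /andP[cx xd].
  rewrite lte_fin => /(_ cx) [dF F'].
  set F := (fun x => _) in dF F'.
  have FE : \forall y \near x, F y = F1 y - F1 c.
    near=> y; rewrite /F /Rintegral gint//; apply/andP; split; apply: ltW.
      by near: y; exact: lt_nbhsr.
    by near: y; exact: lt_nbhsl.
  have FF : {near x, F =1 (fun y => y / 2 + f y - F1 c)}.
    by apply: filterS FE => y ->; rewrite F1E mul1r.
  have fF : {near x, f =1 (fun y => F y + F1 c - y / 2)}.
    by apply: filterS FF => y ->; lra.
  have iF : is_derive x 1 (fun y => F y + F1 c - y / 2) (g x - 1/2).
    have idF : is_derive x 1 F (g x) by rewrite -F' derive1E; exact/derivableP.
    by apply: is_derive_eq; rewrite /GRing.scale/=; lra.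
  have fF' : \near x, (fun y => F y + F1 c - y / 2) x = f x.
    by apply: filterS fF => y ->.
  have [df <-] := near_eq_is_derive fF' iF.
  by split; [exact: df|rewrite derive1E].
Unshelve. all: by end_near. Qed.

(** The integral of a nonnegative function is a supremum over the simple functions below it, hence
    monotone even for nonmeasurable integrands. Length integrands along a path, whose measurability
    is not established, are compared in this way. *)
Lemma le_integral_ge0 d (T : measurableType d) (R : realType)
    (mu : {measure set T -> \bar R}) (A B : set T) (f g : T -> \bar R) :
  A `<=` B -> (forall x, A x -> (0 <= f x)%E) -> (forall x, B x -> (0 <= g x)%E) ->
  (forall x, A x -> (f x <= g x)%E) ->
  (\int[mu]_(x in A) f x <= \int[mu]_(x in B) g x)%E.
Proof.
move=> AB f0 g0 fg; rewrite !ge0_integralE//.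
apply: ge_ereal_sup => _ [h hf <-]; apply: ereal_sup_ubound; exists h => //= x.
apply: (le_trans (hf x)).
rewrite !patchE; case: ifPn => [/set_mem xA|_].
  by rewrite mem_set ?fg//; exact: AB.
by case: ifPn => // /set_mem; exact: g0.
Qed.

Lemma lipschitz_variation (R : realType) (f : R -> R) (c d K : R) :
  c < d -> (forall s t, c <= s <= d -> c <= t <= d -> `|f s - f t| <= K * `|s - t|) ->
  exists h : R -> R, [/\ lebesgue_measure.-integrable `[c, d] (EFin \o h),
    (\int[lebesgue_measure]_(x in `[c, d]) (h x)%:E = (f d - f c)%:E)%E &
    {ae lebesgue_measure, forall x, c < x < d -> derivable f x 1 /\ derive1 f x = h x}].
Proof.
move=> cd fL.
(* Clamping to [[c, d]] extends [f] to a Lipschitz function on the whole line. Division by [k] below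
   brings its slope under 1/2, and the summand 1 in [k] keeps [k] positive when [K] is 0. *)
pose q (x : R) := Num.max c (Num.min x d).
have qcd x : c <= q x <= d.
  by rewrite /q le_max lexx/= ge_max (ltW cd)/= ge_min lexx orbT.
have qL x y : `|q x - q y| <= `|x - y|.
  wlog xy : x y / x <= y.
    move=> H; have [/H//|/ltW/H] := leP x y.
    by rewrite distrC [leRHS]distrC.
  rewrite [leRHS]ler0_norm ?subr_le0// ler_norml; apply/andP.
  have qE z : (q z = c /\ z <= c) \/ (q z = z /\ c <= z <= d) \/ (q z = d /\ d <= z).
    rewrite /q; have [zd|dz] := leP z d; last first.
      by right; right; rewrite (max_idPr (ltW cd)) ltW.
    have [cz|zc] := leP c z; first by right; left; split=> //; apply/andP.
    by left; rewrite ltW.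
  by case: (qE x) => [[-> ?]|[[-> /andP[? ?]]|[-> ?]]];
     case: (qE y) => [[-> ?]|[[-> /andP[? ?]]|[-> ?]]]; split; lra.
have K0 : 0 <= K.
  have := fL c d; rewrite !lexx !(ltW cd) => /(_ erefl erefl) /(le_trans (normr_ge0 _)).
  by rewrite pmulr_lge0// normr_gt0 subr_eq0 lt_eqF.
pose k := 2 * (K + 1).
have k0 : 0 < k by rewrite /k; lra.
have [|h [ih hE hae]] := @lipschitz_ae_derivable R (fun x => k^-1 * f (q x)) c d cd.
  have k'0 : 0 <= k^-1 by rewrite invr_ge0 ltW.
  move=> x y; rewrite -mulrBr normrM (ger0_norm k'0) mulrC ler_pdivrMr//.
  apply: (le_trans (fL _ _ (qcd x) (qcd y))).
  apply: (@le_trans _ _ (K * `|x - y|)); first by rewrite ler_wpM2l.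
  by rewrite /k; have := normr_ge0 (x - y); nra.
have qid x : c <= x <= d -> q x = x.
  by move=> /andP[cx xd]; rewrite /q (min_idPl xd) (max_idPr cx).
exists (fun x => k * h x); split.
- have -> : EFin \o (fun x => k * h x) = (fun x => k%:E * (EFin \o h) x)%E by [].
  by apply: integrableZl => //; exact: measurable_itv.
- under eq_integral do rewrite EFinM.
  rewrite integralZl//.
  rewrite hE !qid ?lexx ?ltW// -EFinM; congr EFin.
  by rewrite -mulrBr mulrA mulfV ?mul1r// gt_eqF.
- apply: filterS hae; first exact: (ae_filter_ringOfSetsType lebesgue_measure).
  move=> x /= H cxd; have [df dh] := H cxd; move: cxd => /andP[cx xd].
  have fE : \near x, (fun y => k * (k^-1 * f (q y))) x = f x.
    near=> y; rewrite qid; first by rewrite mulrA mulfV ?mul1r// gt_eqF.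
    apply/andP; split; apply: ltW.
      by near: y; exact: lt_nbhsr.
    by near: y; exact: lt_nbhsl.
  have iF : is_derive x 1 (fun y => k * (k^-1 * f (q y))) (k * h x).
    have idF : is_derive x 1 (fun y => k^-1 * f (q y)) (h x).
      by rewrite -dh derive1E; exact/derivableP.
    exact: is_deriveZ.
  have [df' <-] := near_eq_is_derive fE iF.
  by split; [exact: df'|rewrite derive1E].
Unshelve. all: by end_near. Qed.

(** The source of every admissibility statement: [u] will be the test function along a path and [F]
    the length integrand of that path. *)
Lemma lipschitz_le_integral (R : realType) (u : R -> R) (F : R -> \bar R)
    (D : set R) (c d K : R) :
  c < d -> `]c, d[ `<=` D -> (forall t, D t -> 0 <= F t)%E ->
  (forall s t, c <= s <= d -> c <= t <= d -> `|u s - u t| <= K * `|s - t|) ->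
  {ae lebesgue_measure, forall t, c < t < d -> derivable u t 1 ->
    (`|derive1 u t|%:E <= F t)%E} ->
  (`|u d - u c|%:E <= \int[lebesgue_measure]_(t in D) F t)%E.
Proof.
move=> cd cdD F0 uL uF.
have [h [ih hE hae]] := @lipschitz_variation _ _ _ _ _ cd uL.
have [N [mN N0 NP]] : lebesgue_measure.-negligible
    (~` [set t | c < t < d -> (`|h t|%:E <= F t)%E]).
  have [N1 [mN1 N10 N1P]] := hae; have [N2 [mN2 N20 N2P]] := uF.
  exists (N1 `|` N2); split; first exact: measurableU.
    by rewrite measureU0.
  move=> t /=; have [tN1|tN1] := pselect (N1 t); first by left.
  have [tN2|tN2 []] := pselect (N2 t); first by right.
  move=> ctd.
  have [df <-] : derivable u t 1 /\ derive1 u t = h t.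
    by apply: contrapT => hn; apply: tN1; apply: N1P => /= /(_ ctd).
  by apply: contrapT => hn; apply: tN2; apply: N2P => /= /(_ ctd df).
have -> : `|u d - u c|%:E = `|\int[lebesgue_measure]_(x in `[c, d]) (h x)%:E|%E by rewrite hE.
have mh : measurable_fun `[c, d] (EFin \o h) by case/integrableP : ih.
apply: (le_trans (le_abse_integral _ _ _)) => //.
have mh' : measurable_fun `]c, d[ (fun x => `|(h x)%:E|)%E.
  apply: measurableT_comp => //.
  by apply: measurable_funS mh => //; exact: subset_itv_oo_cc.
rewrite -integral_itv_bndo_bndc; last first.
  apply: measurableT_comp => //.
  by apply: measurable_funS mh => //; exact: subset_itv_co_cc.
rewrite -integral_itv_obnd_cbnd//.
rewrite (@ge0_negligible_integral _ _ _ _ _ N)//.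
apply: le_integral_ge0 => //.
- by move=> t [/cdD].
- move=> t [ctd tN].
  by apply: contrapT => hn; apply: tN; apply: NP => /= /(_ ctd).
Qed.

(** * Area in Cayley and polar coordinates *)

Lemma ge0_integral_mrestr d (T : measurableType d) (R : realType)
    (mu : {measure set T -> \bar R}) (E : set T) (mE : measurable E)
    (f : T -> \bar R) :
  measurable_fun setT f -> (forall x, 0 <= f x)%E ->
  (\int[mrestr mu mE]_x f x = \int[mu]_(x in E) f x)%E.
Proof.
move=> mf f0.
have mE' := measurableC mE.
have m0 : mrestr mu mE (~` E) = 0%E by rewrite /mrestr setIC setICr measure0.
have -> : (\int[mrestr mu mE]_x f x = \int[mrestr mu mE]_(x in E) f x)%E.
  by rewrite (ge0_negligible_integral mE' _ _ _ m0)// setDE setTI setCK.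
apply: eq_measure_integral => A mA AE.
by rewrite /= /mrestr setIidl.
Qed.

(** * One-dimensional change of variables for nonnegative integrals *)

Section integral_subst.
Variables (R : realType) (G H w : R -> R) (E : set R).
Hypothesis mE : measurable E.
Hypothesis E_itv : is_interval E.
Hypothesis mH : measurable_fun E H.
Hypothesis G_homo : {homo G : x y / x < y}.
Hypothesis G_derive : forall t : R, is_derive t (1 : R) G (w t).
Hypothesis w_cont : continuous w.
Hypothesis w_ge0 : forall t, 0 <= w t.
Hypothesis GK : forall t, E (G t) /\ H (G t) = t.
Hypothesis HK : forall x, E x -> G (H x) = x.

Let leb := @lebesgue_measure R.

Let G_cont : continuous G.
Proof.
move=> x; apply: differentiable_continuous; apply/derivable1_diffP.
by have [] := G_derive x.
Qed.

Let GF : exists F : cumulative R R, forall x, F x = G x.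
Proof.
have nd : nondecreasing G by apply: ltW_homo.
pose F : cumulative R R := HB.pack G (isCumulative.Build R _ R _ nd
  (right_continuousW G_cont)).
by exists F.
Qed.

(** The region under the graph of [w]: projecting its area to the first axis realises the measure
    [w dx]. *)
Let U : set (R * R) := [set z | 0 <= z.2] `&` [set z | z.2 < w z.1].

Let mw : measurable_fun setT w.
Proof. exact: continuous_measurable_fun. Qed.

Let mU : measurable U.
Proof.
apply: measurableI.
  rewrite -[X in measurable X]setTI; apply: measurable_fun_le => //.
have -> : [set z : R * R | z.2 < w z.1] = (fun z : R * R => z.2 < w z.1) @^-1` [set true].
  by [].
rewrite -[X in measurable X]setTI; apply: measurable_fun_ltr => //.
exact: measurableT_comp.
Qed.

Let phi : R -> measurableTypeR R := H \_ E.

Let mphi : measurable_fun setT phi.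
Proof. exact/(measurable_restrictT H mE). Qed.

Let m2 : {measure set (measurableTypeR R) -> \bar R}.
Proof. by refine (pushforward (mrestr leb mE) phi); exact: mphi. Defined.

Let m1 : {measure set (measurableTypeR R) -> \bar R}.
Proof.
by refine (pushforward (mrestr (leb \x leb)%E mU) fst); exact: measurable_fst.
Defined.

Let int2 (g : R -> \bar R) : measurable_fun setT g -> (forall x, 0 <= g x)%E ->
  (\int[m2]_t g t = \int[leb]_(x in E) g (H x))%E.
Proof.
move=> mg g0; rewrite /m2 ge0_integral_pushforward//.
have mgp : measurable_fun setT (g \o phi) by apply: measurableT_comp => //; exact: mphi.
rewrite preimage_setT ge0_integral_mrestr => [|//|x]; last exact: g0.
by apply: eq_integral => x xE /=; rewrite /phi patchE xE.
Qed.

Let int1 (g : R -> \bar R) : measurable_fun setT g -> (forall x, 0 <= g x)%E ->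
  (\int[m1]_t g t = \int[leb]_x (g x * (w x)%:E))%E.
Proof.
move=> mg g0; rewrite /m1 ge0_integral_pushforward//.
have mgp : measurable_fun setT (g \o (fst : R * R -> R)) by exact: measurableT_comp.
rewrite preimage_setT ge0_integral_mrestr => [|//|x]; last exact: g0.
rewrite integral_mkcond fubini_tonelli1; last 2 first.
- by apply/(measurable_restrictT _ mU); apply: measurable_funTS; apply: measurableT_comp.
- by move=> z; rewrite patchE; case: ifP => //= _.
apply: eq_integral => x _; rewrite /fubini_F.
transitivity (\int[leb]_(y in `[0%R, w x[) g x)%E.
  rewrite [RHS]integral_mkcond; apply: eq_integral => y _; rewrite !patchE.
  congr (if _ then _ else _).
  apply/idP/idP; rewrite !inE /U /= in_itv/=; first by move=> [-> ->].
  by move=> /andP[].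
rewrite integral_cst//; congr (_ * _)%E.
apply: (etrans (lebesgue_measure_itv _)); rewrite /= lte_fin.
case: ltP => [_|w0]; first by rewrite oppr0 addr0.
by rewrite (_ : w x = 0)//; apply/eqP; rewrite eq_le w0 w_ge0.
Qed.

(** Both measures give []a, b]] the mass [G b - G a]: [m1] by the fundamental theorem of calculus,
    [m2] because the preimage under [H] is []G a, G b]]. These values determine a Stieltjes
    measure. *)
Let m12 A : measurable A -> m1 A = m2 A.
Proof.
have [F FE] := GF.
suff key (m : {measure set (measurableTypeR R) -> \bar R}) :
   (forall a b, a < b -> m `]a, b]%classic = (G b - G a)%:E) ->
   forall X, ocitv X -> lebesgue_stieltjes_measure F X = m X.
  move=> mA; rewrite -(@lebesgue_stieltjes_measure_unique _ F m1 _ A mA).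
    rewrite -(@lebesgue_stieltjes_measure_unique _ F m2 _ A mA)//.
    apply: key => a b ab; rewrite /m2/= /pushforward /mrestr.
    have Emem y : (G a < y) && (y <= G b) -> E y.
      move=> /andP[ay yb]; apply: (E_itv (GK a).1 (GK b).1).
      by rewrite (ltW ay).
    have -> : phi @^-1` `]a, b]%classic `&` E = `]G a, G b]%classic.
      apply/seteqP; split => y /=.
        move=> [+ Ey]; rewrite /phi patchE mem_set// !in_itv/= => /andP[aH Hb].
        have aG : G a < G (H y) by exact: G_homo.
        have Gb : G (H y) <= G b by exact: (ltW_homo G_homo).
        by move: aG Gb; rewrite HK// => -> ->.
      rewrite in_itv/= => aGb; have Ey := Emem _ aGb.
      split=> //; rewrite /phi patchE mem_set// in_itv/=.
      move: aGb; rewrite -{1 2}(HK Ey) => /andP[aH Hb].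
      rewrite !ltNge; apply/andP; split.
        by apply: contraTN aH => /(ltW_homo G_homo); rewrite leNgt.
      by rewrite leNgt; apply: contraTN Hb => /G_homo; rewrite ltNge.
    by rewrite /leb lebesgue_measure_itv/= lte_fin G_homo.
  apply: key => a b ab.
  transitivity (\int[m1]_t (\1_(`]a, b]%classic : set R) t)%:E)%E.
    by rewrite integral_indic// ?setIT//; exact: measurable_itv.
  have mi : measurable_fun setT (fun t => (\1_(`]a, b]%classic : set R) t)%:E : \bar R).
    by apply/measurable_EFinP; exact: measurable_indic.
  rewrite int1//.
  transitivity (\int[leb]_(t in `]a, b]) (w t)%:E)%E.
    rewrite [RHS]integral_mkcond; apply: eq_integral => t _.
    by rewrite patchE indicE; case: ifP; rewrite ?mul1e ?mul0e.
  rewrite /leb integral_itv_obnd_cbnd; last first.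
    by apply/measurable_EFinP; exact: measurable_funTS.
  rewrite (@continuous_FTC2 _ _ G)//.
  - exact: continuous_subspaceT.
  - split.
    + by move=> t _; have [] := G_derive t.
    + by apply: cvg_at_right_filter; exact: G_cont.
    + by apply: cvg_at_left_filter; exact: G_cont.
  - by move=> t _; rewrite derive1E; have [] := G_derive t.
move=> mE2 X oX; have [->|[[a b] /= ab ->]] := (ocitvP X).1 oX; first by rewrite !measure0.
rewrite mE2// /lebesgue_stieltjes_measure /measure_extension.
rewrite measurable_mu_extE/=; last exact: is_ocitv.
by rewrite wlength_itv_bnd ?ltW// !FE.
Qed.

Lemma ge0_integral_subst (f : R -> \bar R) :
  measurable_fun E f -> (forall x, E x -> 0 <= f x)%E ->
  (\int[leb]_(x in E) f x = \int[leb]_t (f (G t) * (w t)%:E))%E.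
Proof.
move=> mf f0.
have mfG : measurable_fun setT (f \o G).
  apply: (measurable_comp mE) => //; first by move=> _ [t _ <-]; have [] := GK t.
  exact: continuous_measurable_fun.
have fG0 t : (0 <= (f \o G) t)%E by apply: f0; have [] := GK t.
rewrite -int1//.
have -> : (\int[m1]_t (f \o G) t = \int[m2]_t (f \o G) t)%E.
  by apply: eq_measure_integral => A mA _; exact: m12.
rewrite int2//; apply: eq_integral => x /set_mem Ex /=.
by rewrite HK.
Qed.

End integral_subst.

Section substitutions.
Variable R : realType.
Let leb := @lebesgue_measure R.
Implicit Type f : R -> \bar R.

Lemma ge0_integral_affine f (k b : R) : 0 < k -> measurable_fun setT f ->
  (forall x, 0 <= f x)%E ->
  (\int[leb]_x f x = \int[leb]_t (f (k * t + b)%R * k%:E))%E.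
Proof.
move=> k0 mf f0.
apply: (@ge0_integral_subst R (fun t => k * t + b) (fun x => (x - b) / k) (cst k) setT) => //.
- by apply: measurable_funM => //; exact: measurable_funB.
- by move=> x y xy; rewrite ltrD2r ltr_pM2l.
- by move=> t; apply: is_derive_eq; rewrite /GRing.scale/=; lra.
- by move=> t; exact: cvg_cst.
- by move=> t; exact: ltW.
- by move=> t; split=> //; rewrite addrK mulrAC mulfV ?mul1r// gt_eqF.
- by move=> x _; rewrite mulrCA mulfV ?mulr1 ?subrK// gt_eqF.
Qed.

Lemma ge0_integral_expR f : measurable_fun setT f ->
  (forall x, 0 <= f x)%E ->
  (\int[leb]_(x in `]0%R, +oo[) f x = \int[leb]_t (f (expR t) * (expR t)%:E))%E.
Proof.
move=> mf f0.
apply: (@ge0_integral_subst R expR (@ln R) expR `]0, +oo[%classic) => //.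
- exact: interval_is_interval.
- by apply: measurable_funTS; exact: measurable_ln.
- by move=> x y; rewrite ltr_expR.
- by move=> t; exact: continuous_expR.
- by move=> t; rewrite expRK /= in_itv/= andbT expR_gt0.
- by move=> x /=; rewrite in_itv/= andbT => x0; rewrite lnK.
- exact: measurable_funTS.
Qed.

Lemma ge0_integral_atan f : measurable_fun setT f ->
  (forall x, 0 <= f x)%E ->
  (\int[leb]_(x in `](- (pi / 2))%R, (pi / 2)%R[) f x =
   \int[leb]_t (f (atan t) * ((1 + t ^+ 2)^-1)%R%:E))%E.
Proof.
move=> mf f0.
have cosn0 (x : R) : - (pi / 2) < x < pi / 2 -> cos x != 0.
  by move=> hx; rewrite gt_eqF// cos_gt0_pihalf.
have t1 (t : R) : 1 + t ^+ 2 != 0 by rewrite gt_eqF// ltr_wpDr// ?sqr_ge0.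
apply: (@ge0_integral_subst R (@atan R) (@tan R) (fun t => (1 + t ^+ 2)^-1)
  `](- (pi / 2)), (pi / 2)[%classic) => //.
- exact: interval_is_interval.
- apply: open_continuous_measurable_fun; first exact: interval_open.
  by move=> x /[!inE]/=; rewrite in_itv/= => /cosn0; exact: continuous_tan.
- move=> x y xy; have [hx tx] := atan_def x; have [hy ty] := atan_def y.
  by rewrite -ltr_tan ?tx ?ty// in_itv.
- move=> t; apply: cvgV; first exact: t1.
  apply: cvgD; first exact: cvg_cst.
  exact: exprn_continuous.
- by move=> t; rewrite invr_ge0 addr_ge0// sqr_ge0.
- by move=> t; have [? ?] := atan_def t; rewrite /= in_itv/=.
- by move=> x /=; rewrite in_itv/= => hx; rewrite tanK// in_itv.
- exact: measurable_funTS.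
Qed.

Lemma ge0_integral_neg f : measurable_fun setT f -> (forall x, 0 <= f x)%E ->
  (\int[leb]_x f x = \int[leb]_x f (- x)%R)%E.
Proof.
move=> mf f0.
have mN : measurable_fun setT (-%R : R -> measurableTypeR R) by exact: oppr_measurable.
transitivity (\int[pushforward leb (-%R : R -> measurableTypeR R)]_x f x)%E.
  by apply: eq_measure_integral => A mA _; exact/esym/lebesgue_measureN.
by rewrite ge0_integral_pushforward.
Qed.

End substitutions.

(** * Invariance of plane measure under translations, shears and rotations *)

Section plane.
Variable R : realType.
Let leb := @lebesgue_measure R.
Implicit Type f : R * R -> \bar R.

(* [area] is typed over the default display of [R], the library's product
   measure over the display of [measurableTypeR R]: the Borel sets agree. *)
Definition plane : {measure set (measurableTypeR R * measurableTypeR R) -> \bar R} :=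
  (leb \x leb)%E.

Lemma integral_area (D : set (R * R)) f : measurable D -> measurable_fun setT f ->
  (forall z, 0 <= f z)%E ->
  (\int[@area R]_(z in D) f z = \int[plane]_z (f \_ D) z)%E.
Proof.
move=> mD mf f0.
pose phi (z : measurableTypeR R * measurableTypeR R) : (R * R)%type := z.
have mphi : measurable_fun setT phi by move=> _ A mA; rewrite setTI.
have := @ge0_integral_pushforward _ _ _ _ R phi mphi plane D f mD (measurable_funTS mf) (fun z _ => f0 z).
rewrite -integral_mkcond.
exact.
Qed.

Lemma plane_iterated1 f : measurable_fun setT f -> (forall z, 0 <= f z)%E ->
  (\int[plane]_z f z = \int[leb]_x \int[leb]_y f (x, y))%E.
Proof.
move=> mf f0.
exact: (@fubini_tonelli1 _ _ (measurableTypeR R) (measurableTypeR R) R leb leb f mf f0).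
Qed.

Lemma plane_iterated2 f : measurable_fun setT f -> (forall z, 0 <= f z)%E ->
  (\int[plane]_z f z = \int[leb]_y \int[leb]_x f (x, y))%E.
Proof.
move=> mf f0.
exact: (@fubini_tonelli2 _ _ (measurableTypeR R) (measurableTypeR R) R leb leb f mf f0).
Qed.

Lemma plane_translate f (a b : R) : measurable_fun setT f -> (forall z, 0 <= f z)%E ->
  (\int[plane]_z f z = \int[plane]_z f (a + z.1, b + z.2)%R)%E.
Proof.
move=> mf f0.
have mg : measurable_fun setT (fun z : R * R => f (a + z.1, b + z.2)%R).
  apply: measurableT_comp => //; apply: measurable_fun_pair; exact: measurable_funD.
rewrite (plane_iterated1 mf f0) (plane_iterated1 mg (fun z => f0 _)).
have mF : measurable_fun setT (fun x => \int[leb]_y f (x, y))%E.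
  exact: (@measurable_fun_fubini_tonelli_F _ _ (measurableTypeR R) (measurableTypeR R) R leb f mf f0).
rewrite (@ge0_integral_affine R (fun x => \int[leb]_y f (x, y))%E 1 a)//; last first.
  by move=> x; exact: integral_ge0.
apply: eq_integral => x _; rewrite mule1 mul1r (addrC x).
rewrite (@ge0_integral_affine R (fun y => f (a + x, y)%R) 1 b)//; last first.
  exact: measurableT_comp.
by apply: eq_integral => y _; rewrite mule1 mul1r (addrC y).
Qed.

Lemma plane_shear1 f (k : R) : measurable_fun setT f -> (forall z, 0 <= f z)%E ->
  (\int[plane]_z f z = \int[plane]_z f (z.1 + k * z.2, z.2)%R)%E.
Proof.
move=> mf f0.
have mg : measurable_fun setT (fun z : R * R => f (z.1 + k * z.2, z.2)%R).
  apply: measurableT_comp => //; apply: measurable_fun_pair => //.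
  by apply: measurable_funD => //; exact: measurable_funM.
rewrite (plane_iterated2 mf f0) (plane_iterated2 mg (fun z => f0 _)).
apply: eq_integral => y _.
rewrite (@ge0_integral_affine R (fun x => f (x, y)%R) 1 (k * y))//; last first.
  exact: measurableT_comp.
by apply: eq_integral => x _; rewrite mule1 mul1r.
Qed.

Lemma plane_swap f : measurable_fun setT f -> (forall z, 0 <= f z)%E ->
  (\int[plane]_z f z = \int[plane]_z f (z.2, z.1))%E.
Proof.
move=> mf f0.
have mg : measurable_fun setT (fun z : R * R => f (z.2, z.1)).
  by apply: measurableT_comp => //; exact: measurable_fun_pair.
by rewrite plane_iterated1// plane_iterated2.
Qed.

Lemma plane_shear2 f (k : R) : measurable_fun setT f -> (forall z, 0 <= f z)%E ->
  (\int[plane]_z f z = \int[plane]_z f (z.1, z.2 + k * z.1)%R)%E.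
Proof.
move=> mf f0.
have mg : measurable_fun setT (fun z : R * R => f (z.2, z.1)).
  by apply: measurableT_comp => //; exact: measurable_fun_pair.
have mh : measurable_fun setT (fun z : R * R => f (z.1, z.2 + k * z.1)%R).
  apply: measurableT_comp => //; apply: measurable_fun_pair => //.
  by apply: measurable_funD => //; exact: measurable_funM.
by rewrite plane_swap// (plane_shear1 k mg)// [RHS]plane_swap.
Qed.

Lemma plane_neg2 f : measurable_fun setT f -> (forall z, 0 <= f z)%E ->
  (\int[plane]_z f z = \int[plane]_z f (z.1, - z.2)%R)%E.
Proof.
move=> mf f0.
have mg : measurable_fun setT (fun z : R * R => f (z.1, - z.2)%R).
  by apply: measurableT_comp => //; apply: measurable_fun_pair => //; exact: measurableT_comp.
rewrite (plane_iterated1 mf f0) (plane_iterated1 mg (fun z => f0 _)).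
apply: eq_integral => x _.
by rewrite ge0_integral_neg//; exact: measurableT_comp.
Qed.

(* a rotation is a product of three shears *)
Lemma plane_rotate f (c s : R) : c ^+ 2 + s ^+ 2 = 1 ->
  measurable_fun setT f -> (forall z, 0 <= f z)%E ->
  (\int[plane]_z f z = \int[plane]_z f (c * z.1 - s * z.2, s * z.1 + c * z.2)%R)%E.
Proof.
move=> cs mf f0.
(* The half-turn has no such factorisation into shears; it is built from swaps and reflections. *)
have [c1|c1] := eqVneq c (-1).
  have s0 : s = 0 by apply/eqP; rewrite -sqrf_eq0; apply/eqP; move: cs; rewrite c1; lra.
  have mg : measurable_fun setT (fun z : R * R => f (z.1, - z.2)%R).
    apply: measurableT_comp => //; apply: measurable_fun_pair => //.
    exact: measurableT_comp.
  have mg2 : measurable_fun setT (fun z : R * R => f (z.2, - z.1)%R).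
    apply: measurableT_comp => //; apply: measurable_fun_pair => //.
    exact: measurableT_comp.
  have mg3 : measurable_fun setT (fun z : R * R => f (- z.2, - z.1)%R).
    by apply: measurableT_comp => //; apply: measurable_fun_pair; exact: measurableT_comp.
  rewrite (plane_neg2 mf f0) (plane_swap mg (fun z => f0 _)).
  rewrite (plane_neg2 mg2 (fun z => f0 _)) (plane_swap mg3 (fun z => f0 _)).
  by apply: eq_integral => z _ /=; rewrite c1 s0 !mul0r subr0 add0r !mulN1r.
(* Minus the tangent of half the rotation angle. *)
pose k := - s / (1 + c).
have c1' : 1 + c != 0 by rewrite addrC -[X in _ + X]opprK subr_eq0.
have mg : measurable_fun setT (fun z : R * R => f (z.1 + k * z.2, z.2)%R).
  apply: measurableT_comp => //; apply: measurable_fun_pair => //.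
  by apply: measurable_funD => //; exact: measurable_funM.
have mg2 : measurable_fun setT (fun z : R * R => f (z.1 + k * (z.2 + s * z.1), z.2 + s * z.1)%R).
  have m1 : measurable_fun setT (fun z : R * R => z.2 + s * z.1).
    by apply: measurable_funD => //; exact: measurable_funM.
  apply: measurableT_comp => //; apply: measurable_fun_pair => //.
  by apply: measurable_funD => //; exact: measurable_funM.
rewrite (plane_shear1 k mf f0) (plane_shear2 s mg (fun z => f0 _)).
rewrite (plane_shear1 k mg2 (fun z => f0 _)).
apply: eq_integral => z _ /=; congr f.
have e2 : k * (1 + c) = - s by rewrite divfK.
have e1 : k * s = c - 1.
  by apply: (mulIf c1'); rewrite mulrAC e2; nra.
congr (_, _).
  transitivity (z.1 + k * s * z.1 + (2 * k + k * (k * s)) * z.2); first by ring.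
  by rewrite e1 -[s]opprK -e2; ring.
transitivity (s * z.1 + z.2 + k * s * z.2); first by ring.
by rewrite e1; ring.
Qed.
End plane.

(** Inversion is continuous off 0, and the single point 0, with its default value, is treated as a
    separate measurable piece. *)
Lemma measurable_fun_inv d (T : measurableType d) (R : realType) (D : set T) (g : T -> R) :
  measurable_fun D g -> measurable_fun D (fun x => (g x)^-1).
Proof.
move=> mg; apply: (measurableT_comp (f := fun x : R => x^-1)) mg.
have -> : [set: R] = [set x | x != 0] `|` [set 0].
  by apply/seteqP; split => // x _ /=; case: eqVneq => [->|]; [right|left].
have o0 : open [set x : R | x != 0] by exact: open_neq.
apply/measurable_funU => //; first by apply: open_measurable.
split; last exact: measurable_fun_set1.
apply: open_continuous_measurable_fun => // x /[!inE]/= x0.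
exact: inv_continuous.
Qed.

(** Measurability by recursion on the expression. The clause for differences precedes that for sums
    because [a - b] is a sum with an opposite. *)
Ltac mfun :=
  lazymatch goal with
  | |- measurable_fun _ ( *%R ?c) =>
      apply: (measurable_funM (f := cst c) (g := id)); mfun
  | |- measurable_fun _ (+%R ?c) =>
      apply: (measurable_funD (f := cst c) (g := id)); mfun
  | |- measurable_fun _ expR => exact: measurable_expR
  | |- measurable_fun _ (fun z => (@?a z, @?b z)) => apply: measurable_fun_pair; mfun
  | |- measurable_fun _ (fun z => (@?a z + - @?b z)%R) => apply: measurable_funB; mfun
  | |- measurable_fun _ (fun z => (@?a z + @?b z)%R) => apply: measurable_funD; mfun
  | |- measurable_fun _ (fun z => (@?a z * @?b z)%R) => apply: measurable_funM; mfun
  | |- measurable_fun _ (fun z => (@?a z ^+ ?n)%R) => apply: measurable_funX; mfun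
  | |- measurable_fun _ (fun z => ((@?a z)^-1)%R) => apply: measurable_fun_inv; mfun
  | |- measurable_fun _ (fun z => expR (@?a z)) =>
      apply: (measurableT_comp (@measurable_expR _)); mfun
  | |- measurable_fun _ (fun z => cos (@?a z)) =>
      apply: (measurableT_comp (continuous_measurable_fun (@continuous_cos _))); mfun
  | |- measurable_fun _ (fun z => sin (@?a z)) =>
      apply: (measurableT_comp (continuous_measurable_fun (@continuous_sin _))); mfun
  | |- measurable_fun _ (fun z => (@?a z)%:E) => apply/measurable_EFinP; mfun
  | |- measurable_fun _ (fun z => (@?a z * @?b z)%E) => apply: emeasurable_funM; mfun
  | |- measurable_fun _ (fun z => ?f (@?a z)) =>
      first [ assumption | exact: measurable_cst | exact: measurable_fst
            | exact: measurable_snd | apply: (measurableT_comp (f := f)); [assumption|mfun] ]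
  | |- _ => first [assumption | exact: measurable_cst | exact: measurable_fst
                  | exact: measurable_snd | exact: measurable_id ]
  end.

(** * Polar coordinates and inversion in the upper half-plane *)

Section polar.
Variable R : realType.
Let leb := @lebesgue_measure R.

Let H : set (R * R) := [set z | 0 < z.2].

Lemma measurable_halfplane : measurable H.
Proof.
have -> : H = (fun z : R * R => 0 < z.2) @^-1` [set true] by [].
by rewrite -[X in measurable X]setTI; apply: measurable_fun_ltr.
Qed.

(** A chain of one-variable substitutions: y = e^s, x = y t, t = tan u, and finally the translation
    of s by ln (cos u), which turns the logarithmic height into the logarithmic radius. The angle
    [u] is measured from the vertical. *)
Lemma plane_polar (f : R * R -> \bar R) :
  measurable_fun setT f -> (forall z, 0 <= f z)%E ->
  (\int[plane R]_z (f \_ H) z =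
   \int[leb]_(u in `](- (pi / 2))%R, (pi / 2)%R[)
     \int[leb]_s (f (expR s * sin u, expR s * cos u)%R * (expR s ^+ 2)%:E))%E.
Proof.
move=> mf f0.
have mfH : measurable_fun setT (f \_ H).
  by apply/(measurable_restrictT _ measurable_halfplane); exact: measurable_funTS.
have fH0 z : (0 <= (f \_ H) z)%E by rewrite patchE; case: ifP.
pose F y := (\int[leb]_x f (x, y))%E.
have F0 y : (0 <= F y)%E by apply: integral_ge0.
have mF : measurable_fun setT F.
  exact: (@measurable_fun_fubini_tonelli_G _ _ (measurableTypeR R) (measurableTypeR R) R leb f mf f0).
have m_of (a b : R * R -> R) : measurable_fun setT a -> measurable_fun setT b ->
    measurable_fun setT (fun z => f (a z, b z)).
  by move=> ma mb; apply: measurableT_comp => //; apply: measurable_fun_pair.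
rewrite (plane_iterated2 mfH fH0).
transitivity (\int[leb]_(y in `]0%R, +oo[) F y)%E.
  rewrite [RHS]integral_mkcond; apply: eq_integral => y _; rewrite patchE.
  have -> : (y \in `]0%R, +oo[%classic) = (0 < y).
    by apply/idP/idP; rewrite inE/= in_itv/= andbT.
  case: ifPn => y0.
    by apply: eq_integral => x _; rewrite patchE mem_set.
  apply: integral0_eq => x _; rewrite patchE ifF//.
  by apply/negP; rewrite inE; exact/negP.
rewrite ge0_integral_expR//.
pose k (z : R * R) := (f (expR z.1 * z.2, expR z.1)%R * (expR z.1 ^+ 2)%:E)%E.
have mk : measurable_fun setT k.
  by rewrite /k; mfun.
have k0 z : (0 <= k z)%E by rewrite mule_ge0// lee_fin sqr_ge0.
transitivity (\int[leb]_s \int[leb]_t k (s, t))%E.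
  apply: eq_integral => s _.
  have m1 : measurable_fun setT (fun x => f (x, expR s)).
    by mfun.
  have m2 : measurable_fun setT (fun t => f (expR s * t, expR s)%R).
    by mfun.
  rewrite /F (@ge0_integral_affine R _ (expR s) 0)//; last exact: expR_gt0.
  under eq_integral do rewrite addr0.
  have m3 : measurable_fun setT (fun t => f (expR s * t, expR s)%R * (expR s)%:E)%E by mfun.
  have k3 t : (0 <= f (expR s * t, expR s)%R * (expR s)%:E)%E.
    by rewrite mule_ge0// lee_fin expR_ge0.
  rewrite -ge0_integralZr//.
  by apply: eq_integral => t _; rewrite /k /= -muleA -EFinM -expr2.
rewrite -(plane_iterated1 mk k0) (plane_iterated2 mk k0).
pose g u := (\int[leb]_s (f (expR s * sin u, expR s * cos u)%R * (expR s ^+ 2)%:E))%E.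
have mg2 : measurable_fun setT (fun z : R * R =>
    (f (expR z.2 * sin z.1, expR z.2 * cos z.1)%R * (expR z.2 ^+ 2)%:E)%E).
  by mfun.
have mg : measurable_fun setT g.
  apply: (@measurable_fun_fubini_tonelli_F _ _ (measurableTypeR R) (measurableTypeR R) R leb _ mg2) => z.
  by rewrite mule_ge0// lee_fin sqr_ge0.
rewrite (@ge0_integral_atan R g)//; last first.
  by move=> u; apply: integral_ge0 => s _; rewrite mule_ge0// lee_fin sqr_ge0.
apply: eq_integral => t _.
have [ha ta] := atan_def t.
have c0 : 0 < cos (atan t) by exact: cos_gt0_pihalf.
have st : sin (atan t) = t * cos (atan t).
  by rewrite -{2}ta /tan divfK// gt_eqF.
have ct : (1 + t ^+ 2)^-1 = cos (atan t) ^+ 2.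
  by rewrite -{1}ta -cos2_tan2 ?gt_eqF// invrK.
have mu1 : measurable_fun setT (fun s => f (expR s * sin (atan t), expR s * cos (atan t))%R * (expR s ^+ 2)%:E)%E.
  by mfun.
have u0 s : (0 <= f (expR s * sin (atan t), expR s * cos (atan t))%R * (expR s ^+ 2)%:E)%E.
  by rewrite mule_ge0// lee_fin sqr_ge0.
have c20 : (0 <= (cos (atan t) ^+ 2)%:E)%E by rewrite lee_fin sqr_ge0.
rewrite /g ct -ge0_integralZr//.
have m1 : measurable_fun setT (fun s => k (s, t)) by apply: (measurableT_comp mk); mfun.
  rewrite (@ge0_integral_affine R _ 1 (ln (cos (atan t))))//.
  apply: eq_integral => s _; rewrite mule1 mul1r /k /= expRD lnK// st.
  by rewrite -muleA -EFinM exprMn [(expR s * _)%R as X in (X * t)%R]mulrC; congr (f (_, _) * _)%E; ring.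
Qed.

(** In logarithmic polar coordinates the inversion z -> 2 z / |z|^2 fixes the angle and is s -> ln 2
    - s, a reflection followed by a translation. *)
Lemma plane_inversion (f : R * R -> \bar R) :
  measurable_fun setT f -> (forall z, 0 <= f z)%E ->
  (\int[plane R]_z (f \_ H) z = \int[plane R]_z
    ((fun z => f ((z.1 ^+ 2 + z.2 ^+ 2)^-1 * 2 * z.1, (z.1 ^+ 2 + z.2 ^+ 2)^-1 * 2 * z.2)%R
      * (((z.1 ^+ 2 + z.2 ^+ 2)^-1 * 2) ^+ 2)%:E) \_ H) z)%E.
Proof.
move=> mf f0.
pose g (z : R * R) := (f ((z.1 ^+ 2 + z.2 ^+ 2)^-1 * 2 * z.1, (z.1 ^+ 2 + z.2 ^+ 2)^-1 * 2 * z.2)%R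
      * (((z.1 ^+ 2 + z.2 ^+ 2)^-1 * 2) ^+ 2)%:E)%E; rewrite -/g.
have mg : measurable_fun setT g.
  by rewrite /g; mfun.
have g0 z : (0 <= g z)%E by rewrite mule_ge0// lee_fin sqr_ge0.
rewrite (plane_polar mf f0) (plane_polar mg g0); apply: eq_integral => u _.
pose h s := (f (expR s * sin u, expR s * cos u)%R * (expR s ^+ 2)%:E)%E; rewrite -/h.
have mh : measurable_fun setT h.
  by rewrite /h; mfun.
have h0 s : (0 <= h s)%E by rewrite mule_ge0// lee_fin sqr_ge0.
rewrite (@ge0_integral_neg R h mh h0).
rewrite (@ge0_integral_affine R _ 1 (- ln 2))//; last exact: measurableT_comp.
apply: eq_integral => s _; rewrite mule1 mul1r /h /g opprD opprK expRD lnK ?posrE// expRN.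
have -> : ((expR s * sin u) ^+ 2 + (expR s * cos u) ^+ 2)^-1 = (expR s)^-1 ^+ 2.
  by rewrite !exprMn -mulrDr addrC cos2Dsin2 mulr1 exprVn.
have e0 : expR s != 0 by rewrite gt_eqF// expR_gt0.
by rewrite /= -muleA -EFinM; congr (f (_, _) * _%:E)%E; field.
Qed.
End polar.

Section disk_area.
Variable R : realType.
Let leb := @lebesgue_measure R.

Lemma measurable_disk : measurable (@disk R).
Proof.
have -> : @disk R = (fun z : R * R => z.1 ^+ 2 + z.2 ^+ 2 < 1) @^-1` [set true] by [].
by rewrite -[X in measurable X]setTI; apply: measurable_fun_ltr => //; mfun.
Qed.

(** This is 2 / |z + i|^2, the modulus of the derivative of [cay d] at z. *)
Definition cay_scale (z : R * R) : R := (z.1 ^+ 2 + (1 + z.2) ^+ 2)^-1 * 2.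

(* [e^(i d) (z - i) / (z + i)], from the upper half-plane to the disk *)
Definition cay (d : R) (z : R * R) : R * R :=
  let k := cay_scale z in
  (cos d * (1 - k * (1 + z.2)) + sin d * (k * z.1),
   sin d * (1 - k * (1 + z.2)) - cos d * (k * z.1)).

Definition logpolar (y0 : R) (s u : R) : R * R := (y0 + expR s * sin u, expR s * cos u).

Lemma cay_normE (d : R) (z : R * R) : 0 < z.1 ^+ 2 + (1 + z.2) ^+ 2 ->
  (cay d z).1 ^+ 2 + (cay d z).2 ^+ 2 = 1 - 2 * cay_scale z * z.2.
Proof.
move=> N0; rewrite /cay /=; set k := cay_scale z.
have kN : k * (z.1 ^+ 2 + (1 + z.2) ^+ 2) = 2.
  by rewrite /k /cay_scale mulrAC mulVf ?mul1r// gt_eqF.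
transitivity ((cos d ^+ 2 + sin d ^+ 2) * (1 - 2 * k * (1 + z.2) +
  k * (k * (z.1 ^+ 2 + (1 + z.2) ^+ 2)))); first by ring.
by rewrite kN cos2Dsin2; ring.
Qed.

(** Since (z - i) / (z + i) = 1 - 2 i / (z + i), the Cayley map is composed of rigid motions and one
    inversion: move e^(i d) to the origin, invert, lower by 1, then take polar coordinates about
    [y0]. *)
Lemma disk_area (d y0 : R) (f : R * R -> \bar R) :
  measurable_fun setT f -> (forall z, 0 <= f z)%E ->
  (\int[@area R]_(z in @disk R) f z =
   \int[leb]_(u in `](- (pi / 2))%R, (pi / 2)%R[) \int[leb]_s
     (f (cay d (logpolar y0 s u)) * ((cay_scale (logpolar y0 s u) * expR s) ^+ 2)%R%:E))%E.
Proof.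
move=> mf f0; set c := cos d; set sd := sin d.
have cs : c ^+ 2 + sd ^+ 2 = 1 by exact: cos2Dsin2.
have mH := measurable_halfplane (R := R).
set H := [set z : R * R | 0 < z.2] in mH *.
have mD := measurable_disk.
rewrite integral_area//.
pose g := f \_ (@disk R).
have mg : measurable_fun setT g.
  by apply/(measurable_restrictT _ mD); exact: measurable_funTS.
have g0 z : (0 <= g z)%E by rewrite /g patchE; case: ifP.
have gout z : ~ disk z -> g z = 0%E.
  by move=> hz; rewrite /g patchE ifF//; apply/negP; rewrite inE.
pose ga (z : R * R) := g (c + z.1, sd + z.2).
have mga : measurable_fun setT ga by rewrite /ga; mfun.
pose gb (z : R * R) := g (c + (sd * z.1 - (- c) * z.2), sd + ((- c) * z.1 + sd * z.2)).
have mgb : measurable_fun setT gb by rewrite /gb; mfun.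
pose g1 (z : R * R) := g (c * (1 - z.2) + sd * z.1, sd * (1 - z.2) - c * z.1).
have mg1 : measurable_fun setT g1 by rewrite /g1; mfun.
have e1 : (\int[plane R]_z g z = \int[plane R]_z g1 z)%E.
  rewrite (plane_translate c sd mg g0).
  have cs' : sd ^+ 2 + (- c) ^+ 2 = 1 by rewrite sqrrN addrC.
  rewrite (plane_rotate cs' mga (fun z => g0 _)).
  rewrite (plane_neg2 mgb (fun z => g0 _)).
  by apply: eq_integral => z _; rewrite /gb /g1 /=; congr (g (_, _)); ring.
(* [g1] lives on the disk of centre (0, 1) and radius 1, which lies in the upper half-plane and
   touches its boundary at 0. *)
have e2 : (\int[plane R]_z g1 z = \int[plane R]_z (g1 \_ H) z)%E.
  apply: eq_integral => z _; rewrite patchE; case: ifPn => // /negP; rewrite inE /H/= => hz.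
  rewrite /g1 gout// /disk /=; apply/negP; rewrite -leNgt.
  move/negP: hz; rewrite -leNgt => hz.
  suff -> : (c * (1 - z.2) + sd * z.1) ^+ 2 + (sd * (1 - z.2) - c * z.1) ^+ 2
     = (c ^+ 2 + sd ^+ 2) * ((1 - z.2) ^+ 2 + z.1 ^+ 2) by rewrite cs; nra.
  by ring.
pose g2 (z : R * R) := (g1 ((z.1 ^+ 2 + z.2 ^+ 2)^-1 * 2 * z.1, (z.1 ^+ 2 + z.2 ^+ 2)^-1 * 2 * z.2)%R
      * (((z.1 ^+ 2 + z.2 ^+ 2)^-1 * 2) ^+ 2)%:E)%E.
have mg2 : measurable_fun setT g2 by rewrite /g2; mfun.
have g20 z : (0 <= g2 z)%E by rewrite mule_ge0 ?lee_fin ?sqr_ge0// g0.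
have mg2H : measurable_fun setT (g2 \_ H).
  by apply/(measurable_restrictT _ mH); exact: measurable_funTS.
have g2H0 z : (0 <= (g2 \_ H) z)%E by rewrite patchE; case: ifP.
pose g3 (z : R * R) := (g (cay d (y0 + z.1, z.2)%R) * ((cay_scale (y0 + z.1, z.2)) ^+ 2)%R%:E)%E.
have mg3 : measurable_fun setT g3 by rewrite /g3 /cay /cay_scale /=; mfun.
have g30 z : (0 <= g3 z)%E by rewrite mule_ge0 ?lee_fin ?sqr_ge0// g0.
have e3 : (\int[plane R]_z (g1 \_ H) z = \int[plane R]_z (g3 \_ H) z)%E.
  rewrite (plane_inversion mg1 (fun z => g0 _)) -/g2.
  rewrite (plane_translate y0 1 mg2H g2H0).
  apply: eq_integral => z _; rewrite !patchE.
  have e32 : g2 (y0 + z.1, 1 + z.2) = g3 z.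
    rewrite /g2 /g3 /g1 /cay /cay_scale /=.
    by congr (g (_, _) * _)%E; rewrite -/c -/sd; ring.
  (* After lowering by 1 the half-plane starts at height -1. Points of height between -1 and 0
     correspond to points outside the disk, where [g] vanishes. *)
  case: ifPn => [/set_mem|/negP]; rewrite /H/= ?inE /=.
    move=> z1; case: ifPn => [//|/negP]; rewrite inE /= => /negP; rewrite -leNgt => z2.
    rewrite e32 /g3 gout ?mul0e// /disk /=; apply/negP; rewrite -leNgt.
    rewrite cay_normE/=; last by rewrite ltr_wpDl ?sqr_ge0// exprn_gt0.
    have : 0 <= cay_scale (y0 + z.1, z.2).
      by rewrite /cay_scale mulr_ge0// invr_ge0 addr_ge0 ?sqr_ge0.
    by nra.
  move=> z1; rewrite ifF//; apply/negP; rewrite inE /= => z2; apply: z1.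
  by rewrite addr_gt0.
rewrite -/g e1 e2 e3 (plane_polar mg3 g30).
apply: eq_integral => u /[!inE]/=; rewrite in_itv/= => hu.
have cu : 0 < cos u by exact: cos_gt0_pihalf.
apply: eq_integral => s _; rewrite /g3 /= -/(logpolar y0 s u).
rewrite -muleA -EFinM -exprMn; congr (_ * _)%E.
rewrite /g patchE mem_set//.
have y0' : 0 < expR s * cos u by rewrite mulr_gt0// expR_gt0.
have N0 : 0 < (logpolar y0 s u).1 ^+ 2 + (1 + (logpolar y0 s u).2) ^+ 2.
  by rewrite ltr_wpDl ?sqr_ge0// exprn_gt0//= addr_gt0.
have k0 : 0 < cay_scale (logpolar y0 s u) by rewrite /cay_scale mulr_gt0// invr_gt0.
rewrite /disk /= cay_normE// gtrDl oppr_lt0; apply: mulr_gt0 => //.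
exact: mulr_gt0.
Qed.
End disk_area.

(** * Lower bound for the width *)

Section cay_curve.
Variable R : realType.

(** Conformality: the Cayley map multiplies the length of a velocity by [cay_scale], whatever its
    direction. *)
Lemma is_derive_cay (d t x' y' : R) (x y : R -> R) :
  is_derive t (1 : R) x x' -> is_derive t (1 : R) y y' ->
  0 < x t ^+ 2 + (1 + y t) ^+ 2 ->
  exists D1 D2, [/\ is_derive t (1 : R) (fun t => (cay d (x t, y t)).1) D1,
    is_derive t (1 : R) (fun t => (cay d (x t, y t)).2) D2 &
    D1 ^+ 2 + D2 ^+ 2 = cay_scale (x t, y t) ^+ 2 * (x' ^+ 2 + y' ^+ 2)].
Proof.
move=> dx dy N0.
pose N t := x t ^+ 2 + (1 + y t) ^+ 2.
have Nn : N t != 0 by rewrite gt_eqF.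
pose N' := 2 * x t * x' + 2 * (1 + y t) * y'.
have dN : is_derive t (1 : R) N N'.
  by apply: is_derive_eq; rewrite /N' /GRing.scale/=; ring.
have dV : is_derive t (1 : R) (fun t => (N t)^-1) (- (N t) ^- 2 * N').
  exact: (@is_deriveV _ N t N' 1 Nn dN).
pose p' := - ((- (N t) ^- 2 * N' * 2) * (1 + y t) + (N t)^-1 * 2 * y').
pose q' := (- (N t) ^- 2 * N' * 2) * x t + (N t)^-1 * 2 * x'.
have dp : is_derive t (1 : R) (fun t => 1 - (N t)^-1 * 2 * (1 + y t)) p'.
  by apply: is_derive_eq; rewrite /p' /GRing.scale/=; ring.
have dq : is_derive t (1 : R) (fun t => (N t)^-1 * 2 * x t) q'.
  by apply: is_derive_eq; rewrite /q' /GRing.scale/=; ring.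
exists (cos d * p' + sin d * q'), (sin d * p' - cos d * q'); split.
- rewrite /cay /cay_scale /= -/N.
  by apply: is_derive_eq; rewrite /GRing.scale/=; ring.
- rewrite /cay /cay_scale /= -/N.
  by apply: is_derive_eq; rewrite /GRing.scale/=; ring.
transitivity ((cos d ^+ 2 + sin d ^+ 2) * (p' ^+ 2 + q' ^+ 2)); first by ring.
rewrite cos2Dsin2 mul1r /p' /q' /N' /cay_scale /=.
move: Nn; rewrite /N; move: (x t) (y t) => X Y Nn; field.
exact: Nn.
Qed.

(** Half-angle formulas with y = tan a. The real line covers the circle except for e^(i d), which
    corresponds to infinity. *)
Lemma cay_boundary (d y : R) : cay d (y, 0) = circ_pt (d - pi + 2 * atan y).
Proof.
have [ha ta] := atan_def y; set a := atan y in ha ta *.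
have ca : cos a != 0 by rewrite gt_eqF// cos_gt0_pihalf.
have ka : cay_scale (y, 0) = 2 * cos a ^+ 2.
  by rewrite /cay_scale /= addr0 expr1n addrC -ta -cos2_tan2// invrK mulrC.
have sa : y * cos a = sin a by rewrite -ta /tan divfK.
have k1 : cay_scale (y, 0) * (1 + 0) = 1 + cos (2 * a).
  by rewrite ka [in RHS]mulr_natl cos_mulr2n; ring.
have k2 : cay_scale (y, 0) * y = sin (2 * a).
  by rewrite ka [in RHS]mulr_natl sin_mulr2n -sa; ring.
rewrite /cay k1 k2 /circ_pt.
have -> : d - pi + 2 * a = (d + 2 * a) - pi by ring.
have cpi (x : R) : cos (x - pi) = - cos x.
  by rewrite -[in RHS](subrK pi x) cosDpi opprK.
have spi (x : R) : sin (x - pi) = - sin x.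
  by rewrite -[in RHS](subrK pi x) sinDpi opprK.
by rewrite cpi spi cosD sinD /=; congr (_, _); ring.
Qed.

Lemma MVT_le (f df : R -> R) (a b K : R) :
  (forall x, a <= x <= b -> is_derive x (1 : R) f (df x)) ->
  (forall x, a <= x <= b -> `|df x| <= K) ->
  forall s t, a <= s <= b -> a <= t <= b -> `|f s - f t| <= K * `|s - t|.
Proof.
move=> fdf dfK s t; wlog st : s t / s <= t.
  move=> H hs ht; have [/H|/ltW/H] := leP s t; first exact.
  by rewrite distrC [`|s - t|]distrC; apply.
move=> /andP[as_ sb] /andP[at_ tb].
have hab x : s <= x <= t -> a <= x <= b.
  by move=> /andP[sx xt]; rewrite (le_trans as_ sx) (le_trans xt tb).
have [c + E] : exists2 c, c \in `[s, t] & f t - f s = df c * (t - s).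
  apply: MVT_segment => //.
    by move=> x; rewrite in_itv/= => /andP[/ltW sx /ltW xt]; apply/fdf/hab/andP.
  apply: continuous_in_subspaceT => x /[!inE]/=; rewrite in_itv/= => /hab/fdf[+ _].
  by move=> /derivable1_diffP/differentiable_continuous.
rewrite in_itv/= => /hab hc.
by rewrite distrC E normrM [`|s - t|]distrC ler_wpM2r// dfK.
Qed.

Lemma sqr_norm_le (x y K : R) : 0 <= K -> x ^+ 2 + y ^+ 2 <= K ^+ 2 -> `|x| <= K.
Proof.
move=> K0 h; rewrite -(ger0_norm K0) -ler_sqr ?nnegrE// !real_normK ?num_real//.
by apply: le_trans h; rewrite lerDl sqr_ge0.
Qed.

Lemma dist2_le (z w : R * R) : dist2 z w <= `|z.1 - w.1| + `|z.2 - w.2|.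
Proof.
rewrite /dist2 -[leRHS]ger0_norm ?addr_ge0// -sqrtr_sqr ler_wsqrtr// [leRHS]sqrrD.
by rewrite !real_normK ?num_real// -addrAC lerDl mulrn_wge0// mulr_ge0.
Qed.

Variables (d y0 s : R).

(** The image of the half-circle of radius e^s about [y0], run from its left end to its right end at
    constant angular speed in the half-plane. *)
Definition cay_arc (t : R) : R * R := cay d (logpolar y0 s (pi * (t - 1 / 2))).

Let u (t : R) : R := pi * (t - 1 / 2).

Let u_itv (t : R) : 0 <= t <= 1 -> - (pi / 2) <= u t <= pi / 2.
Proof. by move=> /andP[t0 t1]; have := pi_gt0 R; rewrite /u; nra. Qed.

Let cos_ge0 (t : R) : 0 <= t <= 1 -> 0 <= cos (u t).
Proof. by move=> /u_itv; exact: cos_ge0_pihalf. Qed.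

Let den_ge1 (t : R) : 0 <= t <= 1 ->
  1 <= (logpolar y0 s (u t)).1 ^+ 2 + (1 + (logpolar y0 s (u t)).2) ^+ 2.
Proof.
move=> /cos_ge0 c0; have e0 := expR_gt0 s; rewrite /logpolar /=.
have : 0 <= expR s * cos (u t) by rewrite mulr_ge0// ltW.
by have := sqr_ge0 (y0 + expR s * sin (u t)); nra.
Qed.

Lemma cay_arc_derive (t : R) : 0 <= t <= 1 ->
  exists D1 D2, [/\ is_derive t (1 : R) (fun t => (cay_arc t).1) D1,
    is_derive t (1 : R) (fun t => (cay_arc t).2) D2 &
    D1 ^+ 2 + D2 ^+ 2 = (pi * (cay_scale (logpolar y0 s (u t)) * expR s)) ^+ 2].
Proof.
move=> t01; have N1 := den_ge1 t01.
have du : is_derive t (1 : R) u pi.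
  by apply: is_derive_eq; rewrite /GRing.scale/=; ring.
have dsin : is_derive t (1 : R) (fun t => sin (u t)) (cos (u t) * pi).
  exact: (@is_derive1_comp _ sin u).
have dcos : is_derive t (1 : R) (fun t => cos (u t)) (- sin (u t) * pi).
  exact: (@is_derive1_comp _ cos u).
have dx : is_derive t (1 : R) (fun t => y0 + expR s * sin (u t)) (expR s * (cos (u t) * pi)).
  by apply: is_derive_eq; rewrite /GRing.scale/=; ring.
have dy : is_derive t (1 : R) (fun t => expR s * cos (u t)) (expR s * (- sin (u t) * pi)).
  by apply: is_derive_eq; rewrite /GRing.scale/=; ring.
have [|D1 [D2 [d1 d2 dE]]] := is_derive_cay d dx dy; first exact: lt_le_trans N1.
exists D1, D2; split=> //; rewrite dE.
transitivity (cay_scale (logpolar y0 s (u t)) ^+ 2 * expR s ^+ 2 * pi ^+ 2 *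
   (cos (u t) ^+ 2 + sin (u t) ^+ 2)); first by rewrite /logpolar; ring.
by rewrite cos2Dsin2; ring.
Qed.

Lemma cay_scale_arc_bound (t : R) : 0 <= t <= 1 ->
  0 < cay_scale (logpolar y0 s (u t)) <= 2.
Proof.
move=> /den_ge1 N1; rewrite /cay_scale; set N := (_ + _).
have N0 : 0 < N by exact: lt_le_trans N1.
by rewrite mulr_gt0 ?invr_gt0//= ler_piMl// invf_le1.
Qed.

Lemma speed_cay_arc (t : R) : 0 < t < 1 ->
  speed cay_arc t = pi * (cay_scale (logpolar y0 s (u t)) * expR s).
Proof.
move=> /andP[t0 t1]; have t01 : 0 <= t <= 1 by rewrite !ltW.
have [D1 [D2 [d1 d2 dE]]] := cay_arc_derive t01.
rewrite /speed !derive1E.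
have -> : 'D_1 (fst \o cay_arc) t = D1 by exact: derive_val.
have -> : 'D_1 (snd \o cay_arc) t = D2 by exact: derive_val.
have /andP[k0 _] := cay_scale_arc_bound t01.
rewrite dE sqrtr_sqr ger0_norm//; apply: mulr_ge0; first exact: pi_ge0.
by apply: mulr_ge0; [exact: ltW|exact: expR_ge0].
Qed.

Lemma cay_arc_path (E F : set (R * R)) :
  E (cay d (y0 - expR s, 0)) -> F (cay d (y0 + expR s, 0)) ->
  path_joining E F cay_arc.
Proof.
move=> hE hF; split.
- apply: continuous_in_subspaceT => t /[!inE]/=; rewrite in_itv/= => /cay_arc_derive.
  move=> [D1 [D2 [[d1 _] [d2 _] _]]].
  have c1 := differentiable_continuous ((derivable1_diffP _ _).1 d1).
  have c2 := differentiable_continuous ((derivable1_diffP _ _).1 d2).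
  have -> : cay_arc = (fun t => ((cay_arc t).1, (cay_arc t).2)).
    by apply/funext => t'; case: (cay_arc t').
  exact: (cvg_pair c1 c2).
- rewrite /cay_arc /logpolar.
  have -> : pi * (0 - 1 / 2) = - (pi / 2) :> R by field.
  by rewrite sinN cosN sin_pihalf cos_pihalf mulr0 mulrN1.
- rewrite /cay_arc /logpolar.
  have -> : pi * (1 - 1 / 2) = pi / 2 :> R by field.
  by rewrite sin_pihalf cos_pihalf mulr0 mulr1.
- move=> t /andP[t0 t1]; have t01 : 0 <= t <= 1 by rewrite !ltW.
  have /andP[k0 _] := cay_scale_arc_bound t01.
  rewrite /disk /cay_arc /= cay_normE; last exact: lt_le_trans (den_ge1 t01).
  rewrite gtrDl oppr_lt0; apply: mulr_gt0; first exact: mulr_gt0.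
  rewrite /logpolar /= mulr_gt0 ?expR_gt0// cos_gt0_pihalf//.
  by have := pi_gt0 R; nra.
- move=> c e c0 e1.
  pose K := 2 * pi * expR s : R.
  have K0 : 0 <= K by rewrite !mulr_ge0 ?pi_ge0 ?expR_ge0.
  have ce01 x : c <= x <= e -> 0 <= x <= 1.
    by move=> /andP[cx xe]; rewrite (le_trans (ltW c0) cx) (le_trans xe (ltW e1)).
  have dK t : 0 <= t <= 1 -> (derive1 (fst \o cay_arc) t) ^+ 2 + (derive1 (snd \o cay_arc) t) ^+ 2 <= K ^+ 2.
    move=> t01; have [D1 [D2 [d1 d2 dE]]] := cay_arc_derive t01.
    rewrite !derive1E.
    have -> : 'D_1 (fst \o cay_arc) t = D1 by exact: derive_val.
    have -> : 'D_1 (snd \o cay_arc) t = D2 by exact: derive_val.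
    rewrite dE; have /andP[k0 k2] := cay_scale_arc_bound t01.
    rewrite ler_sqr ?nnegrE//; last first.
      apply: mulr_ge0; first exact: pi_ge0.
      by apply: mulr_ge0; [exact: ltW|exact: expR_ge0].
    rewrite /K -mulrA [2 * _]mulrCA ler_wpM2l ?pi_ge0// ler_wpM2r ?expR_ge0//.
  have L1 := @MVT_le (fst \o cay_arc) (derive1 (fst \o cay_arc)) c e K.
  have L2 := @MVT_le (snd \o cay_arc) (derive1 (snd \o cay_arc)) c e K.
  exists (K + K) => x y hx hy; apply: (le_trans (dist2_le _ _)); rewrite mulrDl lerD//.
    apply: (L1 _ _ x y hx hy) => z /ce01 hz.
      rewrite derive1E; apply: derivableP.
      by have [D1 [D2 [[]]]] := cay_arc_derive hz.
    exact: sqr_norm_le (dK _ hz).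
  apply: (L2 _ _ x y hx hy) => z /ce01 hz.
    rewrite derive1E; apply: derivableP.
    by have [D1 [D2 [_ []]]] := cay_arc_derive hz.
  by apply: (sqr_norm_le (y := derive1 (fst \o cay_arc) z)) => //; rewrite addrC dK.
Qed.
End cay_curve.

Section width_lower_bound.
Variable R : realType.
Let leb := @lebesgue_measure R.

(** Cauchy-Schwarz on an interval of length 1, in the form 2 F <= F^2 + 1, which stays meaningful
    for infinite values. *)
Lemma sqr_integral01_ge1 (F : R -> \bar R) :
  measurable_fun setT F -> (forall t, 0 <= F t)%E ->
  (1 <= \int[leb]_(t in `]0%R, 1%R[) F t)%E ->
  (1 <= \int[leb]_(t in `]0%R, 1%R[) (F t * F t))%E.
Proof.
move=> mF F0 F1.
have mF2 : measurable_fun setT (fun t => F t * F t)%E by mfun.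
have m1 : measurable (`]0, 1[%classic : set R) by exact: measurable_itv.
have F20 t : (0 <= F t * F t)%E by rewrite mule_ge0.
have l1 : (\int[leb]_(t in `]0%R, 1%R[) (1 : \bar R) = 1)%E.
  rewrite integral_cst// mul1e; apply: (etrans (lebesgue_measure_itv _)).
  by rewrite /= lte_fin ltr01 oppr0 adde0.
rewrite -(@leeD2rE _ 1%E)//.
rewrite -[X in (_ <= _ + X)%E]l1 -ge0_integralD//; last first.
  exact: measurable_funTS.
apply: (@le_trans _ _ (\int[leb]_(t in `]0%R, 1%R[) (2%:E * F t))%E).
  rewrite ge0_integralZl//; last exact: measurable_funTS.
  rewrite -EFinD (_ : 1 + 1 = 2 * 1 :> R)%R; last by rewrite mulr1.
  by rewrite EFinM lee_pmul2l.
apply: ge0_le_integral => //.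
- by move=> t _; rewrite mule_ge0.
- by apply: measurable_funTS; mfun.
- by apply: measurable_funTS; apply: emeasurable_funD.
- move=> t _; have := F0 t; case: (F t) => [x| |]//= _.
    by rewrite -!EFinM -EFinD lee_fin; have := sqr_ge0 (x - 1); nra.
  by rewrite mulyy addye// leey.
Qed.

(** The length-area method. As [q] and [r] are at the same distance [l] from [y0], each half-circle
    of radius between [l] and [L] joins [[p, q]] to [[r, +oo[]. *)
Lemma width_ge (d p q r : R) (E F : set (R * R)) :
  q < r -> p < q ->
  (forall y, p <= y <= q -> E (cay d (y, 0))) ->
  (forall y, r <= y -> F (cay d (y, 0))) ->
  ((ln (((q + r) / 2 - p) / ((r - q) / 2)) / pi)%:E <= width (path_joining E F))%E.
Proof.
move=> qr pq hE hF; set y0 := (q + r) / 2; set l := (r - q) / 2; set L := y0 - p.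
have l0 : 0 < l by rewrite /l; lra.
have L0 : 0 < L by rewrite /L /y0; lra.
have lL : l < L by rewrite /l /L /y0; lra.
have pi0 := pi_gt0 R.
apply: le_ereal_inf_tmp => _ [rho [mrho rho0 adm] <-].
pose G s u := (rho (cay d (logpolar y0 s u)) * (cay_scale (logpolar y0 s u) * expR s)%R%:E)%E.
have mG2 : measurable_fun setT (fun z : R * R => (G z.1 z.2 * G z.1 z.2)%E).
  by rewrite /G /cay /logpolar /cay_scale /=; mfun.
have sq_ge0 (x : \bar R) : (0 <= x * x)%E.
  by case: x => [x| |]//; rewrite -EFinM lee_fin -expr2 sqr_ge0.
have mrr : measurable_fun setT (fun z => rho z * rho z)%E by exact: emeasurable_funM.
rewrite (disk_area d y0 mrr (fun z => sq_ge0 _)).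
(* The restriction on the angle is moved into the integrand, so that the order of integration can be
   exchanged on the whole plane. *)
pose K (z : R * R) := ((fun u => G z.1 u * G z.1 u)%E \_ (`](- (pi / 2)), (pi / 2)[%classic : set R)) z.2.
have mU : measurable (`](- (pi / 2)), (pi / 2)[%classic : set R) by exact: measurable_itv.
have mK : measurable_fun setT K.
  have -> : K = (fun z : R * R => G z.1 z.2 * G z.1 z.2)%E \_
      (snd @^-1` (`](- (pi / 2)), (pi / 2)[%classic : set R)).
    by apply/funext => z; rewrite /K !patchE.
  have mS : measurable (snd @^-1` (`](- (pi / 2)), (pi / 2)[%classic : set R) : set (R * R)).
    by rewrite -[X in measurable X]setTI; exact: measurable_snd.
  by apply/(measurable_restrictT _ mS); exact: measurable_funTS mG2.
have K0 z : (0 <= K z)%E by rewrite /K patchE; case: ifP.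
have -> : (\int[leb]_(u in `](- (pi / 2))%R, (pi / 2)%R[) \int[leb]_s
     (rho (cay d (logpolar y0 s u)) * rho (cay d (logpolar y0 s u)) *
      ((cay_scale (logpolar y0 s u) * expR s) ^+ 2)%R%:E) =
    \int[leb]_u \int[leb]_s K (s, u))%E.
  rewrite integral_mkcond; apply: eq_integral => u _; rewrite patchE /K.
  case: ifPn => hu.
    apply: eq_integral => s _; rewrite patchE /= hu /G.
    by rewrite expr2 EFinM muleACA.
  by rewrite integral0_eq// => s _; rewrite patchE /= (negbTE hu).
rewrite -(plane_iterated2 mK K0) (plane_iterated1 mK K0).
have mKs : measurable_fun setT (fun s => \int[leb]_u K (s, u))%E.
  exact: (@measurable_fun_fubini_tonelli_F _ _ (measurableTypeR R) (measurableTypeR R) R leb K mK K0).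
(* A half-circle has angular length pi and [rho]-length at least 1, so by Cauchy-Schwarz each radius
   contributes at least 1 / pi. *)
apply: (@le_trans _ _ (\int[leb]_(s in `]ln l, ln L[) (pi^-1)%:E)%E).
  have lE : leb (`]ln l, ln L[%classic : set R) = (ln L - ln l)%:E.
    by apply: (etrans (lebesgue_measure_itv _)); rewrite /= lte_fin ltr_ln ?posrE// lL.
  rewrite integral_cst//; apply: (@le_trans _ _ ((pi^-1)%:E * (ln L - ln l)%:E)%E).
    by rewrite -EFinM lee_fin mulrC ln_div.
  by rewrite -lE.
rewrite [leLHS]integral_mkcond.
apply: le_integral_ge0 => //.
- by move=> s _; rewrite patchE; case: ifP => // _; rewrite lee_fin invr_ge0 ltW.
- by move=> s _; apply: integral_ge0.
move=> s _; rewrite patchE; case: ifPn => hs; last exact: integral_ge0.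
move: hs; rewrite inE /= in_itv/= => /andP[ls sL].
have el : l < expR s by rewrite -ltr_ln ?posrE ?expR_gt0// expRK.
have eL : expR s < L by rewrite -ltr_ln ?posrE ?expR_gt0// expRK.
have path : path_joining E F (cay_arc d y0 s).
  apply: cay_arc_path; first apply: hE; last apply: hF.
    by move: el eL; rewrite /l /L /y0 => ? ?; apply/andP; split; lra.
  by move: el; rewrite /l /y0 => ?; lra.
have := adm _ path; rewrite /rho_length.
pose Fs t := (pi%:E * G s (pi * (t - 1 / 2))%R)%E.
have mFs : measurable_fun setT Fs.
  by rewrite /Fs /G /cay /logpolar /cay_scale /=; mfun.
have cos0 (t : R) : 0 < t < 1 -> 0 < cos (pi * (t - 1 / 2)).
  by move=> /andP[t0 t1]; rewrite cos_gt0_pihalf//; nra.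
pose Fa t := `|Fs t|%E.
have mFa : measurable_fun setT Fa by apply: measurableT_comp.
have FaE : (\int[leb]_(t in `]0%R, 1%R[) (rho (cay_arc d y0 s t) * (speed (cay_arc d y0 s) t)%:E) =
    \int[leb]_(t in `]0%R, 1%R[) Fa t)%E.
  apply: eq_integral => t; rewrite inE/= in_itv/= => t01.
  rewrite speed_cay_arc// /Fa /Fs /G /cay_arc.
  rewrite gee0_abs; first by rewrite EFinM muleCA.
  apply: mule_ge0; first by rewrite lee_fin ltW.
  apply: mule_ge0; first exact: rho0.
  rewrite lee_fin; apply: mulr_ge0; last exact: expR_ge0.
  have t01' : 0 <= t <= 1 by case/andP: t01 => t0 t1; rewrite !ltW.
  by have /andP[/ltW] := cay_scale_arc_bound y0 s t01'.
rewrite FaE => /(sqr_integral01_ge1 mFa (fun t => abse_ge0 _)) H1.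
pose k u := K (s, u).
have mk : measurable_fun setT k by apply: (measurableT_comp mK); exact: pair1_measurable.
have k0 u : (0 <= k u)%E by exact: K0.
rewrite (@ge0_integral_affine R k pi (- (pi / 2)))//.
have kk0 t : (0 <= k (pi * t + - (pi / 2))%R)%E by exact: K0.
have mkk : measurable_fun setT (fun t => k (pi * t + - (pi / 2))%R) by mfun.
rewrite ge0_integralZr//; last by rewrite lee_fin ltW.
have H2 : (1 <= (pi ^+ 2)%:E * \int[leb]_t k (pi * t + - (pi / 2))%R)%E.
  apply: (le_trans H1); rewrite -ge0_integralZl//; last by rewrite lee_fin sqr_ge0.
  apply: le_integral_ge0 => //.
  - by move=> t _; rewrite mule_ge0 ?lee_fin ?sqr_ge0// /k K0.
  move=> t; rewrite /= in_itv/= => /andP[t0 t1].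
  have -> : pi * t + - (pi / 2) = pi * (t - 1 / 2) by field.
  rewrite /k /K patchE mem_set /=; last by rewrite in_itv/=; apply/andP; split; nra.
  rewrite /Fa /Fs abseM muleACA -abseM -abseM gee0_abs; last exact: sq_ge0.
  by rewrite gee0_abs ?sq_ge0// expr2 EFinM.
move: H2; set I := (\int[leb]_t _)%E => H2.
have I0 : (0 <= I)%E by apply: integral_ge0.
case: I H2 I0 => [x| |] H2 I0; [|by rewrite gt0_mulye ?lte_fin// leey|by []].
move: H2 I0; rewrite -!EFinM !lee_fin => H2 x0.
by rewrite -[pi^-1]mulr1 ler_pdivrMl//; move: H2; rewrite expr2; nra.
Qed.
End width_lower_bound.

(** * Upper bound for the width *)

Section lipschitz_calculus.
Variables (R : realType) (c e : R).
Implicit Types f h : R -> R.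

Definition lip f : Prop := exists K : R, forall s t, c <= s <= e -> c <= t <= e ->
  `|f s - f t| <= K * `|s - t|.

Lemma lip_ge0 f : lip f -> exists2 K : R, 0 <= K &
  forall s t, c <= s <= e -> c <= t <= e -> `|f s - f t| <= K * `|s - t|.
Proof.
move=> [K HK]; exists `|K| => // s t hs ht; apply: (le_trans (HK s t hs ht)).
by rewrite ler_wpM2r// ler_norm.
Qed.

Lemma lip_bounded f : lip f -> exists2 B : R, 0 <= B & forall t, c <= t <= e -> `|f t| <= B.
Proof.
move=> /lip_ge0[K K0 HK]; have [ce|ec] := leP c e; last first.
  by exists 0 => // t /andP[ct te]; have := le_lt_trans (le_trans ct te) ec; rewrite ltxx.
exists (`|f c| + K * (e - c)).
  by rewrite addr_ge0// mulr_ge0// subr_ge0.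
move=> t /andP[ct te]; rewrite -[f t](subrK (f c)) addrC.
apply: (le_trans (ler_normD _ _)); rewrite lerD2l.
apply: (le_trans (HK _ _ _ _)); rewrite ?lexx ?ct ?te ?ce//.
by rewrite ler_wpM2l// ger0_norm ?subr_ge0// lerD2r.
Qed.

Lemma lip_cst k : lip (fun=> k).
Proof. by exists 0 => s t _ _; rewrite subrr normr0 mul0r. Qed.

Lemma lipD f h : lip f -> lip h -> lip (fun t => f t + h t).
Proof.
move=> [K HK] [K' HK']; exists (K + K') => s t hs ht.
have -> : f s + h s - (f t + h t) = (f s - f t) + (h s - h t) by ring.
by apply: (le_trans (ler_normD _ _)); rewrite mulrDl lerD ?HK ?HK'.
Qed.

Lemma lipN f : lip f -> lip (fun t => - f t).
Proof.
by move=> [K HK]; exists K => s t hs ht; rewrite -opprD normrN HK.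
Qed.

Lemma lipB f h : lip f -> lip h -> lip (fun t => f t - h t).
Proof. by move=> lf lh; apply: lipD => //; exact: lipN. Qed.

Lemma lipM f h : lip f -> lip h -> lip (fun t => f t * h t).
Proof.
move=> lf lh; have [A A0 HA] := lip_bounded lf; have [B B0 HB] := lip_bounded lh.
have [K K0 HK] := lip_ge0 lf; have [K' K'0 HK'] := lip_ge0 lh.
exists (K * B + A * K') => s t hs ht.
have -> : f s * h s - f t * h t = (f s - f t) * h s + f t * (h s - h t) by ring.
apply: (le_trans (ler_normD _ _)); rewrite !normrM mulrDl lerD//.
  by rewrite mulrAC ler_pM ?HK ?HB.
by rewrite -mulrA ler_pM ?HA ?HK'.
Qed.

Lemma lip_comp f h dh (A B K : R) :
  (forall x, A <= x <= B -> is_derive x (1 : R) h (dh x)) ->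
  (forall x, A <= x <= B -> `|dh x| <= K) ->
  (forall t, c <= t <= e -> A <= f t <= B) -> lip f -> lip (fun t => h (f t)).
Proof.
move=> hdh dhK fAB /lip_ge0[K' K'0 HK']; exists (`|K| * K') => s t hs ht.
apply: (le_trans (MVT_le hdh dhK (fAB _ hs) (fAB _ ht))).
rewrite -mulrA; apply: (@le_trans _ _ (`|K| * `|f s - f t|)).
  by rewrite ler_wpM2r// ler_norm.
by rewrite ler_wpM2l// HK'.
Qed.

Lemma lip_continuous f : lip f -> {within `[c, e], continuous f}.
Proof.
move=> /lip_ge0[K K0 HK]; apply/subspace_continuousP => x /=; rewrite in_itv/= => xce.
apply/cvgrPdist_le => eps eps0.
have K1 : 0 < K + 1 by lra.
have d0 : 0 < eps / (K + 1) by rewrite divr_gt0.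
have N : \forall y \near x, `|x - y| < eps / (K + 1).
  by apply/nbhs_ballP; exists (eps / (K + 1)).
rewrite near_withinE; apply: filterS N => y xy; rewrite /= in_itv/= => yce.
apply: (le_trans (HK _ _ xce yce)).
apply: (@le_trans _ _ ((K + 1) * `|x - y|)); first by rewrite ler_wpM2r//; lra.
by rewrite mulrC -ler_pdivlMr//; exact: ltW.
Qed.

Lemma lip_pos f : c <= e -> lip f -> (forall t, c <= t <= e -> 0 < f t) ->
  exists2 A : R, 0 < A & exists B, forall t, c <= t <= e -> A <= f t <= B.
Proof.
move=> ce lf f0.
have [x xce xmin] := EVT_min ce (lip_continuous lf).
have [B B0 HB] := lip_bounded lf.
exists (f x); first by apply: f0; move: xce; rewrite in_itv.
exists B => t tce; rewrite xmin ?in_itv//=.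
by rewrite (le_trans (ler_norm _))// HB.
Qed.

Lemma lipV f : c <= e -> lip f -> (forall t, c <= t <= e -> 0 < f t) ->
  lip (fun t => (f t)^-1).
Proof.
move=> ce lf f0; have [A A0 [B HAB]] := lip_pos ce lf f0.
apply: (@lip_comp f (fun x => x^-1) (fun x => - x ^- 2 * 1) A B (A ^- 2)) => //.
- move=> x /andP[Ax xB]; apply: (@is_deriveV _ id x 1 1).
  by rewrite gt_eqF//; exact: lt_le_trans Ax.
- move=> x /andP[Ax xB]; have x0 : 0 < x by exact: lt_le_trans Ax.
  rewrite mulr1 normrN ger0_norm ?invr_ge0 ?sqr_ge0//.
  have xx : 0 < x ^+ 2 by rewrite exprn_gt0.
  have AA : 0 < A ^+ 2 by rewrite exprn_gt0.
  by rewrite lef_pV2 ?posrE// ler_sqr ?nnegrE// ltW.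
Qed.

Lemma lip_ln f : c <= e -> lip f -> (forall t, c <= t <= e -> 0 < f t) ->
  lip (fun t => ln (f t)).
Proof.
move=> ce lf f0; have [A A0 [B HAB]] := lip_pos ce lf f0.
apply: (@lip_comp f (@ln R) (fun x => x^-1) A B A^-1) => //.
- by move=> x /andP[Ax xB]; apply: is_derive1_ln; exact: lt_le_trans Ax.
- move=> x /andP[Ax xB]; have x0 : 0 < x by exact: lt_le_trans Ax.
  rewrite ger0_norm; first by rewrite lef_pV2 ?posrE.
  by rewrite invr_ge0 ltW.
Qed.

Lemma lip_expR f : lip f -> lip (fun t => expR (f t)).
Proof.
move=> lf; have [B B0 HB] := lip_bounded lf.
apply: (@lip_comp f expR expR (- B) B (expR B)) => //.
- by move=> x /andP[_ xB]; rewrite ger0_norm ?expR_ge0// ler_expR.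
- by move=> t /HB; rewrite ler_norml.
Qed.

Lemma lip_atan f : lip f -> lip (fun t => atan (f t)).
Proof.
move=> lf; have [B B0 HB] := lip_bounded lf.
apply: (@lip_comp f (@atan R) (fun x => (1 + x ^+ 2)^-1) (- B) B 1) => //.
- move=> x _; have h := sqr_ge0 x.
  by rewrite ger0_norm ?invr_ge0 ?addr_ge0// invf_le1 ?lerDl// ltr_wpDr.
- by move=> t /HB; rewrite ler_norml.
Qed.

Lemma lip_min1 f : lip f -> lip (fun t => Num.min (f t) 1).
Proof.
move=> [K HK]; exists K => s t hs ht; apply: le_trans (HK s t hs ht).
rewrite !minEle; have [h1|h1] := leP (f s) 1; have [h2|h2] := leP (f t) 1 => //.
- by rewrite ler_norml; have := ler_norm (f s - f t); have := ler_norm (f t - f s);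
    rewrite distrC => ? ?; apply/andP; split; lra.
- by rewrite ler_norml; have := ler_norm (f s - f t); have := ler_norm (f t - f s);
    rewrite distrC => ? ?; apply/andP; split; lra.
- by rewrite subrr normr0.
Qed.

End lipschitz_calculus.

(** The cutoffs have corners. Where a minimum is derivable at a crossing, its derivative is still
    that of one of the branches, so gradient bounds can be checked branch by branch on closed
    pieces. *)
Lemma derive_min_cases (R : realType) (f h : R -> R) (t f' h' : R) :
  is_derive t (1 : R) f f' -> is_derive t (1 : R) h h' ->
  derivable (fun t => Num.min (f t) (h t)) t 1 ->
  (f t <= h t /\ derive1 (fun t => Num.min (f t) (h t)) t = f') \/
  (h t <= f t /\ derive1 (fun t => Num.min (f t) (h t)) t = h').
Proof.
move=> df dh dm; set m := (fun t => _) in dm *; rewrite derive1E.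
have cont (g : R -> R) g' : is_derive t (1 : R) g g' -> g x @[x --> t] --> g t.
  by move=> [+ _]; move=> /derivable1_diffP/differentiable_continuous.
have dfh : is_derive t (1 : R) (fun x => f x - h x) (f' - h') by exact: is_deriveB.
have dhf : is_derive t (1 : R) (fun x => h x - f x) (h' - f') by exact: is_deriveB.
have lt_near (g : R -> R) g' : is_derive t (1 : R) g g' -> g t < 0 -> \forall x \near t, g x < 0.
  by move=> /cont + g0; move=> /cvgr_lt; apply.
case: (ltP (f t) (h t)) => [fh|].
  left; split; first exact: ltW.
  have := lt_near _ _ dfh; rewrite subr_lt0 => /(_ fh) N.
  apply: derive_val; apply: (near_eq_is_derive _ df).
  by apply: filterS N => x; rewrite subr_lt0 /m minEle => /ltW ->.
rewrite le_eqVlt => /orP[/eqP hf|hf].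
  have dmf : is_derive t (1 : R) (fun x => m x - f x) ('D_1 m t - f').
    by apply: is_deriveB => //; exact: derivableP.
  have dmh : is_derive t (1 : R) (fun x => m x - h x) ('D_1 m t - h').
    by apply: is_deriveB => //; exact: derivableP.
  (* [m] equals [f] or [h] at every point, so the difference quotients of
     [m - f] and [m - h] have product [0]. *)
  suff : ('D_1 m t - f') * ('D_1 m t - h') = 0.
    move=> /eqP; rewrite mulf_eq0 !subr_eq0 => /orP[/eqP ->|/eqP ->].
      by left; rewrite hf.
    by right.
  have cvgq (g : R -> R) g' : is_derive t (1 : R) g g' ->
      (fun k : R => k^-1 * (g (k + t) - g t)) @ 0^' --> g'.
    move=> [dg <-]; have := dg; rewrite /derivable /derive => cg.
    apply: cvg_trans cg; apply: near_eq_cvg; near=> k.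
    by rewrite /= /GRing.scale/= mulr1.
  have q0 k : (k^-1 * (m (k + t) - f (k + t) - (m t - f t))) *
      (k^-1 * (m (k + t) - h (k + t) - (m t - h t))) = 0.
    have -> : m t - f t = 0 by rewrite /m hf minxx subrr.
    have -> : m t - h t = 0 by rewrite /m hf minxx subrr.
    by rewrite /m !subr0 minEle; case: ifP => _; rewrite subrr ?mulr0 ?mul0r.
  have H : (0 : R) @[_ --> (0 : R)^'] --> ('D_1 m t - f') * ('D_1 m t - h').
    apply: cvg_trans (cvgM (cvgq _ _ dmf) (cvgq _ _ dmh)).
    by apply: near_eq_cvg; near=> k; rewrite /= q0.
  by apply: (cvg_unique _ H (cvg_cst 0)); exact: norm_hausdorff.
right; split => //.
have := lt_near _ _ dhf; rewrite subr_lt0 => /(_ hf) N.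
apply: derive_val; apply: (near_eq_is_derive _ dh).
by apply: filterS N => x; rewrite subr_lt0 /m minEge => /ltW ->.
Unshelve. all: by end_near. Qed.

Lemma derivable_is_derive1 (R : realType) (f : R -> R) (t : R) :
  derivable f t 1 -> is_derive t (1 : R) f (derive1 f t).
Proof. by move=> df; rewrite derive1E; exact: derivableP. Qed.

(** * The inverse Cayley map in logarithmic polar coordinates *)

Section inverse_cayley.
Variables (R : realType) (d y0 : R).
Implicit Types w z : R * R.

(** With v = e^(-i d) w this is |1 - v|^2; [cinv_x] and [cinv_y] are the real and imaginary parts of
    i (1 + v) / (1 - v), the inverse of [cay d]. *)
Definition cinv_den w : R :=
  (1 - (w.1 * cos d + w.2 * sin d)) ^+ 2 + (w.2 * cos d - w.1 * sin d) ^+ 2.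
Definition cinv_x w : R := - (2 * (w.2 * cos d - w.1 * sin d)) / cinv_den w.
Definition cinv_y w : R := 2 * (1 - (w.1 * cos d + w.2 * sin d)) / cinv_den w - 1.
Definition cinv_rad2 w : R := (cinv_x w - y0) ^+ 2 + cinv_y w ^+ 2.
Definition cinv_lograd w : R := ln (cinv_rad2 w) / 2.
Definition cinv_angle w : R := atan ((cinv_x w - y0) / cinv_y w).

Lemma cinv_denE w : cinv_den w = (w.1 - cos d) ^+ 2 + (w.2 - sin d) ^+ 2.
Proof.
rewrite /cinv_den; have := cos2Dsin2 d; move: (cos d) (sin d) => c s cs.
transitivity ((c ^+ 2 + s ^+ 2) * (w.1 ^+ 2 + w.2 ^+ 2) - 2 * (w.1 * c + w.2 * s) + 1).
  by ring.
by rewrite cs mul1r -[X in _ + X = _]cs; ring.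
Qed.

Lemma cinv_den_gt0 w : w != (cos d, sin d) -> 0 < cinv_den w.
Proof.
move=> wd; rewrite cinv_denE lt_def addr_ge0 ?sqr_ge0// andbT.
rewrite paddr_eq0 ?sqr_ge0// !sqrf_eq0 !subr_eq0; apply: contra wd => /andP[/eqP a /eqP b].
by rewrite -a -b; case: w {a b}.
Qed.

Lemma cinv_yE w : 0 < cinv_den w ->
  cinv_y w = (1 - (w.1 ^+ 2 + w.2 ^+ 2)) / cinv_den w.
Proof.
move=> N0; have Nn : cinv_den w != 0 by rewrite gt_eqF.
rewrite /cinv_y; apply: (mulIf Nn); rewrite mulrBl !divfK// mul1r /cinv_den.
have := cos2Dsin2 d; move: (cos d) (sin d) => c s cs.
transitivity (1 - (c ^+ 2 + s ^+ 2) * (w.1 ^+ 2 + w.2 ^+ 2)); first by ring.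
by rewrite cs mul1r.
Qed.

Lemma cinv_y_gt0 w : disk w -> 0 < cinv_den w /\ 0 < cinv_y w.
Proof.
rewrite /disk /= => wd.
have N0 : 0 < cinv_den w.
  apply: cinv_den_gt0; apply/eqP => wE; move: wd; rewrite wE /=.
  by rewrite cos2Dsin2 ltxx.
by split=> //; rewrite cinv_yE// divr_gt0// subr_gt0.
Qed.

Lemma cinv_cay z : 0 < z.1 ^+ 2 + (1 + z.2) ^+ 2 ->
  [/\ cinv_den (cay d z) = 2 * cay_scale z, cinv_x (cay d z) = z.1 & cinv_y (cay d z) = z.2].
Proof.
move=> N0; have Nn : z.1 ^+ 2 + (1 + z.2) ^+ 2 != 0 by rewrite gt_eqF.
have k0 : cay_scale z != 0 by rewrite /cay_scale mulf_neq0 ?invr_eq0// gt_eqF.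
have kN : cay_scale z * (z.1 ^+ 2 + (1 + z.2) ^+ 2) = 2.
  by rewrite /cay_scale mulrAC mulVf ?mul1r.
have cs := cos2Dsin2 d.
have e1 : 1 - ((cay d z).1 * cos d + (cay d z).2 * sin d) = cay_scale z * (1 + z.2).
  rewrite /cay /=; move: cs (cay_scale z) => + k.
  move: (cos d) (sin d) => c s cs.
  transitivity (1 - (c ^+ 2 + s ^+ 2) * (1 - k * (1 + z.2))); first by ring.
  by rewrite cs; ring.
have e2 : (cay d z).2 * cos d - (cay d z).1 * sin d = - (cay_scale z * z.1).
  rewrite /cay /=; move: cs (cay_scale z) => + k.
  move: (cos d) (sin d) => c s cs.
  transitivity (- ((c ^+ 2 + s ^+ 2) * (k * z.1))); first by ring.
  by rewrite cs; ring.
have dE : cinv_den (cay d z) = 2 * cay_scale z.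
  by rewrite /cinv_den e1 e2 -kN; ring.
by split=> //; rewrite /cinv_x /cinv_y dE ?e1 ?e2; field.
Qed.

Lemma cinv_logpolar (s u : R) : - (pi / 2) < u < pi / 2 ->
  [/\ cinv_den (cay d (logpolar y0 s u)) = 2 * cay_scale (logpolar y0 s u),
      cinv_lograd (cay d (logpolar y0 s u)) = s &
      cinv_angle (cay d (logpolar y0 s u)) = u].
Proof.
move=> hu; have c0 : 0 < cos u by exact: cos_gt0_pihalf.
have e0 := expR_gt0 s.
have [|dE xE yE] := @cinv_cay (logpolar y0 s u).
  rewrite /logpolar /=; have : 0 < expR s * cos u by exact: mulr_gt0.
  by have := sqr_ge0 (y0 + expR s * sin u); nra.
split=> //.
- rewrite /cinv_lograd /cinv_rad2 xE yE /logpolar /=.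
  have -> : (y0 + expR s * sin u - y0) ^+ 2 + (expR s * cos u) ^+ 2 = expR (2 * s).
    rewrite [RHS]expRM_natl.
    transitivity (expR s ^+ 2 * (cos u ^+ 2 + sin u ^+ 2)); first by ring.
    by rewrite cos2Dsin2 mulr1.
  by rewrite expRK mulrAC divff ?mul1r.
- rewrite /cinv_angle xE yE /logpolar /=.
  have -> : (y0 + expR s * sin u - y0) / (expR s * cos u) = tan u.
    by rewrite /tan; field; rewrite !gt_eqF.
  by rewrite tanK// in_itv.
Qed.

Lemma cinv_rad2_gt0 w : disk w -> 0 < cinv_rad2 w.
Proof.
move=> /cinv_y_gt0[_ y]; rewrite /cinv_rad2.
by have := sqr_ge0 (cinv_x w - y0); have : 0 < cinv_y w ^+ 2 by [rewrite exprn_gt0]; lra.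
Qed.

(** Up to the sign and the origin of the angle, the two coordinates are the real and imaginary parts
    of log (z - y0). The map is therefore conformal, with factor |dz/dw| / |z - y0| and |dz/dw| = 2
    / |1 - v|^2. *)
Lemma is_derive_cinv (g1 g2 : R -> R) (t g1' g2' : R) :
  disk (g1 t, g2 t) -> is_derive t (1 : R) g1 g1' -> is_derive t (1 : R) g2 g2' ->
  exists s' a', [/\ is_derive t (1 : R) (fun t => cinv_lograd (g1 t, g2 t)) s',
    is_derive t (1 : R) (fun t => cinv_angle (g1 t, g2 t)) a' &
    s' ^+ 2 + a' ^+ 2 =
      (2 / (cinv_den (g1 t, g2 t) * expR (cinv_lograd (g1 t, g2 t)))) ^+ 2
        * (g1' ^+ 2 + g2' ^+ 2)].
Proof.
move=> gd dg1 dg2; have [N0 Y0] := cinv_y_gt0 gd; have Q0 := cinv_rad2_gt0 gd.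
pose p t := 1 - (g1 t * cos d + g2 t * sin d).
pose q t := g2 t * cos d - g1 t * sin d.
pose p' := - (g1' * cos d + g2' * sin d).
pose q' := g2' * cos d - g1' * sin d.
have dp : is_derive t (1 : R) p p'.
  by apply: is_derive_eq; rewrite /p' /GRing.scale/=; ring.
have dq : is_derive t (1 : R) q q'.
  by apply: is_derive_eq; rewrite /q' /GRing.scale/=; ring.
have pq : p' ^+ 2 + q' ^+ 2 = g1' ^+ 2 + g2' ^+ 2.
  have := cos2Dsin2 d; rewrite /p' /q'; move: (cos d) (sin d) => c s cs.
  transitivity ((c ^+ 2 + s ^+ 2) * (g1' ^+ 2 + g2' ^+ 2)); first by ring.
  by rewrite cs mul1r.
pose N t := p t ^+ 2 + q t ^+ 2.
have NE x : cinv_den (g1 x, g2 x) = N x by [].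
have Nn : N t != 0 by rewrite gt_eqF.
pose N' := 2 * p t * p' + 2 * q t * q'.
have dN : is_derive t (1 : R) N N'.
  by apply: is_derive_eq; rewrite /N' /GRing.scale/=; ring.
have dNV : is_derive t (1 : R) (fun t => (N t)^-1) (- (N t) ^- 2 * N').
  exact: (@is_deriveV _ N t N' 1 Nn dN).
pose X t := - (2 * q t) / N t.
pose Y t := 2 * p t / N t - 1.
pose X' := - (2 * q') / N t - (2 * q t) * (- (N t) ^- 2 * N').
pose Y' := 2 * p' / N t + 2 * p t * (- (N t) ^- 2 * N').
have dX : is_derive t (1 : R) X X'.
  by apply: is_derive_eq; rewrite /X' /GRing.scale/=; ring.
have dY : is_derive t (1 : R) Y Y'.
  by apply: is_derive_eq; rewrite /Y' /GRing.scale/=; ring.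
have XY : X' ^+ 2 + Y' ^+ 2 = (2 / N t) ^+ 2 * (g1' ^+ 2 + g2' ^+ 2).
  rewrite -pq /X' /Y' /N'; move: Nn; rewrite /N; move: (p t) (q t) => P Q Nn.
  by field.
pose Q t := (X t - y0) ^+ 2 + Y t ^+ 2.
have QE x : cinv_rad2 (g1 x, g2 x) = Q x by [].
rewrite QE in Q0.
have Qn : Q t != 0 by rewrite gt_eqF.
pose Q' := 2 * (X t - y0) * X' + 2 * Y t * Y'.
have dQ : is_derive t (1 : R) Q Q'.
  by apply: is_derive_eq; rewrite /Q' /GRing.scale/=; ring.
have dlnQ : is_derive t (1 : R) (fun t => ln (Q t)) ((Q t)^-1 * Q').
  by apply: (@is_derive1_comp _ (@ln R) Q) => //; exact: is_derive1_ln.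
have Yn : Y t != 0 by rewrite gt_eqF.
have dYV : is_derive t (1 : R) (fun t => (Y t)^-1) (- (Y t) ^- 2 * Y').
  exact: (@is_deriveV _ Y t Y' 1 Yn dY).
pose T t := (X t - y0) / Y t.
pose T' := X' / Y t + (X t - y0) * (- (Y t) ^- 2 * Y').
have dT : is_derive t (1 : R) T T'.
  by apply: is_derive_eq; rewrite /T' /GRing.scale/=; ring.
exists ((Q t)^-1 * Q' / 2), ((1 + T t ^+ 2)^-1 * T'); split.
- by apply: is_derive_eq; rewrite /GRing.scale/=; ring.
- exact: (@is_derive1_comp _ (@atan R) T).
have -> : expR (cinv_lograd (g1 t, g2 t)) = Num.sqrt (Q t).
  rewrite /cinv_lograd QE; apply/eqP.
  rewrite -(eqrXn2 (n := 2))// ?expR_ge0 ?sqrtr_ge0// sqr_sqrtr ?ltW//.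
  by rewrite -expRM_natl mulrC divfK// lnK.
rewrite NE; transitivity ((X' ^+ 2 + Y' ^+ 2) / Q t); last first.
  by rewrite XY invfM mulrA [in RHS]exprMn exprVn sqr_sqrtr ?ltW//; ring.
rewrite /Q' /T' /T; move: Qn Yn; rewrite /Q; move: (X t - y0) (Y t) => a b Qn Yn.
by field; rewrite Qn Yn.
Qed.

End inverse_cayley.

(** * Energy of the test function in strip coordinates *)

Section strip_energy.
Variable R : realType.
Let leb := @lebesgue_measure R.

Lemma measurable_fun_leB d (T : measurableType d) (f g : T -> R) :
  measurable_fun setT f -> measurable_fun setT g ->
  measurable_fun setT (fun x => (f x <= g x)%R%:R : R).
Proof.
move=> mf mg.
have mS : measurable [set x | f x <= g x].
  have -> : [set x | f x <= g x] = (fun x => f x <= g x) @^-1` [set true] by [].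
  by rewrite -[X in measurable X]setTI; apply: measurable_fun_ler.
have -> : (fun x => (f x <= g x)%R%:R : R) = \1_[set x | f x <= g x].
  by apply/funext => x; rewrite indicE; have [h|h] := boolP (f x <= g x);
    [rewrite mem_set|rewrite memNset//; exact/negP].
exact: measurable_indic.
Qed.

(** The substitution x = e^s turns the exponential into a constant on []0, expR a]]. *)
Lemma integral_expR_tail (a : R) :
  (\int[leb]_s ((s <= a)%R%:R * expR (s - a))%:E = 1)%E.
Proof.
pose f x : \bar R := ((x <= expR a)%R%:R * expR (- a))%:E.
have mf : measurable_fun setT f.
  by apply/measurable_EFinP; apply: measurable_funM => //; exact: measurable_fun_leB.
have f0 x : (0 <= f x)%E by rewrite lee_fin mulr_ge0// expR_ge0.
transitivity (\int[leb]_s (f (expR s) * (expR s)%:E))%E.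
  by apply: eq_integral => s _; rewrite /f ler_expR -EFinM expRD; congr (_%:E); ring.
rewrite -ge0_integral_expR// integral_mkcond.
transitivity (\int[leb]_(x in `]0%R, expR a]) (expR (- a))%:E)%E.
  rewrite [RHS]integral_mkcond; apply: eq_integral => x _; rewrite !patchE.
  have -> : (x \in (`]0%R, +oo[%classic : set R)) = (0 < x).
    by apply/idP/idP; rewrite inE/= in_itv/= andbT.
  have -> : (x \in (`]0%R, expR a]%classic : set R)) = (0 < x) && (x <= expR a).
    by apply/idP/idP; rewrite inE/= in_itv.
  by rewrite /f; case: (0 < x); case: (x <= _); rewrite /= ?mul1r ?mul0r.
have lE : leb (`]0%R, expR a]%classic : set R) = (expR a)%:E.
  by apply: (etrans (lebesgue_measure_itv _)); rewrite /= lte_fin expR_gt0 oppr0 adde0.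
rewrite integral_cst//; apply: (etrans (congr1 _ lE)).
by rewrite -EFinM -expRD addNr expR0.
Qed.

Lemma integral_expR2_tail (a : R) :
  (\int[leb]_s ((s <= a)%R%:R * expR (2 * (s - a)))%:E = (1 / 2)%:E)%E.
Proof.
pose f s : \bar R := ((s <= 2 * a)%R%:R * expR (s - 2 * a))%:E.
have mf : measurable_fun setT f.
  apply/measurable_EFinP; apply: measurable_funM; last by mfun.
  exact: measurable_fun_leB.
have f0 x : (0 <= f x)%E by rewrite lee_fin mulr_ge0// expR_ge0.
have := integral_expR_tail (2 * a); rewrite -/f.
have k2 : 0 < (2 : R) by [].
rewrite (ge0_integral_affine 0 k2 mf f0).
have mf2 : measurable_fun setT (fun t : R => f (2 * t + 0)).
  by apply: (measurableT_comp mf); apply: measurable_funD.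
rewrite ge0_integralZr//.
have -> : (\int[leb]_t f (2 * t + 0)%R = \int[leb]_s ((s <= a)%R%:R * expR (2 * (s - a)))%:E)%E.
  by apply: eq_integral => s _; rewrite /f addr0 ler_pM2l// mulrBr.
(* The value is read off from 2 I = 1, after infinite values of I are excluded. *)
set I := (\int[leb]_s _)%E; case: I => [x|//=|//=]; rewrite ?gt0_mulye ?gt0_mulNye ?lte_fin//.
by rewrite -EFinM => -[] h; congr (_%:E); lra.
Qed.

Lemma integral_expRN_tail (b : R) :
  (\int[leb]_s ((b <= s)%R%:R * expR (b - s))%:E = 1)%E.
Proof.
rewrite -(integral_expR_tail (- b)) [RHS]ge0_integral_neg.
- by apply: eq_integral => s _; rewrite lerN2 opprK [b - s]addrC.
- apply/measurable_EFinP; apply: measurable_funM; last by mfun.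
  exact: measurable_fun_leB.
- by move=> s; rewrite lee_fin mulr_ge0// expR_ge0.
Qed.

Lemma integral_slab (a b k : R) : a <= b ->
  (\int[leb]_s (((a <= s)%R && (s <= b)%R)%:R * k)%:E = ((b - a) * k)%:E)%E.
Proof.
move=> ab; transitivity (\int[leb]_(s in `[a, b]) k%:E)%E.
  rewrite [RHS]integral_mkcond; apply: eq_integral => s _; rewrite patchE.
  have -> : (s \in (`[a, b]%classic : set R)) = (a <= s) && (s <= b).
    by apply/idP/idP; rewrite inE/= in_itv.
  by case: (_ && _); rewrite /= ?mul1r ?mul0r.
have lE : leb (`[a, b]%classic : set R) = (b - a)%:E.
  apply: (etrans (lebesgue_measure_itv _)); rewrite /= lte_fin.
  by have [_|ba] := ltP a b; [rewrite EFinB|rewrite (@le_anti _ _ a b) ?subrr// ab].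
rewrite integral_cst//; apply: (etrans (congr1 _ lE)).
by rewrite -EFinM mulrC.
Qed.

Lemma integral_quadratic_le (al be ga h : R) : 0 < h ->
  (forall u, - h <= u <= h -> 0 <= al * u ^+ 2 + be * u + ga) ->
  (\int[leb]_(u in `](- h)%R, h[) (al * u ^+ 2 + be * u + ga)%:E
    <= (2 * al * h ^+ 3 / 3 + 2 * ga * h)%:E)%E.
Proof.
move=> h0 f0; have hh : - h < h by lra.
pose f u : R := al * u ^+ 2 + be * u + ga.
pose F u : R := al / 3 * u ^+ 3 + be / 2 * u ^+ 2 + ga * u.
have dF (u : R) : is_derive u (1 : R) F (f u).
  by apply: is_derive_eq; rewrite /f /GRing.scale/=; field.
have cF : continuous F.
  by move=> u; have [/derivable1_diffP/differentiable_continuous + _] := dF u.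
have df (u : R) : is_derive u (1 : R) f (2 * al * u + be).
  by apply: is_derive_eq; rewrite /f /GRing.scale/=; ring.
apply: (@le_trans _ _ (\int[leb]_(u in `[(- h)%R, h]) (f u)%:E)%E).
  apply: le_integral_ge0 => //.
  - by move=> u /=; rewrite !in_itv/= => /andP[/ltW -> /ltW ->].
  - by move=> u /=; rewrite in_itv/= lee_fin => /andP[/ltW ? /ltW ?]; apply/f0/andP.
rewrite (continuous_FTC2 (F := F) hh).
- by rewrite -EFinB lee_fin /F; rewrite le_eqVlt; apply/orP; left; apply/eqP; field.
- apply: continuous_subspaceT => u.
  by have [/derivable1_diffP/differentiable_continuous + _] := df u.
- split.
  + by move=> u _; have [] := dF u.
  + by apply: cvg_at_right_filter; exact: cF.
  + by apply: cvg_at_left_filter; exact: cF.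
- by move=> u _; rewrite derive1E; exact: derive_val.
Qed.

(** The squared gradient of the test function in the coordinates (s, u), piece by piece. At the
    seams s = a and s = b two terms are present, so the gradient of either branch is dominated
    there. *)
Definition strip_energy (a b s u : R) : R :=
  (s <= a)%R%:R * expR (2 * (s - a)) * ((u ^+ 2 + 1) / pi ^+ 2) +
  ((a <= s)%R && (s <= b)%R)%:R * pi ^- 2 +
  (b <= s)%R%:R * expR (b - s) * ((u / pi - 1 / 2) ^+ 2 / 4 + pi ^- 2).

Lemma strip_energy_ge0 a b s u : 0 <= strip_energy a b s u.
Proof.
have i0 : 0 <= pi ^- 2 :> R by rewrite invr_ge0 sqr_ge0.
have u0 := sqr_ge0 u; have v0 := sqr_ge0 (u / pi - 1 / 2).
have A : 0 <= (u ^+ 2 + 1) / pi ^+ 2 by rewrite mulr_ge0//; lra.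
have B : 0 <= (u / pi - 1 / 2) ^+ 2 / 4 + pi ^- 2 by lra.
rewrite /strip_energy !addr_ge0//.
- by apply: mulr_ge0 => //; apply: mulr_ge0 => //; exact: expR_ge0.
- exact: mulr_ge0.
- by apply: mulr_ge0 => //; apply: mulr_ge0 => //; exact: expR_ge0.
Qed.

(** The middle piece gives (b - a) / pi, the inner tail pi / 24 + 1 / (2 pi), the outer tail pi / 12
    + 1 / pi. *)
Lemma strip_energy_integral (a b : R) : a <= b ->
  (\int[leb]_(u in `](- (pi / 2))%R, (pi / 2)%R[) \int[leb]_s (strip_energy a b s u)%:E
    <= ((b - a) / pi + (pi / 8 + 3 / (2 * pi)))%:E)%E.
Proof.
move=> ab; have p0 := pi_gt0 R; have pn : pi != 0 :> R by rewrite gt_eqF.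
have i0 : 0 <= pi ^- 2 :> R by rewrite invr_ge0 sqr_ge0.
pose c1 u : R := (u ^+ 2 + 1) / pi ^+ 2.
pose c3 u : R := (u / pi - 1 / 2) ^+ 2 / 4 + pi ^- 2.
have c10 u : 0 <= c1 u by rewrite /c1 mulr_ge0//; have := sqr_ge0 u; lra.
have c30 u : 0 <= c3 u by rewrite /c3; have := sqr_ge0 (u / pi - 1 / 2); lra.
have inner u : (\int[leb]_s (strip_energy a b s u)%:E =
    (c1 u / 2 + (b - a) * pi ^- 2 + c3 u)%:E)%E.
  have m1 : measurable_fun setT (fun s : R => ((s <= a)%R%:R * expR (2 * (s - a)))%:E).
    apply/measurable_EFinP; apply: measurable_funM; last by mfun.
    exact: measurable_fun_leB.
  have m3 : measurable_fun setT (fun s : R => ((b <= s)%R%:R * expR (b - s))%:E).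
    apply/measurable_EFinP; apply: measurable_funM; last by mfun.
    exact: measurable_fun_leB.
  have m2 : measurable_fun setT (fun s : R => (((a <= s)%R && (s <= b)%R)%:R * pi ^- 2 : R)%:E).
    apply/measurable_EFinP; apply: measurable_funM => //.
    have -> : (fun s : R => ((a <= s)%R && (s <= b)%R)%:R : R) =
       (fun s => (a <= s)%R%:R * (s <= b)%R%:R).
      by apply/funext => s; case: (a <= s); case: (s <= b); rewrite ?mulr1 ?mulr0.
    by apply: measurable_funM; exact: measurable_fun_leB.
  pose f1 s := ((c1 u)%:E * ((s <= a)%R%:R * expR (2 * (s - a)))%:E)%E.
  pose f2 s := (((a <= s)%R && (s <= b)%R)%:R * pi ^- 2 : R)%:E.
  pose f3 s := ((c3 u)%:E * ((b <= s)%R%:R * expR (b - s))%:E)%E.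
  have g1 s : (0 <= ((s <= a)%R%:R * expR (2 * (s - a)))%:E)%E.
    by rewrite lee_fin mulr_ge0// expR_ge0.
  have g3 s : (0 <= ((b <= s)%R%:R * expR (b - s))%:E)%E.
    by rewrite lee_fin mulr_ge0// expR_ge0.
  have f10 s : (0 <= f1 s)%E by rewrite mule_ge0// lee_fin.
  have f20 s : (0 <= f2 s)%E by rewrite lee_fin mulr_ge0.
  have f30 s : (0 <= f3 s)%E by rewrite mule_ge0// lee_fin.
  have mf1 : measurable_fun setT f1 by exact: emeasurable_funM.
  have mf3 : measurable_fun setT f3 by exact: emeasurable_funM.
  transitivity (\int[leb]_s (f1 s + f2 s + f3 s))%E.
    apply: eq_integral => s _; rewrite /f1 /f2 /f3 -!EFinM -!EFinD /strip_energy.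
    by congr (_%:E); rewrite /c1 /c3; ring.
  rewrite ge0_integralD//; last first.
  - exact: emeasurable_funD.
  - by move=> s _; exact: adde_ge0.
  rewrite ge0_integralD// /f1 /f3 !ge0_integralZl//; last 2 first.
  - by rewrite lee_fin.
  - by rewrite lee_fin.
  rewrite integral_expR2_tail integral_expRN_tail integral_slab// mule1 -EFinM -!EFinD.
  by congr (_%:E); rewrite mul1r.
have h0 : 0 < pi / 2 :> R by rewrite divr_gt0.
pose al : R := pi ^- 2 / 2 + pi ^- 2 / 4.
pose be : R := - (4 * pi)^-1.
pose ga : R := pi ^- 2 / 2 + (b - a) * pi ^- 2 + 1 / 16 + pi ^- 2.
have E u : c1 u / 2 + (b - a) * pi ^- 2 + c3 u = al * u ^+ 2 + be * u + ga.
  by rewrite /c1 /c3 /al /be /ga; move: pn; generalize (pi : R) => P pn; field; exact: pn.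
have E0 u : 0 <= al * u ^+ 2 + be * u + ga.
  have := c10 u; have := c30 u; rewrite -E => ? ?.
  have H : 0 <= (b - a) / pi ^+ 2 by apply: mulr_ge0; rewrite ?subr_ge0.
  by rewrite addr_ge0// addr_ge0// divr_ge0.
apply: (@le_trans _ _ (\int[leb]_(u in `](- (pi / 2))%R, (pi / 2)%R[)
    (al * u ^+ 2 + be * u + ga)%:E)%E).
  by apply: le_integral_ge0 => // [u _|u _|u _]; rewrite ?inner ?E ?lee_fin.
apply: (le_trans (integral_quadratic_le h0 (fun u _ => E0 u))).
rewrite lee_fin /al /ga le_eqVlt; apply/orP; left; apply/eqP.
by move: pn; generalize (pi : R) => P pn; field; exact: pn.
Qed.
End strip_energy.

Section test_function.
Variables (R : realType) (d y0 a b : R).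
Hypothesis ab : a < b.
Let leb := @lebesgue_measure R.

(* The decay rates 1 (inwards) and 1/2 (outwards) keep the energy finite; the
   outer cutoff acts on [1/2 - angle / pi] so that [test_fun] tends to 1 at the
   pole of the coordinates, which lies on the second arc. *)
Definition cutoff_in (w : R * R) : R := Num.min (expR (cinv_lograd d y0 w - a)) 1.
Definition cutoff_out (w : R * R) : R := Num.min (expR ((b - cinv_lograd d y0 w) / 2)) 1.
Definition test_fun (w : R * R) : R :=
  1 / 2 + cutoff_in w * (cinv_angle d y0 w / pi) +
  (1 - cutoff_out w) * (1 / 2 - cinv_angle d y0 w / pi).
(** The gradient bound in the strip, pulled back to the disk: the second factor is the conformal
    factor of [is_derive_cinv]. *)
Definition test_metric (w : R * R) : R :=
  Num.sqrt (strip_energy a b (cinv_lograd d y0 w) (cinv_angle d y0 w)) *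
  (2 / (cinv_den d w * expR (cinv_lograd d y0 w))).

Lemma strip_energy_ge (s u : R) :
  [/\ s <= a -> expR (2 * (s - a)) * ((u ^+ 2 + 1) / pi ^+ 2) <= strip_energy a b s u,
      a <= s <= b -> pi ^- 2 <= strip_energy a b s u &
      b <= s -> expR (b - s) * ((u / pi - 1 / 2) ^+ 2 / 4 + pi ^- 2) <= strip_energy a b s u].
Proof.
have i0 : 0 <= pi ^- 2 :> R by rewrite invr_ge0 sqr_ge0.
have A : 0 <= (s <= a)%R%:R * expR (2 * (s - a)) * ((u ^+ 2 + 1) / pi ^+ 2).
  by rewrite mulr_ge0 ?mulr_ge0 ?expR_ge0//; have := sqr_ge0 u; lra.
have B : 0 <= ((a <= s)%R && (s <= b)%R)%:R * pi ^- 2 :> R by rewrite mulr_ge0.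
have C : 0 <= (b <= s)%R%:R * expR (b - s) * ((u / pi - 1 / 2) ^+ 2 / 4 + pi ^- 2).
  by rewrite mulr_ge0 ?mulr_ge0 ?expR_ge0//; have := sqr_ge0 (u / pi - 1 / 2); lra.
rewrite /strip_energy; split.
- move=> h; move: A B C; have -> : (s <= a)%R%:R = 1 :> R by rewrite h.
  by rewrite mul1r => _ B C; rewrite -addrA lerDl addr_ge0.
- move=> h; move: A B C; have -> : ((a <= s)%R && (s <= b)%R)%:R = 1 :> R by rewrite h.
  have mid (x y z : R) : 0 <= x -> 0 <= z -> y <= x + y + z by lra.
  by rewrite [1 / pi ^+ 2]div1r => A _ C; exact: mid.
- move=> h; move: A B C; have -> : (b <= s)%R%:R = 1 :> R by rewrite h.
  by rewrite mul1r => A B _; rewrite lerDr addr_ge0.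
Qed.

(** Chain rule and Cauchy-Schwarz: the derivative along a path is at most the gradient norm times
    the speed, and conformality transfers the speed from the strip to the disk. *)
Lemma derive_test_fun (g1 g2 : R -> R) (t g1' g2' : R) :
  disk (g1 t, g2 t) -> is_derive t (1 : R) g1 g1' -> is_derive t (1 : R) g2 g2' ->
  derivable (fun t => cutoff_in (g1 t, g2 t)) t 1 ->
  derivable (fun t => cutoff_out (g1 t, g2 t)) t 1 ->
  `|derive1 (fun t => test_fun (g1 t, g2 t)) t| <=
    test_metric (g1 t, g2 t) * Num.sqrt (g1' ^+ 2 + g2' ^+ 2).
Proof.
move=> gd dg1 dg2 dm1 dm2.
have [s' [a' [ds da E]]] := is_derive_cinv d y0 gd dg1 dg2.
have [N0 _] := cinv_y_gt0 d gd.
set K := 2 / _ in E.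
have TM : test_metric (g1 t, g2 t) = Num.sqrt (strip_energy a b
    (cinv_lograd d y0 (g1 t, g2 t)) (cinv_angle d y0 (g1 t, g2 t))) * K by [].
have K0 : 0 <= K by apply: divr_ge0 => //; apply: mulr_ge0; rewrite ?expR_ge0// ltW.
move: TM E K0; clearbody K => TM E K0; rewrite {}TM.
pose s t := cinv_lograd d y0 (g1 t, g2 t).
pose f t := cinv_angle d y0 (g1 t, g2 t).
have pn : (pi : R) != 0 by rewrite gt_eqF// pi_gt0.
have dE1 : is_derive t (1 : R) (fun t => expR (s t - a)) (expR (s t - a) * s').
  apply: (@is_derive1_comp _ expR (fun t => s t - a)).
  by apply: is_derive_eq; rewrite subr0.
have dE2 : is_derive t (1 : R) (fun t => expR ((b - s t) / 2)) (expR ((b - s t) / 2) * (- s' / 2)).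
  apply: (@is_derive1_comp _ expR (fun t => (b - s t) / 2)).
  by apply: is_derive_eq; rewrite /GRing.scale/=; ring.
have c1 : is_derive t (1 : R) (fun=> 1 : R) 0 by exact: is_derive_cst.
set m1 := fun t => cutoff_in (g1 t, g2 t) in dm1.
set m2 := fun t => cutoff_out (g1 t, g2 t) in dm2.
have dd1 : is_derive t (1 : R) m1 (derive1 m1 t) by exact: derivable_is_derive1.
have dd2 : is_derive t (1 : R) m2 (derive1 m2 t) by exact: derivable_is_derive1.
pose D := derive1 m1 t * (f t / pi) + m1 t * (a' / pi) - derive1 m2 t * (1 / 2 - f t / pi)
   - (1 - m2 t) * (a' / pi).
have dT : is_derive t (1 : R) (fun t => test_fun (g1 t, g2 t)) D.
  suff : is_derive t (1 : R) (fun t => 1 / 2 + m1 t * (f t * pi^-1) +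
     (1 - m2 t) * (1 / 2 - f t * pi^-1)) D by [].
  by apply: is_derive_eq; rewrite /D /GRing.scale/=; move: (pi^-1 : R) => ip; ring.
have -> : derive1 (fun t => test_fun (g1 t, g2 t)) t = D.
  by rewrite derive1E; exact: derive_val.
have [e1 e2 e3] := strip_energy_ge (s t) (f t).
suff H : D ^+ 2 <= strip_energy a b (s t) (f t) * (s' ^+ 2 + a' ^+ 2).
  have V0 : 0 <= g1' ^+ 2 + g2' ^+ 2 by rewrite addr_ge0 ?sqr_ge0.
  have SE0 := strip_energy_ge0 a b (s t) (f t).
  apply: (@sqr_norm_le _ D 0).
    by apply: mulr_ge0; [apply: mulr_ge0|]; rewrite ?sqrtr_ge0.
  rewrite expr0n /= addr0 !exprMn !sqr_sqrtr// -mulrA.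
  by move: H; rewrite E.
have SS : 0 <= s' ^+ 2 + a' ^+ 2 by rewrite addr_ge0 ?sqr_ge0.
have m1s : m1 t = Num.min (expR (s t - a)) 1 by [].
have m2s : m2 t = Num.min (expR ((b - s t) / 2)) 1 by [].
have le_exp x : (expR x <= 1) = (x <= 0) by rewrite -[1]expR0 ler_expR.
have ge_exp x : (1 <= expR x) = (0 <= x) by rewrite -[1]expR0 ler_expR.
(* Each cutoff is on its exponential branch or on the branch 1. Both exponentials at once would
   force b <= s <= a. *)
have [[h1 D1]|[h1 D1]] := derive_min_cases dE1 c1 dm1;
  have [[h2 D2]|[h2 D2]] := derive_min_cases dE2 c1 dm2.
- by exfalso; move: h1 h2; rewrite !le_exp => h1 h2; move: ab; lra.
- apply: le_trans (ler_wpM2r SS (e1 _)); last by move: h1; rewrite le_exp; lra.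
  have M1 : m1 t = expR (s t - a) by rewrite m1s min_l.
  have M2 : m2 t = 1 by rewrite m2s min_r.
  rewrite /D M1 M2 [derive1 m1 t]D1 [derive1 m2 t]D2 mul0r subrr mul0r !subr0.
  rewrite expRM_natl; move: (expR _) (f t) => e x.
  have -> : (e * s' * (x / pi) + e * (a' / pi)) ^+ 2 = e ^+ 2 / pi ^+ 2 * (s' * x + a') ^+ 2.
    by move: pn; generalize (pi : R) => P pn; field; exact: pn.
  have -> : e ^+ 2 * ((x ^+ 2 + 1) / pi ^+ 2) * (s' ^+ 2 + a' ^+ 2) =
      e ^+ 2 / pi ^+ 2 * ((x ^+ 2 + 1) * (s' ^+ 2 + a' ^+ 2)).
    by move: pn; generalize (pi : R) => P pn; field; exact: pn.
  apply: ler_wpM2l; first by rewrite divr_ge0 ?sqr_ge0.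
  (* By Lagrange's identity the difference of the two sides is exactly this square. *)
  by have := sqr_ge0 (s' - x * a'); nra.
- apply: le_trans (ler_wpM2r SS (e3 _)); last by move: h2; rewrite le_exp; lra.
  have M1 : m1 t = 1 by rewrite m1s min_r.
  have M2 : m2 t = expR ((b - s t) / 2) by rewrite m2s min_l.
  rewrite /D M1 M2 [derive1 m1 t]D1 [derive1 m2 t]D2 mul0r add0r.
  have -> : expR (b - s t) = expR ((b - s t) / 2) ^+ 2.
    by rewrite -expRM_natl; congr expR; field.
  move: (expR _) (f t / pi) => e x; rewrite -exprVn; move: (pi^-1 : R) => ip.
  have -> : 1 * (a' * ip) - e * (- s' / 2) * (1 / 2 - x) - (1 - e) * (a' * ip) =
     e * (s' / 2 * (1 / 2 - x) + a' * ip) by field.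
  rewrite [leLHS]exprMn -[leRHS]mulrA; apply: ler_wpM2l; first exact: sqr_ge0.
  by have := sqr_ge0 (s' * ip - (1 / 2 - x) / 2 * a'); nra.
- apply: le_trans (ler_wpM2r SS (e2 _)); last first.
    by move: h1 h2; rewrite !ge_exp => h1 h2; apply/andP; split; lra.
  have M1 : m1 t = 1 by rewrite m1s min_r.
  have M2 : m2 t = 1 by rewrite m2s min_r.
  rewrite /D M1 M2 [derive1 m1 t]D1 [derive1 m2 t]D2 subrr !mul0r !subr0 add0r mul1r.
  rewrite exprMn exprVn mulrC; apply: ler_wpM2l; first by rewrite invr_ge0 sqr_ge0.
  by rewrite lerDr sqr_ge0.
Qed.

End test_function.

Section test_length.
Variables (R : realType) (d y0 a b : R).
Hypothesis ab : a < b.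

(** On a segment of parameters the path stays in a compact part of the open disk, so the
    denominators, the height and the radius are bounded away from 0. *)
Lemma lip_cinv (g1 g2 : R -> R) (c e : R) : c <= e ->
  (forall t, c <= t <= e -> disk (g1 t, g2 t)) -> lip c e g1 -> lip c e g2 ->
  [/\ lip c e (fun t => cutoff_in d y0 a (g1 t, g2 t)),
      lip c e (fun t => cutoff_out d y0 b (g1 t, g2 t)) &
      lip c e (fun t => test_fun d y0 a b (g1 t, g2 t))].
Proof.
move=> ce gd l1 l2.
pose p t := 1 - (g1 t * cos d + g2 t * sin d).
pose q t := g2 t * cos d - g1 t * sin d.
have lp : lip c e p.
  by apply: lipB; [exact: lip_cst|apply: lipD; apply: lipM => //; exact: lip_cst].
have lq : lip c e q by apply: lipB; apply: lipM => //; exact: lip_cst.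
pose N t := p t * p t + q t * q t.
have NE t : N t = cinv_den d (g1 t, g2 t) by rewrite /N /cinv_den !expr2.
have lNV : lip c e (fun t => (N t)^-1).
  apply: lipV => //; first by apply: lipD; exact: lipM.
  by move=> t /gd /(cinv_y_gt0 d)[]; rewrite NE.
have XE t : - (2 * q t) * (N t)^-1 = cinv_x d (g1 t, g2 t) by rewrite NE.
have YE t : 2 * p t * (N t)^-1 - 1 = cinv_y d (g1 t, g2 t) by rewrite NE.
have lX : lip c e (fun t => - (2 * q t) * (N t)^-1).
  by apply: lipM => //; apply: lipN; apply: lipM => //; exact: lip_cst.
have lY : lip c e (fun t => 2 * p t * (N t)^-1 - 1).
  apply: lipB; last exact: lip_cst.
  by apply: lipM => //; apply: lipM => //; exact: lip_cst.
have lXy : lip c e (fun t => - (2 * q t) * (N t)^-1 - y0).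
  by apply: lipB => //; exact: lip_cst.
pose s t := ln ((- (2 * q t) * (N t)^-1 - y0) * (- (2 * q t) * (N t)^-1 - y0) +
   (2 * p t * (N t)^-1 - 1) * (2 * p t * (N t)^-1 - 1)) * 2^-1.
have sE t : s t = cinv_lograd d y0 (g1 t, g2 t).
  by rewrite /s XE YE -!expr2.
have ls : lip c e s.
  apply: lipM; last exact: lip_cst.
  apply: lip_ln => //; first by apply: lipD; exact: lipM.
  by move=> t /gd /(cinv_rad2_gt0 d y0); rewrite XE YE -!expr2.
pose f t := atan ((- (2 * q t) * (N t)^-1 - y0) * (2 * p t * (N t)^-1 - 1)^-1) * pi^-1.
have fE t : f t = cinv_angle d y0 (g1 t, g2 t) / pi by rewrite /f XE YE.
have lf : lip c e f.
  apply: lipM; last exact: lip_cst.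
  apply: lip_atan; apply: lipM => //; apply: lipV => //.
  by move=> t /gd /(cinv_y_gt0 d)[]; rewrite YE.
have ext h h' : h =1 h' -> lip c e h -> lip c e h' by move=> /funext ->.
have lm1 : lip c e (fun t => cutoff_in d y0 a (g1 t, g2 t)).
  apply: (ext (fun t => Num.min (expR (s t - a)) 1)); first by move=> t; rewrite sE.
  by apply: lip_min1; apply: lip_expR; apply: lipB => //; exact: lip_cst.
have lm2 : lip c e (fun t => cutoff_out d y0 b (g1 t, g2 t)).
  apply: (ext (fun t => Num.min (expR ((b - s t) * 2^-1)) 1)); first by move=> t; rewrite sE.
  apply: lip_min1; apply: lip_expR; apply: lipM; last exact: lip_cst.
  by apply: lipB => //; exact: lip_cst.
split=> //; apply: (ext (fun t => 1 / 2 + cutoff_in d y0 a (g1 t, g2 t) * f t +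
  (1 - cutoff_out d y0 b (g1 t, g2 t)) * (1 / 2 - f t))).
  by move=> t; rewrite /test_fun fE.
apply: lipD; first apply: lipD; [exact: lip_cst|exact: lipM|].
by apply: lipM; apply: lipB => //; exact: lip_cst.
Qed.

(** Inner segments only, since the Lipschitz constant of a path may blow up at its ends. *)
Lemma test_fun_increment (g : R -> R * R) (c e : R) : 0 < c -> c < e -> e < 1 ->
  (forall t, 0 < t < 1 -> disk (g t)) -> loc_lipschitz01 g ->
  (`|test_fun d y0 a b (g e) - test_fun d y0 a b (g c)|%:E <=
    rho_length (fun w => (test_metric d y0 a b w)%:E) g)%E.
Proof.
move=> c0 ce e1 gd gl.
pose g1 t := (g t).1; pose g2 t := (g t).2.
have gE t : g t = (g1 t, g2 t) by rewrite /g1 /g2; case: (g t).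
have ce01 t : c <= t <= e -> 0 < t < 1.
  by move=> /andP[ct te]; rewrite (lt_le_trans c0 ct) (le_lt_trans te e1).
have gd' t : c <= t <= e -> disk (g1 t, g2 t) by move=> /ce01/gd; rewrite gE.
have [K gK] := gl c e c0 e1.
have l1 : lip c e g1.
  exists K => s t hs ht; apply: le_trans (gK s t hs ht).
  apply: (@sqr_norm_le _ _ ((g s).2 - (g t).2)); first exact: sqrtr_ge0.
  by rewrite sqr_sqrtr// addr_ge0 ?sqr_ge0.
have l2 : lip c e g2.
  exists K => s t hs ht; apply: le_trans (gK s t hs ht).
  apply: (@sqr_norm_le _ _ ((g s).1 - (g t).1)); first exact: sqrtr_ge0.
  by rewrite addrC sqr_sqrtr// addr_ge0 ?sqr_ge0.
have [lm1 lm2 [L lT]] := lip_cinv (ltW ce) gd' l1 l2.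
have aed f : lip c e f ->
    {ae lebesgue_measure, forall x : R, c < x < e -> derivable f x 1}.
  move=> [K' lf]; have [h [_ _]] := lipschitz_variation ce lf.
  apply: filterS; first exact: (ae_filter_ringOfSetsType lebesgue_measure).
  by move=> x H /H[].
rewrite !gE.
apply: (@lipschitz_le_integral R (fun t => test_fun d y0 a b (g1 t, g2 t)) _ _ c e L ce).
- by move=> t /=; rewrite !in_itv/= => /andP[ct te]; rewrite (lt_trans c0 ct) (lt_trans te e1).
- move=> t _; rewrite -EFinM lee_fin mulr_ge0 ?sqrtr_ge0// /test_metric.
  rewrite mulr_ge0 ?sqrtr_ge0// divr_ge0// mulr_ge0 ?expR_ge0// /cinv_den.
  by rewrite addr_ge0 ?sqr_ge0.
- exact: lT.
have FF := ae_filter_ringOfSetsType (@lebesgue_measure R).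
apply: filterS (filterI (filterI (aed _ l1) (aed _ l2)) (filterI (aed _ lm1) (aed _ lm2))).
move=> t [[d1 d2] [dm1 dm2]] tce _.
have tce' : c <= t <= e by case/andP: tce => /ltW -> /ltW ->.
rewrite -EFinM lee_fin gE /speed.
apply: (derive_test_fun ab (gd' _ tce')).
- exact: derivable_is_derive1 (d1 tce).
- exact: derivable_is_derive1 (d2 tce).
- exact: dm1.
- exact: dm2.
Qed.
End test_length.

(** * Boundary limits of the test function *)

Section test_limits.
Variables (R : realType) (d y0 a b : R).

(** Near a real boundary point the height y tends to 0 and x / y diverges, whereas y / x tends to 0,
    where the arctangent is continuous. *)
Lemma atan_divN (x y : R) : 0 < y -> 0 < x -> atan (x / y) = pi / 2 - atan (y / x).
Proof.
move=> y0' x0; have T0 : 0 < y / x by exact: divr_gt0.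
set th := atan (y / x).
have th0 : 0 < th by rewrite -(@atan0 R); exact: lt_atan.
have th1 : th < pi / 2 by exact: atan_ltpi2.
have p0 := pi_gt0 R.
have -> : x / y = tan (pi / 2 - th).
  have -> : pi / 2 - th = - (th - pi / 2) by rewrite opprB.
  rewrite /tan sinN cosN sinBpihalf cosBpihalf opprK.
  have -> : sin th = tan th * cos th.
    by rewrite /tan divfK// gt_eqF// cos_gt0_pihalf// th1 andbT; lra.
  rewrite atanK; have : cos th != 0 by rewrite gt_eqF// cos_gt0_pihalf// th1 andbT; lra.
  by move: (cos th) => k k0; field; rewrite k0 !gt_eqF.
by rewrite tanK// in_itv/=; apply/andP; split; lra.
Qed.

Lemma atan_divNl (x y : R) : 0 < y -> x < 0 -> atan (x / y) = - (pi / 2) + atan (y / - x).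
Proof.
move=> y0' x0; have -> : x / y = - (- x / y) by rewrite mulNr opprK.
by rewrite atanN atan_divN ?oppr_gt0//; lra.
Qed.

Lemma cvg_minr T (F : set_system T) (FF : Filter F) (f g : T -> R) (u v : R) :
  f @ F --> u -> g @ F --> v -> (fun x => Num.min (f x) (g x)) @ F --> Num.min u v.
Proof.
move=> fu gv; rewrite minr_absE.
have -> : (fun x => Num.min (f x) (g x)) = (fun x => (f x + g x - `|f x - g x|) / 2).
  by apply/funext => x; rewrite minr_absE.
apply: cvgM; last exact: cvg_cst.
apply: cvgB; first exact: cvgD.
by apply: cvg_norm; exact: cvgB.
Qed.

(** An abstract filter, to serve both t -> 0 from the right and t -> 1 from the left. *)
Variables (T : Type) (F : set_system T) (FF : Filter F) (g1 g2 : T -> R).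
Hypothesis gd : \forall t \near F, disk (g1 t, g2 t).

Let cvg_lin (w1 w2 : R) : g1 @ F --> w1 -> g2 @ F --> w2 ->
  (fun t => 1 - (g1 t * cos d + g2 t * sin d)) @ F --> 1 - (w1 * cos d + w2 * sin d) /\
  (fun t => g2 t * cos d - g1 t * sin d) @ F --> w2 * cos d - w1 * sin d.
Proof.
move=> c1 c2; split.
  apply: cvgB; first exact: cvg_cst.
  by apply: cvgD; apply: cvgM => //; exact: cvg_cst.
by apply: cvgB; apply: cvgM => //; exact: cvg_cst.
Qed.

Lemma cvg_cinv_den (w : R * R) : g1 @ F --> w.1 -> g2 @ F --> w.2 ->
  (fun t => cinv_den d (g1 t, g2 t)) @ F --> cinv_den d w.
Proof.
move=> c1 c2; have [p q] := cvg_lin c1 c2.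
by rewrite /cinv_den /= !expr2; apply: cvgD; apply: cvgM.
Qed.

Lemma cvg_cinv (w : R * R) : cinv_den d w != 0 -> g1 @ F --> w.1 -> g2 @ F --> w.2 ->
  (fun t => cinv_x d (g1 t, g2 t)) @ F --> cinv_x d w /\
  (fun t => cinv_y d (g1 t, g2 t)) @ F --> cinv_y d w.
Proof.
move=> w0 c1 c2; have [p q] := cvg_lin c1 c2.
have nV : (fun t => (cinv_den d (g1 t, g2 t))^-1) @ F --> (cinv_den d w)^-1.
  by apply: cvgV => //; exact: cvg_cinv_den.
split.
  by apply: cvgM => //; apply: cvgN; apply: cvgM => //; exact: cvg_cst.
apply: cvgB; last exact: cvg_cst.
by apply: cvgM => //; apply: cvgM => //; exact: cvg_cst.
Qed.

Section finite_point.
Variable y : R.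
Hypothesis (c1 : g1 @ F --> (cay d (y, 0)).1) (c2 : g2 @ F --> (cay d (y, 0)).2).

Let N0 : 0 < (y, 0 : R).1 ^+ 2 + (1 + (y, 0 : R).2) ^+ 2.
Proof. by rewrite /= addr0 expr1n; have := sqr_ge0 y; lra. Qed.

Let cXY : (fun t => cinv_x d (g1 t, g2 t)) @ F --> y /\
  (fun t => cinv_y d (g1 t, g2 t)) @ F --> (0 : R).
Proof.
have [dE xE yE] := cinv_cay d N0.
rewrite -[X in _ --> X /\ _]xE -[X in _ /\ _ --> X]yE; apply: cvg_cinv => //.
by rewrite dE mulf_neq0// /cay_scale mulf_neq0// invr_eq0 gt_eqF.
Qed.

Let cF (x : R) : x = y - y0 -> x != 0 ->
  (fun t => cinv_lograd d y0 (g1 t, g2 t)) @ F --> ln `|x|.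
Proof.
move=> xE x0; have [cX cY] := cXY.
have -> : ln `|x| = ln (x * x + 0 * 0) / 2.
  rewrite mul0r addr0 -expr2 -real_normK ?num_real//.
  have n0 : 0 < `|x| by rewrite normr_gt0.
  by rewrite expr2 lnM ?posrE//; lra.
apply: cvgM; last exact: cvg_cst.
apply: (@continuous_cvg _ _ _ _ _ _ (@ln R)).
  by apply: continuous_ln; rewrite mul0r addr0 -expr2 exprn_even_gt0.
have cX' : (fun t => cinv_x d (g1 t, g2 t) - y0) @ F --> x.
  by rewrite xE; apply: cvgB => //; exact: cvg_cst.
exact: (cvgD (cvgM cX' cX') (cvgM cY cY)).
Qed.

Let cm (x : R) : x = y - y0 -> x != 0 ->
  (fun t => cutoff_in d y0 a (g1 t, g2 t)) @ F --> Num.min (expR (ln `|x| - a)) 1 /\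
  (fun t => cutoff_out d y0 b (g1 t, g2 t)) @ F --> Num.min (expR ((b - ln `|x|) / 2)) 1.
Proof.
move=> xE x0; have cs := cF xE x0; split.
  apply: cvg_minr; last exact: cvg_cst.
  apply: (@continuous_cvg _ _ _ _ _ _ (@expR R)); first exact: continuous_expR.
  by apply: cvgB => //; exact: cvg_cst.
apply: cvg_minr; last exact: cvg_cst.
apply: (@continuous_cvg _ _ _ _ _ _ (@expR R)); first exact: continuous_expR.
by apply: cvgM; [apply: cvgB => //; exact: cvg_cst|exact: cvg_cst].
Qed.

Let min1 (x : R) : 0 <= x -> Num.min (expR x) 1 = 1.
Proof. by move=> x0; rewrite min_r// -[1]expR0 ler_expR. Qed.

(** For these radii both cutoffs tend to 1, and the angle tends to - pi / 2. *)
Lemma cvg_test_fun_left : a <= ln (y0 - y) <= b -> y < y0 ->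
  (fun t => test_fun d y0 a b (g1 t, g2 t)) @ F --> (0 : R).
Proof.
move=> /andP[ay yb] yy0; have [cX cY] := cXY.
have x0 : y - y0 != 0 by rewrite subr_eq0 lt_eqF.
have [m1 m2] := cm erefl x0.
have xn : `|y - y0| = y0 - y by rewrite distrC gtr0_norm// subr_gt0.
move: m1 m2; rewrite xn !min1; last 2 first.
- by rewrite divr_ge0// subr_ge0.
- by rewrite subr_ge0.
move=> m1 m2.
have cat : (fun t => atan (cinv_y d (g1 t, g2 t) / - (cinv_x d (g1 t, g2 t) - y0))) @ F
    --> (0 : R).
  rewrite -(@atan0 R).
  apply: (@continuous_cvg _ _ _ _ _ _ (@atan R)); first exact: continuous_atan.
  rewrite -(mul0r (- (y - y0))^-1); apply: cvgM => //.
  apply: cvgV; first by rewrite oppr_eq0.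
  by apply: cvgN; apply: cvgB => //; exact: cvg_cst.
have ca : (fun t => cinv_angle d y0 (g1 t, g2 t) / pi) @ F --> (- (pi / 2) + 0) / pi.
  apply: cvgM; last exact: cvg_cst.
  apply: cvg_trans (cvgD (cvg_cst (- (pi / 2))) cat).
  apply: near_eq_cvg; near=> t.
  rewrite /= /cinv_angle atan_divNl//.
    by have /cinv_y_gt0 : disk (g1 t, g2 t) by [near: t]; move=> /(_ d)[].
  by rewrite subr_lt0; near: t; exact: (cvgr_lt y).
have -> : 0 = 1 / 2 + 1 * ((- (pi / 2) + 0) / pi) + (1 - 1) * (1 / 2 - (- (pi / 2) + 0) / pi) :> R.
  have pn : (pi : R) != 0 by rewrite gt_eqF// pi_gt0.
  by move: pn; generalize (pi : R) => P pn; field; exact: pn.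
apply: cvgD; first by apply: cvgD; [exact: cvg_cst|exact: cvgM].
by apply: cvgM; apply: cvgB => //; exact: cvg_cst.
Unshelve. all: by end_near. Qed.

(** The angle tends to pi / 2, so the factor beside the outer cutoff tends to 0 and [y] may lie
    arbitrarily far out. *)
Lemma cvg_test_fun_right : a <= ln (y - y0) -> y0 < y ->
  (fun t => test_fun d y0 a b (g1 t, g2 t)) @ F --> (1 : R).
Proof.
move=> ay yy0; have [cX cY] := cXY.
have x0 : y - y0 != 0 by rewrite subr_eq0 gt_eqF.
have [m1 m2] := cm erefl x0.
have xn : `|y - y0| = y - y0 by rewrite gtr0_norm// subr_gt0.
move: m1; rewrite xn min1; last by rewrite subr_ge0.
move=> m1.
have cat : (fun t => atan (cinv_y d (g1 t, g2 t) / (cinv_x d (g1 t, g2 t) - y0))) @ F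
    --> (0 : R).
  rewrite -(@atan0 R).
  apply: (@continuous_cvg _ _ _ _ _ _ (@atan R)); first exact: continuous_atan.
  rewrite -(mul0r (y - y0)^-1); apply: cvgM => //.
  apply: cvgV => //.
  by apply: cvgB => //; exact: cvg_cst.
have ca : (fun t => cinv_angle d y0 (g1 t, g2 t) / pi) @ F --> (pi / 2 - 0) / pi.
  apply: cvgM; last exact: cvg_cst.
  apply: cvg_trans (cvgB (cvg_cst (pi / 2)) cat).
  apply: near_eq_cvg; near=> t.
  rewrite /= /cinv_angle atan_divN//.
    by have /cinv_y_gt0 : disk (g1 t, g2 t) by [near: t]; move=> /(_ d)[].
  by rewrite subr_gt0; near: t; exact: (cvgr_gt y).
set M := Num.min _ _ in m2.
have -> : 1 = 1 / 2 + 1 * ((pi / 2 - 0) / pi) + (1 - M) * (1 / 2 - (pi / 2 - 0) / pi) :> R.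
  have pn : (pi : R) != 0 by rewrite gt_eqF// pi_gt0.
  by move: pn; generalize (pi : R) => P pn; field; exact: pn.
apply: cvgD; first by apply: cvgD; [exact: cvg_cst|exact: cvgM].
by apply: cvgM; apply: cvgB => //; exact: cvg_cst.
Unshelve. all: by end_near. Qed.
End finite_point.

(** The angle may have no limit here. The radius tends to infinity and the outer cutoff to 0, which
    squeezes the test function between 1 - e^((b - s) / 2) and 1. *)
Lemma cvg_test_fun_pole : g1 @ F --> cos d -> g2 @ F --> sin d ->
  (fun t => test_fun d y0 a b (g1 t, g2 t)) @ F --> (1 : R).
Proof.
move=> c1 c2; have [cp cq] := cvg_lin c1 c2.
have cs : cos d * cos d + sin d * sin d = 1 by rewrite -!expr2 cos2Dsin2.
have qs : sin d * cos d - cos d * sin d = 0 by ring.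
rewrite cs subrr qs in cp cq.
have cN := @cvg_cinv_den (cos d, sin d) c1 c2.
move: cN; rewrite /cinv_den /= cs qs subrr expr0n /= addr0 => cN.
pose N t := cinv_den d (g1 t, g2 t).
pose p t := 1 - (g1 t * cos d + g2 t * sin d).
pose q t := g2 t * cos d - g1 t * sin d.
(* With the denominator cleared, the squared radius times [N] is [M], which tends to 4 at the pole;
   hence [N / M], the inverse squared radius, tends to 0. *)
pose M t := 4 - (4 * p t - 2 * N t) - N t + 4 * y0 * q t + y0 * y0 * N t.
have cM : M @ F --> 4 - (4 * 0 - 2 * 0) - 0 + 4 * y0 * 0 + y0 * y0 * 0.
  apply: cvgD; last by apply: cvgM => //; exact: cvg_cst.
  apply: cvgD; last by apply: cvgM => //; exact: cvg_cst.
  apply: cvgB => //.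
  apply: cvgB; first exact: cvg_cst.
  by apply: cvgB; apply: cvgM => //; exact: cvg_cst.
have ME t : 0 < N t -> cinv_rad2 d y0 (g1 t, g2 t) * N t = M t.
  move=> Nt; have Nn : N t != 0 by rewrite gt_eqF.
  rewrite /cinv_rad2 /cinv_x /cinv_y -/(N t) /= -/(p t) -/(q t).
  have NE : N t = p t ^+ 2 + q t ^+ 2 by [].
  rewrite /M; move: Nn; rewrite NE; move: (p t) (q t) => P Q Nn; field; exact: Nn.
pose I t := N t / M t.
have cI : I @ F --> (0 : R).
  rewrite -(mul0r (4 - (4 * 0 - 2 * 0) - 0 + 4 * y0 * 0 + y0 * y0 * 0)^-1).
  apply: cvgM => //; apply: cvgV => //; rewrite !mulr0 !subr0 !addr0; exact: lt0r_neq0.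
have IE t : disk (g1 t, g2 t) -> I t = (cinv_rad2 d y0 (g1 t, g2 t))^-1.
  move=> gdt; have [Nt _] := cinv_y_gt0 d gdt; have Q0 := cinv_rad2_gt0 d y0 gdt.
  by rewrite /I -ME//; move: Q0 Nt; rewrite -/(N t) => Q0 Nt; field; rewrite !gt_eqF.
have cS : (fun t => Num.sqrt (I t)) @ F --> (0 : R).
  rewrite -(@sqrtr0 R).
  by apply: (@continuous_cvg _ _ _ _ _ _ (@Num.sqrt R)) => //; exact: sqrt_continuous.
have cSS : (fun t => Num.sqrt (Num.sqrt (I t))) @ F --> (0 : R).
  rewrite -(@sqrtr0 R).
  by apply: (@continuous_cvg _ _ _ _ _ _ (@Num.sqrt R)) => //; exact: sqrt_continuous.
have S1 t : disk (g1 t, g2 t) -> Num.sqrt (I t) = expR (- cinv_lograd d y0 (g1 t, g2 t)).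
  move=> gdt; have Q0 := cinv_rad2_gt0 d y0 gdt.
  rewrite IE// /cinv_lograd; apply/eqP; rewrite -(eqrXn2 (n := 2))// ?expR_ge0 ?sqrtr_ge0//.
  rewrite sqr_sqrtr ?invr_ge0 ?ltW// -expRM_natl mulrN mulrC divfK// expRN lnK//.
have S2 t : disk (g1 t, g2 t) ->
    Num.sqrt (Num.sqrt (I t)) = expR (- cinv_lograd d y0 (g1 t, g2 t) / 2).
  move=> gdt; rewrite S1//; apply/eqP.
  rewrite -(eqrXn2 (n := 2))// ?expR_ge0 ?sqrtr_ge0// sqr_sqrtr ?expR_ge0//.
  by rewrite -expRM_natl mulrC divfK.
have cz : (fun t => 1 - expR (b / 2) * Num.sqrt (Num.sqrt (I t))) @ F --> (1 : R).
  rewrite -[X in _ --> X]subr0 -[X in _ - X](mulr0 (expR (b / 2))).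
  by apply: cvgB; [exact: cvg_cst|apply: cvgM => //; exact: cvg_cst].
have ca : (fun t => expR a * Num.sqrt (I t)) @ F --> (0 : R).
  by rewrite -(mulr0 (expR a)); apply: cvgM => //; exact: cvg_cst.
apply: (squeeze_cvgr (f := fun t => 1 - expR (b / 2) * Num.sqrt (Num.sqrt (I t)))
  (h := fun=> 1)) => //; last exact: cvg_cst.
near=> t.
have gdt : disk (g1 t, g2 t) by near: t.
have : expR a * Num.sqrt (I t) < 1 by near: t; exact: (cvgr_lt 0).
rewrite S2// S1// -!expRD -[X in _ < X]expR0 ltr_expR => sa.
have m1 : cutoff_in d y0 a (g1 t, g2 t) = 1.
  by rewrite /cutoff_in min_r// -[X in X <= _]expR0 ler_expR; lra.
have e2 : b / 2 + - cinv_lograd d y0 (g1 t, g2 t) / 2 = (b - cinv_lograd d y0 (g1 t, g2 t)) / 2.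
  by field.
rewrite /test_fun m1 e2 mul1r.
have m2 : cutoff_out d y0 b (g1 t, g2 t) <= expR ((b - cinv_lograd d y0 (g1 t, g2 t)) / 2).
  by rewrite /cutoff_out ge_min lexx.
have m20 : 0 <= cutoff_out d y0 b (g1 t, g2 t).
  by rewrite /cutoff_out le_min expR_ge0 ler01.
have A1 : cinv_angle d y0 (g1 t, g2 t) / pi < 1 / 2.
  by rewrite ltr_pdivrMr ?pi_gt0// mulrC mul1r; exact: atan_ltpi2.
have A2 : - (1 / 2) < cinv_angle d y0 (g1 t, g2 t) / pi.
  by rewrite ltr_pdivlMr ?pi_gt0// mulNr mulrC mul1r; exact: atan_gtNpi2.
move: (cutoff_out _ _ _ _) (cinv_angle _ _ _ / pi) (expR _) m2 m20 A1 A2 => m A e m2 m20 A1 A2.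
by apply/andP; split; nra.
Unshelve. all: by end_near. Qed.
End test_limits.

(** * Energy and admissibility of the test metric *)

Section width_upper_bound.
Variable R : realType.
Let leb := @lebesgue_measure R.

Lemma measurable_test_metric (d y0 a b : R) :
  measurable_fun setT (test_metric d y0 a b).
Proof.
have mden : measurable_fun setT (cinv_den d) by rewrite /cinv_den; mfun.
have mx : measurable_fun setT (cinv_x d).
  rewrite /cinv_x; apply: measurable_funM; last by mfun.
  by apply: measurableT_comp => //; mfun.
have my : measurable_fun setT (cinv_y d) by rewrite /cinv_y; mfun.
have mr : measurable_fun setT (cinv_rad2 d y0) by rewrite /cinv_rad2; mfun.
have ms : measurable_fun setT (cinv_lograd d y0).
  rewrite /cinv_lograd; apply: measurable_funM => //.
  by apply: (measurableT_comp (@measurable_ln R)).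
have ma : measurable_fun setT (cinv_angle d y0).
  rewrite /cinv_angle; apply: (measurableT_comp (f := @atan R)).
    by apply: continuous_measurable_fun => x; exact: continuous_atan.
  by mfun.
have mE : measurable_fun setT
    (fun w => strip_energy a b (cinv_lograd d y0 w) (cinv_angle d y0 w)).
  rewrite /strip_energy; apply: measurable_funD; first apply: measurable_funD.
  - apply: measurable_funM; last by mfun.
    by apply: measurable_funM; [exact: measurable_fun_leB|mfun].
  - apply: measurable_funM => //.
    rewrite (_ : (fun w => _) = (fun w => (a <= cinv_lograd d y0 w)%R%:R *
       (cinv_lograd d y0 w <= b)%R%:R : R)); last first.
      by apply/funext => w; case: (a <= _); case: (_ <= b); rewrite ?mulr1 ?mulr0.
    by apply: measurable_funM; exact: measurable_fun_leB.
  - apply: measurable_funM; last by mfun.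
    by apply: measurable_funM; [exact: measurable_fun_leB|mfun].
rewrite /test_metric; apply: measurable_funM; last by mfun.
apply: (measurableT_comp (f := @Num.sqrt R)) mE.
by apply: continuous_measurable_fun => x; exact: sqrt_continuous.
Qed.

Lemma test_metric_ge0 (d y0 a b : R) w : 0 <= test_metric d y0 a b w.
Proof.
rewrite /test_metric mulr_ge0 ?sqrtr_ge0// divr_ge0// mulr_ge0 ?expR_ge0//.
by rewrite /cinv_den addr_ge0 ?sqr_ge0.
Qed.

(** Conformal invariance: the factor of the metric cancels the Jacobian of [disk_area], leaving the
    energy on the strip. *)
Lemma test_metric_energy (d y0 a b : R) : a <= b ->
  (\int[@area R]_(z in @disk R) ((test_metric d y0 a b z)%:E * (test_metric d y0 a b z)%:E)
    <= ((b - a) / pi + (pi / 8 + 3 / (2 * pi)))%:E)%E.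
Proof.
move=> ab; pose f z := ((test_metric d y0 a b z)%:E * (test_metric d y0 a b z)%:E)%E.
have f0 z : (0 <= f z)%E by rewrite /f -EFinM lee_fin -expr2 sqr_ge0.
have mf : measurable_fun setT f.
  by apply: emeasurable_funM; apply/measurable_EFinP; exact: measurable_test_metric.
rewrite (disk_area d y0 mf f0); apply: le_trans (strip_energy_integral ab).
apply: le_integral_ge0 => //.
- move=> u _; apply: integral_ge0 => s _; apply: mule_ge0 => //.
  by rewrite lee_fin sqr_ge0.
- move=> u _; apply: integral_ge0 => s _; rewrite lee_fin; exact: strip_energy_ge0.
move=> u /=; rewrite in_itv/= => hu.
rewrite le_eqVlt; apply/orP; left; apply/eqP; apply: eq_integral => s _.
have [dE sE uE] := cinv_logpolar d y0 s hu.
rewrite /f -!EFinM /test_metric sE uE dE; congr (_%:E).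
have k0 : cay_scale (logpolar y0 s u) != 0.
  rewrite /cay_scale mulf_neq0// invr_eq0 gt_eqF// /logpolar /=.
  have : 0 < expR s * cos u by rewrite mulr_gt0 ?expR_gt0 ?cos_gt0_pihalf.
  by have := sqr_ge0 (y0 + expR s * sin u); nra.
have e0 : expR s != 0 by rewrite gt_eqF// expR_gt0.
rewrite -expr2 exprMn sqr_sqrtr ?strip_energy_ge0//.
move: (strip_energy _ _ _ _) (cay_scale _) (expR s) k0 e0 => S k e k0 e0.
by field; rewrite k0 e0.
Qed.

Lemma width_le (d p q r : R) (E F : set (R * R)) : q < r -> p < q ->
  (forall w, E w -> exists2 y, p <= y <= q & w = cay d (y, 0)) ->
  (forall w, F w -> (exists2 y, r <= y & w = cay d (y, 0)) \/ w = (cos d, sin d)) ->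
  (width (path_joining E F) <=
    (ln (((q + r) / 2 - p) / ((r - q) / 2)) / pi + (pi / 8 + 3 / (2 * pi)))%:E)%E.
Proof.
move=> qr pq hE hF; set y0 := (q + r) / 2; set l := (r - q) / 2; set L := y0 - p.
have l0 : 0 < l by rewrite /l; lra.
have L0 : 0 < L by rewrite /L /y0; lra.
have lL : l < L by rewrite /l /L /y0; lra.
have ab : ln l < ln L by rewrite ltr_ln ?posrE.
rewrite ln_div ?posrE//; apply: le_trans (test_metric_energy d y0 (ltW ab)).
apply: ereal_inf_lbound; exists (fun w => (test_metric d y0 (ln l) (ln L) w)%:E) => //.
split.
- by apply/measurable_EFinP; exact: measurable_test_metric.
- by move=> z; rewrite lee_fin test_metric_ge0.
move=> g [cg g0 g1 gd gl].
have gE t : g t = ((g t).1, (g t).2) by case: (g t).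
have [_ c0 c1] := (continuous_within_itvP g ltr01).1 cg.
have T0 : test_fun d y0 (ln l) (ln L) (g t) @[t --> 0^'+] --> (0 : R).
  have [y /andP[py yq] gy] := hE _ g0.
  rewrite (_ : (fun t => _) = (fun t => test_fun d y0 (ln l) (ln L) ((g t).1, (g t).2))).
    apply: (@cvg_test_fun_left R d y0 _ _ _ _ _ _ _ _ y).
    - near=> t; rewrite -gE; apply: gd; apply/andP; split; near: t.
        exact: nbhs_right_gt.
      exact: nbhs_right_lt.
    - by rewrite -gy; exact: (cvg_comp _ _ c0 cvg_fst).
    - by rewrite -gy; exact: (cvg_comp _ _ c0 cvg_snd).
    - by rewrite !ler_ln ?posrE//; rewrite /l /L /y0; try (apply/andP; split); lra.
    - by rewrite /y0; lra.
  by apply/funext => t; rewrite -gE.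
have T1 : test_fun d y0 (ln l) (ln L) (g t) @[t --> 1^'-] --> (1 : R).
  have gd1 : \forall t \near 1^'-, disk ((g t).1, (g t).2).
    near=> t; rewrite -gE; apply: gd; apply/andP; split; near: t.
      exact: nbhs_left_gt.
    exact: nbhs_left_lt.
  rewrite (_ : (fun t => _) = (fun t => test_fun d y0 (ln l) (ln L) ((g t).1, (g t).2))).
    have [[y ry gy]|gy] := hF _ g1.
      apply: (@cvg_test_fun_right R d y0 _ _ _ _ _ _ _ _ y).
      - exact: gd1.
      - by rewrite -gy; exact: (cvg_comp _ _ c1 cvg_fst).
      - by rewrite -gy; exact: (cvg_comp _ _ c1 cvg_snd).
      - by rewrite ler_ln ?posrE//; rewrite /l /y0; lra.
      - by rewrite /y0; lra.
    apply: cvg_test_fun_pole.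
    - exact: gd1.
    - have -> : cos d = (g 1).1 by rewrite gy.
      exact: (cvg_comp _ _ c1 cvg_fst).
    - have -> : sin d = (g 1).2 by rewrite gy.
      exact: (cvg_comp _ _ c1 cvg_snd).
  by apply/funext => t; rewrite -gE.
(* Inner parameters close to 0 and 1 give values of the test function within eps / 2 of 0 and 1, on
   either side of the parameter 1/2. *)
have H eps : 0 < eps -> ((1 - eps)%:E <=
    rho_length (fun w => (test_metric d y0 (ln l) (ln L) w)%:E) g)%E.
  move=> e0; have e20 : 0 < eps / 2 by rewrite divr_gt0.
  have [c /= [c0' c12 hc]] : exists c : R, [/\ 0 < c, c < 1 / 2 &
      `|0 - test_fun d y0 (ln l) (ln L) (g c)| < eps / 2].
    apply: (@filter_ex _ (0 : R)^'+); near=> c; split; near: c.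
    - exact: nbhs_right_gt.
    - exact: nbhs_right_lt.
    - exact: (cvgr_dist_lt _ _ T0).
  have [e /= [e12 e1 he]] : exists e : R, [/\ 1 / 2 < e, e < 1 &
      `|1 - test_fun d y0 (ln l) (ln L) (g e)| < eps / 2].
    apply: (@filter_ex _ (1 : R)^'-); near=> e; split; near: e.
    - by apply: nbhs_left_gt; lra.
    - exact: nbhs_left_lt.
    - exact: (cvgr_dist_lt _ _ T1).
  have ce : c < e by lra.
  apply: le_trans (test_fun_increment d y0 ab c0' ce e1 gd gl).
  rewrite lee_fin; move: hc he; rewrite !ltr_norml => /andP[? ?] /andP[? ?].
  by apply: le_trans (ler_norm _); lra.
move: H; case: (rho_length _ _) => [x| |] H.
- rewrite lee_fin; apply/ler_addgt0Pr => eps /H; rewrite lee_fin; lra.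
- exact: leey.
- by have := H 1 ltr01; rewrite leeNy_eq.
Unshelve. all: by end_near. Qed.
End width_upper_bound.

(** * Widths between arcs *)

Section path_reversal.
Import HBNNSimple.
Variable R : realType.
Let leb := @lebesgue_measure R.

(** The substitution formula concerns measurable functions, so it is applied to the simple functions
    below the integrand. The resulting inequality is enough to compare widths. *)
Lemma integral01_reflect_le (f : R -> \bar R) : (forall t, 0 <= f t)%E ->
  (\int[leb]_(t in `]0%R, 1%R[) f (1 - t)%R <= \int[leb]_(t in `]0%R, 1%R[) f t)%E.
Proof.
move=> f0; rewrite ge0_integralE//; apply: ge_ereal_sup => _ [h hf <-].
rewrite -integralT_nnsfun [leRHS]integral_mkcond.
pose k (x : R) : \bar R := (HBNNSimple.NonNegSimpleFun.sort h x)%:E.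
have mk : measurable_fun setT k.
  have mh : measurable_fun setT (h : measurableTypeR R -> R) by exact: measurable_funPT.
  by apply/measurable_EFinP; exact: mh.
have k0 x : (0 <= k x)%E by rewrite /k lee_fin; exact: fun_ge0.
rewrite -[leLHS]/(\int[leb]_x k x)%E (ge0_integral_neg mk k0).
have mkN : measurable_fun setT (fun x : R => k (- x)) by apply: measurableT_comp => //; exact: oppr_measurable.
rewrite (ge0_integral_affine (k := 1) (- 1) ltr01 mkN (fun x => k0 _)).
apply: le_integral_ge0 => //.
- by move=> x _; rewrite mule1.
- by move=> x _; rewrite patchE; case: ifP.
move=> x _; rewrite mule1 mul1r opprD opprK addrC; apply: (le_trans (hf _)).
rewrite !patchE; have -> : (1 - x \in (`]0, 1[%classic : set R)) = (x \in (`]0, 1[%classic : set R)).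
  apply/idP/idP; rewrite !inE/= !in_itv/= => /andP[? ?]; apply/andP; split; lra.
by rewrite opprB addrC subrK.
Qed.

(** Where [f] is not derivable both sides are the default value 0, so the identity holds at every
    point. *)
Lemma derive1_reflect (f : R -> R) (t : R) :
  derive1 (fun t => f (1 - t)) t = - derive1 f (1 - t).
Proof.
have dr (s : R) : is_derive s (1 : R) (fun t : R => 1 - t) (- 1).
  by apply: is_derive_eq; rewrite /GRing.scale/=; ring.
have D (h : R -> R) (s : R) : derivable h (1 - s) 1 ->
    is_derive s (1 : R) (fun t => h (1 - t)) (- derive1 h (1 - s)).
  move=> dh; rewrite -mulrN1.
  by apply: (@is_derive1_comp _ h (fun t : R => 1 - t)); exact: derivable_is_derive1.
have [df|df] := pselect (derivable f (1 - t) 1).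
  by rewrite derive1E; have [_ ->] := D _ _ df.
have junk (h : R -> R) (s : R) : ~ derivable h s 1 -> derive1 h s = 0.
  by move=> dh; rewrite derive1E /derive; exact: dvgP.
rewrite (junk _ _ df) oppr0; apply: junk => dfr; apply: df; have := D (fun t => f (1 - t)) (1 - t).
rewrite opprB addrC subrK => /(_ dfr)[+ _].
by rewrite (_ : (fun t0 => _) = f)//; apply/funext => s; rewrite opprB addrC subrK.
Qed.

Lemma speed_reflect (g : R -> R * R) (t : R) :
  speed (fun t => g (1 - t)) t = speed g (1 - t).
Proof.
rewrite /speed (derive1_reflect (fst \o g)) (derive1_reflect (snd \o g)).
by rewrite !sqrrN.
Qed.

Lemma rho_length_reflect (rho : R * R -> \bar R) (g : R -> R * R) :
  (forall z, 0 <= rho z)%E ->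
  (rho_length rho (fun t => g (1 - t)%R) <= rho_length rho g)%E.
Proof.
move=> rho0; rewrite /rho_length.
have f0 t : (0 <= rho (g t) * (speed g t)%:E)%E.
  by rewrite mule_ge0// lee_fin sqrtr_ge0.
pose h t := (rho (g t) * (speed g t)%:E)%E.
suff -> : (fun t : R => rho (g (1 - t)%R) * (speed (fun t => g (1 - t)%R) t)%:E)%E =
    (fun t => h (1 - t)) by exact: integral01_reflect_le.
by apply/funext => t; rewrite speed_reflect.
Qed.

Lemma path_joining_reflect (E F : set (R * R)) (g : R -> R * R) :
  path_joining E F g -> path_joining F E (fun t => g (1 - t)).
Proof.
move=> [cg g0 g1 gd gl]; split.
- apply/subspace_continuousP => x /=; rewrite in_itv/= => /andP[x0 x1].
  have cr : 1 - t @[t --> x] --> 1 - x by apply: cvgB; [exact: cvg_cst|exact: cvg_id].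
  have x01 : (`[0, 1]%classic : set R) (1 - x) by rewrite /= in_itv/=; apply/andP; split; lra.
  have cgx := (subspace_continuousP _ _).1 cg _ x01.
  apply: (@cvg_comp _ _ _ (fun t : R => 1 - t) g _ _ _ _ cgx) => A HA.
  suff : nbhs x (fun t => (`[0, 1]%classic : set R) t -> A (1 - t)) by [].
  have H : nbhs (x : R) (fun t : R => (`[0, 1]%classic : set R) (1 - t) -> A (1 - t)).
    exact: (cr _ HA).
  apply: (@filterS _ (nbhs (x : R)) _ _ _ _ H) => t /= tA; rewrite in_itv/= => /andP[t0 t1].
  by apply: tA; rewrite in_itv/=; apply/andP; split; lra.
- by rewrite subr0.
- by rewrite subrr.
- by move=> t /andP[t0 t1]; apply: gd; apply/andP; split; lra.
- move=> c e c0 e1; have [||K gK] := gl (1 - e) (1 - c); [lra|lra|].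
  exists K => s t /andP[cs se] /andP[ct te].
  have -> : s - t = - ((1 - s) - (1 - t)) by ring.
  by rewrite normrN; apply: gK; apply/andP; split; lra.
Qed.

(** Paths are oriented, and a pair width has to be compared with the local width at its second index
    as well; reversal of paths makes this possible. *)
Lemma width_joining_le (E F E' F' : set (R * R)) : E `<=` F' -> F `<=` E' ->
  (width (path_joining E F) <= width (path_joining E' F'))%E.
Proof.
move=> EF FE; apply: le_ereal_inf => _ [rho [mrho rho0 adm] <-].
exists rho => //; split=> // g [cg g0 g1 gd gl].
apply: le_trans (rho_length_reflect _ rho0).
apply: adm; have [? ? ? ? ?] : path_joining F E (fun t => g (1 - t)) by exact: path_joining_reflect.
by split=> //; [exact: FE|exact: EF].
Qed.

Lemma width_subset (E F E' F' : set (R * R)) : E `<=` E' -> F `<=` F' ->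
  (width (path_joining E F) <= width (path_joining E' F'))%E.
Proof.
move=> EE FF; apply: le_ereal_inf => _ [rho [mrho rho0 adm] <-].
exists rho => //; split=> // g [cg g0 g1 gd gl].
by apply: adm; split=> //; [exact: EE|exact: FF].
Qed.
End path_reversal.

Section arc_width.
Variable R : realType.

(** Half the signed chord between the points of angles [s] and [t], so [arc_ratio] is a cross-ratio
    of four points of the circle. *)
Definition half_sin (s t : R) : R := sin ((t - s) / 2).

Definition arc_ratio (al be ga de : R) : R :=
  half_sin al ga * half_sin be de / (half_sin be ga * half_sin al de).

Lemma half_sin_gt0 (s t : R) : s < t -> t < s + 2 * pi -> 0 < half_sin s t.
Proof. by move=> st ts; apply: sin_gt0_pi; apply/andP; split; lra. Qed.

Lemma tanB (x y : R) : cos x != 0 -> cos y != 0 ->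
  tan x - tan y = sin (x - y) / (cos x * cos y).
Proof.
by move=> cx cy; rewrite /tan sinB; field; rewrite cx cy.
Qed.

Variables al be ga de : R.
Hypotheses (ab : al < be) (bg : be < ga) (gd : ga < de) (da : de < al + 2 * pi).

(** The real coordinate on the circle that has the end [de] of the second arc at infinity. *)
Let y (t : R) : R := tan ((t - de + pi) / 2).

Let half_itv (t : R) : de - 2 * pi < t -> t < de -> - (pi / 2) < (t - de + pi) / 2 < pi / 2.
Proof. by move=> h1 h2; apply/andP; split; lra. Qed.

Let cosE (t : R) : cos ((t - de + pi) / 2) = half_sin t de.
Proof.
rewrite /half_sin (_ : (t - de + pi) / 2 = pi / 2 - (de - t) / 2); last by field.
by rewrite -cosN opprB cosBpihalf.
Qed.

Let yB (s t : R) : de - 2 * pi < s -> s < de -> de - 2 * pi < t -> t < de ->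
  y t - y s = half_sin s t / (half_sin t de * half_sin s de).
Proof.
move=> s1 s2 t1 t2; rewrite /y tanB ?gt_eqF ?cos_gt0_pihalf ?half_itv// !cosE.
by rewrite /half_sin; congr (sin _ / _); field.
Qed.

Let y_lt (s t : R) : de - 2 * pi < s -> s < t -> t < de -> y s < y t.
Proof.
move=> s1 st t2; rewrite -subr_gt0 yB//; [|lra|lra].
apply: divr_gt0; last apply: mulr_gt0; apply: half_sin_gt0; lra.
Qed.

Let y_le (s t : R) : de - 2 * pi < s -> s <= t -> t < de -> y s <= y t.
Proof.
by move=> s1; rewrite le_eqVlt => /orP[/eqP ->//|st t2]; apply/ltW/y_lt.
Qed.

Let cay_y (t : R) : de - 2 * pi < t -> t < de -> cay de (y t, 0) = circ_pt t.
Proof.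
move=> t1 t2; rewrite cay_boundary /y tanK; last by rewrite in_itv/=; exact: half_itv.
by congr circ_pt; field.
Qed.

Let atan_y (t : R) : de - 2 * pi < t -> t < de -> atan (y t) = (t - de + pi) / 2.
Proof. by move=> t1 t2; rewrite /y tanK// in_itv/=; exact: half_itv. Qed.

Let hyps : [/\ al < be, be < ga, ga < de & de < al + 2 * pi].
Proof. by []. Qed.

Let ratioE : ((y be + y ga) / 2 - y al) / ((y ga - y be) / 2) = 2 * arc_ratio al be ga de - 1.
Proof.
have [p0 [? ? ? ?]] := (pi_gt0 R, hyps).
have nz (s t : R) : s < t -> t < s + 2 * pi -> half_sin s t != 0.
  by move=> ? ?; rewrite gt_eqF// half_sin_gt0.
have h1 : y ga - y be != 0.
  by rewrite subr_eq0 gt_eqF//; apply: y_lt; lra.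
have -> : ((y be + y ga) / 2 - y al) / ((y ga - y be) / 2) =
    2 * ((y ga - y al) / (y ga - y be)) - 1 by field; exact: h1.
congr (2 * _ - 1); rewrite !yB /arc_ratio; [|lra..].
have n1 : half_sin ga de != 0 by apply: nz; lra.
have n2 : half_sin al de != 0 by apply: nz; lra.
have n3 : half_sin be de != 0 by apply: nz; lra.
have n4 : half_sin be ga != 0 by apply: nz; lra.
by field; rewrite n1 n2 n3 n4.
Qed.

Let E := @circ_pt R @` `[al, be]%classic.
Let F := @circ_pt R @` `[ga, de]%classic.

Lemma arc_width_ge :
  ((ln (2 * arc_ratio al be ga de - 1) / pi)%:E <= width (path_joining E F))%E.
Proof.
have [p0 [? ? ? ?]] := (pi_gt0 R, hyps); rewrite -ratioE; apply: (width_ge (d := de)).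
- by apply: y_lt; lra.
- by apply: y_lt; lra.
- move=> x /andP[ax xb]; rewrite cay_boundary; exists (de - pi + 2 * atan x) => //=.
  have h1 : atan (y al) <= atan x by exact: le_atan.
  have h2 : atan x <= atan (y be) by exact: le_atan.
  by move: h1 h2; rewrite !atan_y ?in_itv/=; [|lra..] => h1 h2; apply/andP; split; lra.
- move=> x gx; rewrite cay_boundary; exists (de - pi + 2 * atan x) => //=.
  have h1 : atan (y ga) <= atan x by exact: le_atan.
  have h2 := atan_ltpi2 x.
  by move: h1; rewrite !atan_y ?in_itv/=; [|lra..] => h1; apply/andP; split; lra.
Qed.

Lemma arc_width_le :
  (width (path_joining E F) <=
    (ln (2 * arc_ratio al be ga de - 1) / pi + (pi / 8 + 3 / (2 * pi)))%:E)%E.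
Proof.
have [p0 [? ? ? ?]] := (pi_gt0 R, hyps); rewrite -ratioE; apply: (width_le (d := de)).
- by apply: y_lt; lra.
- by apply: y_lt; lra.
- move=> _ [t + <-]; rewrite /= in_itv/= => /andP[at_ tb]; exists (y t).
    by apply/andP; split; apply: y_le; lra.
  by rewrite cay_y//; lra.
- move=> _ [t + <-]; rewrite /= in_itv/= => /andP[gt_ td].
  (* The angle [de] is the pole of the coordinate, where [tan] takes only a default value. *)
  move: td; rewrite le_eqVlt => /orP[/eqP ->|td]; first by right.
  left; exists (y t); first by apply: y_le; lra.
  by rewrite cay_y//; lra.
Qed.
End arc_width.

(** * Numerical constants and the logarithmic width *)

Section width_estimates.
Variable R : realType.

(** The triple-angle formula at pi / 6 gives (sin x + 1) (2 sin x - 1)^2 = 0, so sin (pi / 6) = 1/2,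
    and sin x <= x. *)
Lemma pi_ge3 : 3 <= pi :> R.
Proof.
have p0 := pi_gt0 R; set x : R := pi / 6.
have s3 : sin (x + x *+ 2) = 1.
  by rewrite -(sin_pihalf R); congr sin; rewrite /x; field.
have sx0 : 0 < sin x by apply: sin_gt0_pi; rewrite /x; apply/andP; split; lra.
have cs := cos2Dsin2 x.
have : (sin x + 1) * (2 * sin x - 1) ^+ 2 = 0.
  move: s3; rewrite sinD sin_mulr2n cos_mulr2n => s3.
  have c2 : cos x ^+ 2 = 1 - sin x ^+ 2 by lra.
  have s3' : sin x * (2 * cos x ^+ 2 - 1) + 2 * sin x * cos x ^+ 2 = 1
    by rewrite -[RHS]s3; ring.
  by move: s3'; rewrite c2 => s3'; transitivity (1 - (sin x * (2 * (1 - sin x ^+ 2) - 1) +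
    2 * sin x * (1 - sin x ^+ 2))); [ring|rewrite s3' subrr].
move=> /eqP; rewrite mulf_eq0 sqrf_eq0 => /orP[/eqP ?|/eqP s2]; first by lra.
have := @MVT_le _ sin cos 0 x 1 (fun z _ => is_derive_sin z) (fun z _ => cos_max z) x 0.
rewrite lexx sin0 !subr0 mul1r => /(_ _ _).
have x0 : 0 <= x by rewrite /x; lra.
move=> /(_ _ _); rewrite x0 lexx /= => /(_ isT isT).
have xE : pi = 6 * x by rewrite /x; field.
by rewrite (ger0_norm (ltW sx0)) (ger0_norm x0) => H; lra.
Qed.

Lemma pi_lt4 : pi < 4 :> R.
Proof. by have := pihalf_lt2 R; lra. Qed.

(** Because (1 + 3/32)^8 exceeds 2. *)
Lemma ln2_le : ln 2 <= 3 / 4 :> R.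
Proof.
have h : 1 + 3 / 32 <= expR (3 / 32) :> R by exact: expR_ge1Dx.
have -> : 3 / 4 = ln (expR (8 * (3 / 32))) :> R by rewrite expRK; field.
rewrite ler_ln ?posrE ?expR_gt0// expRM_natl.
apply: (@le_trans _ _ ((1 + 3 / 32) ^+ 8)); first by rewrite !exprS expr0; lra.
by rewrite lerXn2r// nnegrE ?expR_ge0//; lra.
Qed.

Definition width_gap : R := pi / 8 + 3 / (2 * pi).

(** With ln 2 <= 3/4, multiplication by pi reduces this to (pi - 3) (pi - 5) <= 0. *)
Lemma width_gap_le : ln 2 / pi + 2 * width_gap <= 2.
Proof.
have p3 := pi_ge3; have p4 := pi_lt4; have l2 := ln2_le; have p0 := pi_gt0 R.
rewrite -(ler_pM2r p0) mulrDl divfK ?gt_eqF// /width_gap.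
have -> : 2 * (pi / 8 + 3 / (2 * pi)) * pi = pi ^+ 2 / 4 + 3 :> R.
  by move: (lt0r_neq0 p0); generalize (pi : R) => P pn; field; exact: pn.
by nra.
Qed.

Lemma width_gap_ge0 : 0 <= width_gap.
Proof. by have p0 := pi_gt0 R; rewrite addr_ge0// divr_ge0// ltW// mulr_gt0. Qed.

(** The lower bound for a width as a function of the logarithm x of the cross-ratio, the quantity
    that adds up along the circle; with [width_gap] added it is the upper bound. *)
Definition log_width (x : R) : R := ln (2 * expR x - 1) / pi.

Let arg_ge1 (x : R) : 0 <= x -> 1 <= 2 * expR x - 1.
Proof. by move=> x0; have := expR_ge1Dx x; lra. Qed.

Lemma log_width_le (x y : R) : 0 <= x -> x <= y -> log_width x <= log_width y.
Proof.
move=> x0 xy; have ax := arg_ge1 x0; have ay := arg_ge1 (le_trans x0 xy).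
rewrite ler_pM2r ?invr_gt0 ?pi_gt0// ler_ln ?posrE; [|lra|lra].
by move: xy; rewrite -ler_expR; lra.
Qed.

Lemma log_width_ge0 (x : R) : 0 <= x -> 0 <= log_width x.
Proof. by move=> /arg_ge1 h; rewrite divr_ge0 ?pi_ge0// ln_ge0. Qed.

Lemma log_width_ge (x : R) : 0 <= x -> x / pi <= log_width x.
Proof.
move=> x0; have ax := arg_ge1 x0; rewrite ler_pM2r ?invr_gt0 ?pi_gt0//.
rewrite -[leLHS]expRK ler_ln ?posrE ?expR_gt0; [|by []|lra].
by have := expR_ge1Dx x; lra.
Qed.

Lemma log_width_le_ln (x : R) : 0 <= x -> log_width x <= (x + ln 2) / pi.
Proof.
move=> x0; have ax := arg_ge1 x0; rewrite ler_pM2r ?invr_gt0 ?pi_gt0//.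
rewrite -[x in leRHS]expRK addrC -lnM ?posrE ?expR_gt0// ler_ln ?posrE; [lra|lra|].
by rewrite mulr_gt0 ?expR_gt0.
Qed.

Lemma log_width_add (x y : R) : 0 <= x -> 0 <= y ->
  log_width x + log_width y <= log_width (x + y) + ln 2 / pi.
Proof.
move=> x0 y0; have ax := arg_ge1 x0; have ay := arg_ge1 y0.
have axy := arg_ge1 (addr_ge0 x0 y0).
rewrite -!mulrDl ler_pM2r ?invr_gt0 ?pi_gt0//.
rewrite -!lnM ?posrE; [|lra..].
rewrite ler_ln ?posrE; [|by apply: mulr_gt0; lra|by apply: mulr_gt0; lra].
rewrite expRD; move: ax ay; move: (expR x) (expR y) => a b ax ay; lra.
Qed.

(** Merging two terms costs ln 2 / pi but saves one subtracted 2, and [width_gap_le] leaves enough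
    to absorb both gaps. A single term keeps its gap, hence the two bounds. *)
Lemma sum_log_width_le (s : seq R) : all (>= 0) s -> s != [::] ->
  \sum_(x <- s) (log_width x + width_gap - 2) <= log_width (\sum_(x <- s) x) + width_gap - 2 /\
  ((1 < size s)%N ->
     \sum_(x <- s) (log_width x + width_gap - 2) <= log_width (\sum_(x <- s) x) - 2).
Proof.
have gap := width_gap_le; have gap0 := width_gap_ge0.
elim: s => // x [|y s] IH /andP[x0 s0] _; first by rewrite !big_seq1.
have [IH1 _] := IH s0 isT; rewrite ![\sum_(j <- x :: _) _]big_cons.
have S0 : 0 <= \sum_(j <- y :: s) j.
  have s0' : all (>= 0) (y :: s) by [].
  by rewrite big_seq sumr_ge0// => j js; exact: (allP s0').
have := log_width_add x0 S0; move: IH1; set A := \sum_(_ <- _) _; set B := \sum_(_ <- _) _.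
by move=> IH1 H; split=> [|_]; lra.
Qed.

(** If e^(-x) <= 1/2, the error term is at least 2 and pays for the subtracted 2. Otherwise e^x <= 2
    and x <= e^x - 1 = e^x (1 - e^(-x)) <= 2 (1 - e^(-x)). *)
Lemma ln_width_le (x : R) : 0 <= x ->
  x / pi <= Num.max (log_width x - 2) 0 + 4 * (1 - expR (- x)).
Proof.
move=> x0; have h := log_width_ge x0; have p0 := pi_gt0 R; have p3 := pi_ge3.
have m1 : log_width x - 2 <= Num.max (log_width x - 2) 0 by rewrite le_max lexx.
have m2 : 0 <= Num.max (log_width x - 2) 0 by rewrite le_max lexx orbT.
have e1 : expR (- x) <= 1 by rewrite -[leRHS]expR0 ler_expR; lra.
have ee : expR (- x) * expR x = 1 by rewrite -expRD addNr expR0.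
have e0 := expR_gt0 (- x).
have [e2|e2] := leP (expR (- x)) (1 / 2); first by lra.
have ex : x <= expR x - 1 by have := expR_ge1Dx x; lra.
have xx : x / pi <= x.
  by rewrite ler_pdivrMr//; nra.
have : expR x <= 2 by nra.
nra.
Qed.
End width_estimates.

(** * Cross-ratios of a marking *)

Section cross_ratio_sum.
Variables (R : realFieldType) (y : nat -> R).
Hypothesis y_homo : {homo y : i j / (i < j)%N >-> i < j}.

(* [1 - 1 / X] for the cross-ratio [X] of the intervals [i] and [j], respectively
   of the interval [i] and the one from [y q] through infinity to [y 0]. *)
Definition phi_in (i j : nat) : R :=
  (y i.+1 - y i) * (y j.+1 - y j) / ((y j - y i) * (y j.+1 - y i.+1)).
Definition phi_cl (q i : nat) : R :=
  (y i.+1 - y i) * (y q - y 0%N) / ((y q - y i) * (y i.+1 - y 0%N)).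

(** Cross-ratios with interval [i] multiply when interval [q] and the closing interval are joined:
    (1 - [phi_in i q]) (1 - [phi_cl q.+1 i]) = 1 - [phi_cl q i]. *)
Lemma phi_merge q i : (0 < i)%N -> (i.+1 < q)%N ->
  phi_in i q + phi_cl q.+1 i - phi_cl q i = phi_in i q * phi_cl q.+1 i.
Proof.
move=> i0 iq.
have h1 : y 0%N < y i by exact: y_homo.
have h2 : y i < y i.+1 by exact: y_homo.
have h3 : y i.+1 < y q by exact: y_homo.
have h4 : y q < y q.+1 by exact: y_homo.
rewrite /phi_in /phi_cl; field.
by apply/and4P; split; lra.
Qed.

Lemma phi_in_ge0 i j : (i < j)%N -> 0 <= phi_in i j.
Proof.
move=> ij; apply: divr_ge0; apply: mulr_ge0; rewrite subr_ge0; apply: (ltW_homo y_homo);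
 by rewrite leEnat ?ltnS // ltnW.
Qed.

Lemma phi_in_le1 i j : (i.+1 < j)%N -> phi_in i j <= 1.
Proof.
move=> ij.
have h2 : y i < y i.+1 by exact: y_homo.
have h3 : y i.+1 < y j by exact: y_homo.
have h4 : y j < y j.+1 by exact: y_homo.
rewrite /phi_in ler_pdivrMr ?mul1r; first by nra.
by apply: mulr_gt0; lra.
Qed.

Lemma phi_cl_le1 q i : (i.+1 < q)%N -> phi_cl q i <= 1.
Proof.
move=> iq.
have h1 : y 0%N <= y i by apply: (ltW_homo y_homo).
have h2 : y i < y i.+1 by exact: y_homo.
have h3 : y i.+1 < y q by exact: y_homo.
rewrite /phi_cl ler_pdivrMr ?mul1r; first by nra.
by apply: mulr_gt0; lra.
Qed.

(* the coordinate sending [y 0, y q, y q.+1] to [0, 1, oo] *)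
Definition phi_coord (q k : nat) : R :=
  (y k - y 0%N) * (y q.+1 - y q) / ((y q.+1 - y k) * (y q - y 0%N)).

Lemma phi_coord_itv q i : (i < q)%N -> 0 <= phi_coord q i <= 1.
Proof.
move=> iq.
have h1 : y 0%N <= y i by apply: (ltW_homo y_homo).
have h3 : y i < y q by exact: y_homo.
have h4 : y q < y q.+1 by exact: y_homo.
rewrite /phi_coord; apply/andP; split.
  by apply: divr_ge0; apply: mulr_ge0; lra.
rewrite ler_pdivrMr ?mul1r; first by nra.
by apply: mulr_gt0; lra.
Qed.

(** In the coordinate v the two factors are dv / (1 - v_i) and dv / v_(i+1), where dv is the
    increment of v. Both are at most 1. *)
Lemma phi_in_cl_telescope q i : (i.+1 < q)%N ->
  phi_in i q * phi_cl q.+1 i <= 2 * (phi_coord q i.+1 - phi_coord q i).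
Proof.
move=> iq; set v := phi_coord q.
have h1 : y 0%N <= y i by apply: (ltW_homo y_homo).
have h2 : y i < y i.+1 by exact: y_homo.
have h3 : y i.+1 < y q by exact: y_homo.
have h4 : y q < y q.+1 by exact: y_homo.
have vd : 0 < v i.+1 - v i.
  have -> : v i.+1 - v i = (y q.+1 - y 0%N) * (y i.+1 - y i) * (y q.+1 - y q)
     / ((y q.+1 - y i) * (y q.+1 - y i.+1) * (y q - y 0%N)).
    by rewrite /v /phi_coord; field; apply/and3P; split; lra.
  by apply: divr_gt0; rewrite !mulr_gt0//; lra.
have /andP[a0 a1] : 0 <= v i <= 1 by apply: phi_coord_itv; exact: ltnW.
have /andP[b0 b1] : 0 <= v i.+1 <= 1 by exact: phi_coord_itv.
have a1' : v i < 1 by lra.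
have b0' : 0 < v i.+1 by lra.
have e1 : phi_in i q * (1 - v i) = v i.+1 - v i.
  by rewrite /phi_in /v /phi_coord; field; apply/and4P; split; lra.
have e2 : phi_cl q.+1 i * v i.+1 = v i.+1 - v i.
  by rewrite /phi_cl /v /phi_coord; field; apply/and4P; split; lra.
have p0 : 0 <= phi_in i q by apply: phi_in_ge0; exact: ltnW.
have p1 : phi_in i q <= 1 by exact: phi_in_le1.
have c1 : phi_cl q.+1 i <= 1 by apply: phi_cl_le1; exact: ltnW.
have c0 : 0 <= phi_cl q.+1 i by nra.
(* One of the denominators v_(i+1) and 1 - v_i is at least 1/2, so the corresponding factor is at
   most 2 dv. *)
by have [hv|hv] := leP (1/2) (v i.+1); nra.
Qed.

(** The sum over all nonadjacent pairs among q + 1 intervals of the projective line, the last one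
    passing through infinity; the index ranges leave out neighbours. *)
Definition phi_total (q : nat) : R :=
  \sum_(j < q) \sum_(0 <= i < j.-1) phi_in i j + \sum_(1 <= i < q.-1) phi_cl q i.

(** A new point adds at most 4: two boundary terms of at most 1 each, and a sum of products that
    telescopes to at most 2. *)
Lemma phi_total_le q : phi_total q <= 4 * q%:R.
Proof.
elim: q => [|[|q] IH].
- by rewrite /phi_total big_ord0 big_geq// add0r mulr0.
- by rewrite /phi_total big_ord_recl big_ord0 /= !big_geq// !add0r; lra.
rewrite -[q.+2]addn1 natrD mulrDr mulr1 addn1.
apply: (@le_trans _ _ (phi_total q.+1 + 4)); last by rewrite lerD2r.
rewrite -lerBlDl.
have -> : phi_total q.+2 - phi_total q.+1 = \sum_(0 <= i < q) phi_in i q.+1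
    + \sum_(1 <= i < q.+1) phi_cl q.+2 i - \sum_(1 <= i < q) phi_cl q.+1 i.
  by rewrite /phi_total big_ord_recr /=; lra.
case: q {IH} => [|q]; first by rewrite !big_geq//; lra.
rewrite big_ltn// [\sum_(1 <= i < q.+2) _]big_nat_recr//=.
(* [phi_merge] solved for [phi_in]: the closing sums cancel and products remain. *)
have -> : \sum_(1 <= i < q.+1) phi_in i q.+2 =
   \sum_(1 <= i < q.+1) phi_in i q.+2 * phi_cl q.+3 i
   - \sum_(1 <= i < q.+1) phi_cl q.+3 i + \sum_(1 <= i < q.+1) phi_cl q.+2 i.
  rewrite -sumrB -big_split; apply: eq_big_nat => i /andP[i0 iq] /=.
  by rewrite -phi_merge//; lra.
have h1 : phi_in 0 q.+2 <= 1 by exact: phi_in_le1.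
have h2 : phi_cl q.+3 q.+1 <= 1 by exact: phi_cl_le1.
have h3 : \sum_(1 <= i < q.+1) phi_in i q.+2 * phi_cl q.+3 i <= 2.
  pose v := phi_coord q.+2.
  apply: (@le_trans _ _ (\sum_(1 <= i < q.+1) (2 * (v i.+1 - v i)))).
    by apply: ler_sum_nat => i /andP[i0 iq]; exact: phi_in_cl_telescope.
  rewrite -mulr_sumr telescope_sumr//.
  have := @phi_coord_itv q.+2 1%N erefl; have := @phi_coord_itv q.+2 q.+1 (ltnSn _).
  rewrite -/v; lra.
lra.
Qed.
End cross_ratio_sum.

(** * Sums over nonadjacent indices modulo p *)

Section cyclic_sums.
Variables (R : realType) (p : nat).

Lemma nonadj_sym m n : nonadj p m n = nonadj p n m.
Proof. by rewrite /nonadj eq_sym; congr (_ && _); rewrite andbC. Qed.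

Let modn_cases k : (k < p + p)%N -> (k %% p)%N = if (k < p)%N then k else (k - p)%N.
Proof.
move=> kp; case: ltnP => h; first exact: modn_small.
by rewrite -[in LHS](subnK h) modnDr modn_small//; lia.
Qed.

Lemma nonadj_mod n k : (3 < p)%N -> (n < p)%N -> (n <= k < n + p)%N ->
  nonadj p n (k %% p) = (n.+2 <= k < (n + p).-1)%N.
Proof.
move=> p3 np /andP[nk kp]; rewrite /nonadj (modn_cases (k := k)); last by lia.
rewrite (modn_cases (k := n.+1)); last by lia.
case: (ltnP k p) => h1; case: (ltnP n.+1 p) => h2; rewrite modn_cases; try lia;
  case: ifP => h3; lia.
Qed.

Lemma nonadj_lt m n : (3 < p)%N -> (m < n < p)%N ->
  nonadj p m n = (m.+1 < n)%N && (n.+1 < m + p)%N.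
Proof.
move=> p3 /andP[mn np].
have := @nonadj_mod m n p3 (ltn_trans mn np); rewrite (modn_small np) => ->; lia.
Qed.

Lemma sum_rotate (f : nat -> R) n : (forall k, f (k + p)%N = f k) ->
  \sum_(n <= k < n + p) f k = \sum_(k < p) f k.
Proof.
move=> fp; elim: n => [|n IH]; first by rewrite add0n big_mkord.
case: p fp IH => [|q] fp IH; first by rewrite addn0 big_geq// big_ord0.
rewrite -IH [RHS]big_ltn; last by lia.
by rewrite addSn big_nat_recr/=; [rewrite fp addrC|lia].
Qed.

(** Indices are let run beyond p, so that the ones not adjacent to n form the single range from n +
    2 to n + p - 2, over which sums can telescope. *)
Lemma sum_nonadj (f : nat -> R) n : (3 < p)%N -> (n < p)%N ->
  (forall k, f (k + p)%N = f k) ->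
  \sum_(m < p | nonadj p n m) f m = \sum_(n.+2 <= k < (n + p).-1) f k.
Proof.
move=> p3 np fp; pose g k := if nonadj p n (k %% p) then f k else 0.
transitivity (\sum_(m < p) g m).
  by rewrite big_mkcond; apply: eq_bigr => m _; rewrite /g modn_small.
rewrite -(@sum_rotate g n); last by move=> k; rewrite /g modnDr fp.
rewrite (@big_cat_nat _ _ _ n.+2)/=; [|lia|lia].
rewrite (@big_cat_nat _ _ _ (n + p).-1 n.+2)/=; [|lia|lia].
rewrite [X in X + _]big_nat_cond [X in X + _]big1 ?add0r; last first.
  move=> k; rewrite andbT => hk; rewrite /g nonadj_mod//; last by lia.
  by rewrite ifF//; lia.
rewrite [X in _ + X]big_nat_cond [X in _ + X]big1 ?addr0; last first.
  move=> k; rewrite andbT => hk; rewrite /g nonadj_mod//; last by lia.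
  by rewrite ifF//; lia.
rewrite big_nat_cond [RHS]big_nat_cond; apply: eq_bigr => k; rewrite andbT => hk.
by rewrite /g nonadj_mod ?hk//; lia.
Qed.

Lemma sum_ordered_pairs (f : nat -> nat -> R) : (forall m n, f m n = f n m) ->
  \sum_(n < p) \sum_(m < p | nonadj p n m) f n m =
  2 * \sum_(m < p) \sum_(n < p | (m < n)%N && nonadj p m n) f m n.
Proof.
move=> fs; have E n : \sum_(m < p | nonadj p n m) f n m =
    \sum_(m < p | (n < m)%N && nonadj p n m) f n m +
    \sum_(m < p | (m < n)%N && nonadj p m n) f m n.
  rewrite (bigID (fun m : 'I_p => (n < m)%N))/=; congr (_ + _).
    by apply: eq_bigl => m; rewrite andbC.
  apply: eq_big => [m|m _]; last exact: fs.
  rewrite -leqNgt [nonadj p n m]nonadj_sym andbC ltn_neqAle.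
  case: (eqVneq (m : nat) n) => [->|//]; by rewrite /nonadj eqxx /= andbF.
rewrite (eq_bigr _ (fun (n : 'I_p) _ => E n)) big_split/= mulrDl mul1r; congr (_ + _).
rewrite (exchange_big_dep xpredT)//=.
Qed.
End cyclic_sums.

Section arc_ratio_facts.
Variable R : realType.
Implicit Types s t a b c d : R.

Lemma half_sinC s t : half_sin t s = - half_sin s t.
Proof. by rewrite /half_sin -sinN; congr sin; field. Qed.

Lemma half_sin_shift s t : half_sin s (t + 2 * pi) = - half_sin s t.
Proof.
rewrite /half_sin (_ : (t + 2 * pi - s) / 2 = (t - s) / 2 + pi); last by field.
by rewrite sinDpi.
Qed.

Lemma arc_ratioC a b c d : arc_ratio c d a b = arc_ratio a b c d.
Proof.
rewrite /arc_ratio !(half_sinC a c) !(half_sinC b d) !(half_sinC a d) !(half_sinC b c).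
by rewrite !mulrNN [half_sin a d * _]mulrC.
Qed.

Lemma arc_ratio_shift a b c d :
  arc_ratio a b (c + 2 * pi) (d + 2 * pi) = arc_ratio a b c d.
Proof. by rewrite /arc_ratio !half_sin_shift !mulrNN. Qed.

(* Ptolemy's theorem for four points of the circle. *)
Lemma half_sin_ptolemy a b c d :
  half_sin a c * half_sin b d - half_sin b c * half_sin a d =
  half_sin a b * half_sin c d.
Proof.
have E s t : half_sin s t = sin (t / 2) * cos (s / 2) - cos (t / 2) * sin (s / 2).
  by rewrite /half_sin -sinB; congr sin; field.
by rewrite !E; ring.
Qed.

Lemma arc_ratio_gt1 a b c d : a < b -> b < c -> c < d -> d < a + 2 * pi ->
  1 < arc_ratio a b c d.
Proof.
move=> ab bc cd da; have p0 := pi_gt0 R.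
have h0 : 0 < half_sin b c * half_sin a d.
  by apply: mulr_gt0; apply: half_sin_gt0; lra.
rewrite /arc_ratio ltr_pdivlMr// mul1r -subr_gt0 half_sin_ptolemy.
by apply: mulr_gt0; apply: half_sin_gt0; lra.
Qed.
End arc_ratio_facts.

(** * Lifted angles and cross-ratios of a marking *)

Section marking.
Variables (R : realType) (p : nat) (th : nat -> R).
Hypotheses (p3 : (3 < p)%N) (M : ideal_marking p th).

(** Continues the cut points past index p as increasing angles on the universal cover, so that arcs
    met after a full turn need no wrap-around. *)
Definition lift_angle (k : nat) : R := th (k %% p)%N + 2 * pi * (k %/ p)%:R.
Let T := lift_angle.

Let p0 : (0 < p)%N. Proof. by move: p3; lia. Qed.

Lemma lift_angle_shift k : T (k + p)%N = T k + 2 * pi.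
Proof.
by rewrite /T /lift_angle modnDr divnDr ?dvdnn// divnn p0 /= natrD mulrDr mulr1 addrA.
Qed.

Let T_succ k : T k.+1 = th (k %% p).+1 + 2 * pi * (k %/ p)%:R.
Proof.
have kp : (k %% p < p)%N by rewrite ltn_pmod.
rewrite /T /lift_angle {1 2}(divn_eq k p) -addnS.
have [h|h] := ltnP (k %% p).+1 p.
  by rewrite modnMDl (modn_small h) divnMDl// (divn_small h) addn0.
have -> : (k %% p).+1 = p by lia.
by rewrite modnMDl modnn divnMDl// divnn p0 /= M.2 natrD; ring.
Qed.

Lemma lift_angle_ltS k : T k < T k.+1.
Proof. by rewrite T_succ /T /lift_angle ltrD2r; apply: M.1; rewrite ltn_pmod. Qed.

Lemma lift_angle_lt i j : (i < j)%N -> T i < T j.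
Proof.
elim: j => // j IH; rewrite ltnS leq_eqVlt => /orP[/eqP ->|/IH h].
  exact: lift_angle_ltS.
exact: lt_trans h (lift_angle_ltS _).
Qed.

Lemma lift_angle_le i j : (i <= j)%N -> T i <= T j.
Proof. by rewrite leq_eqVlt => /orP[/eqP ->//|/lift_angle_lt/ltW]. Qed.

Lemma lift_angle_lt_turn i j : (j < i + p)%N -> T j < T i + 2 * pi.
Proof. by rewrite -lift_angle_shift; exact: lift_angle_lt. Qed.

Lemma circ_pt_period (t : R) n : circ_pt (t + 2 * pi * n%:R) = circ_pt t.
Proof.
elim: n => [|n IH]; first by rewrite mulr0 addr0.
rewrite -IH /circ_pt -[n.+1]addn1 natrD mulrDr mulr1 addrA.
have -> x : x + 2 * pi = x + pi *+ 2 :> R by rewrite mulr_natl.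
by rewrite cosD2pi sinD2pi.
Qed.

Lemma arc_lift k : Defs.arc p th k = @circ_pt R @` `[T k, T k.+1]%classic.
Proof.
rewrite /Defs.arc T_succ /T /lift_angle; set x := 2 * pi * _.
apply/seteqP; split => _ [t + <-]; rewrite /= in_itv/= => /andP[h1 h2].
  exists (t + x); last by rewrite circ_pt_period.
  by rewrite /= in_itv/= !lerD2r h1.
exists (t - x); last by rewrite -(@circ_pt_period _ (k %/ p)) subrK.
by rewrite /= in_itv/= lerBrDr lerBlDr h1.
Qed.

Lemma arc_mod k : Defs.arc p th (k %% p) = Defs.arc p th k.
Proof. by rewrite /Defs.arc modn_mod. Qed.

(** The nonadjacent arcs fit together to one arc, so a local width is again a width between two
    arcs. *)
Lemma nonadj_union_lift n : (n < p)%N ->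
  nonadj_union p th n = @circ_pt R @` `[T n.+2, T (n + p).-1]%classic.
Proof.
move=> np; apply/seteqP; split.
  move=> w [k [/= kp kn]]; pose k' := if (n <= k)%N then k else (k + p)%N.
  have kk : (k' %% p)%N = k by rewrite /k'; case: ifP => _; rewrite ?modnDr modn_small.
  have hk : (n <= k' < n + p)%N by rewrite /k'; case: ifP; lia.
  move: kn; rewrite nonadj_sym -kk nonadj_mod// => /andP[k1 k2].
  rewrite arc_mod arc_lift => -[t + <-]; rewrite /= in_itv/= => /andP[t1 t2].
  exists t => //; rewrite /= in_itv/=.
  by rewrite (le_trans (lift_angle_le k1) t1) (le_trans t2 (lift_angle_le _)).
move=> _ [t + <-]; rewrite /= in_itv/= => /andP[t1 t2].
have [k [k1 k2 tk]] : exists k, [/\ (n.+2 <= k)%N, (k < (n + p).-1)%N & T k <= t <= T k.+1].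
  have : (n.+2 < (n + p).-1)%N by lia.
  move: t2; elim: ((n + p).-1) => // j IH tj; rewrite ltnS => nj.
  have [tj'|tj'] := leP t (T j).
    move: nj; rewrite leq_eqVlt => /orP[/eqP nj|nj].
      by exists j; rewrite -nj; split=> //; rewrite -nj in tj' tj; rewrite t1 tj.
    by have [k [k1 k2 k3]] := IH tj' nj; exists k; split=> //; exact: ltnW.
  by exists j; split=> //; rewrite (ltW tj') tj.
exists (k %% p)%N.
  by rewrite /= ltn_pmod// nonadj_sym nonadj_mod ?k1//; lia.
by rewrite arc_mod arc_lift; exists t => //=; rewrite in_itv.
Qed.

Definition log_ratio m n : R := ln (arc_ratio (T m) (T m.+1) (T n) (T n.+1)).

Lemma log_ratioC m n : log_ratio n m = log_ratio m n.
Proof. by rewrite /log_ratio arc_ratioC. Qed.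

Lemma log_ratio_shift m n : log_ratio m (n + p) = log_ratio m n.
Proof. by rewrite /log_ratio -addSn !lift_angle_shift arc_ratio_shift. Qed.

Lemma log_ratioE m n : (m.+1 < n)%N -> (n.+1 < m + p)%N ->
  0 < log_ratio m n /\ expR (log_ratio m n) = arc_ratio (T m) (T m.+1) (T n) (T n.+1).
Proof.
move=> mn nm; have X1 : 1 < arc_ratio (T m) (T m.+1) (T n) (T n.+1).
  apply: arc_ratio_gt1; [exact: lift_angle_ltS|exact: lift_angle_lt|exact: lift_angle_ltS|].
  exact: lift_angle_lt_turn.
by split; [exact: ln_gt0|rewrite lnK// posrE; exact: lt_trans X1].
Qed.

Lemma log_ratio_ge0 m n : (m < p)%N -> (n < p)%N -> nonadj p m n -> 0 <= log_ratio m n.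
Proof.
wlog mn : m n / (m < n)%N => [H mp np mn|mp np].
  have [h|h|h] := ltngtP m n.
  - exact: H.
  - by rewrite -log_ratioC; apply: H => //; rewrite nonadj_sym.
  - by move: mn; rewrite /nonadj h eqxx.
by rewrite nonadj_lt ?mn// => /andP[h1 h2]; have [/ltW] := log_ratioE h1 h2.
Qed.

Definition local_log_ratio n : R := \sum_(m < p | nonadj p n m) log_ratio n m.

(** Each [log_ratio n k] is an increment of [F], the logarithm of the ratio of the chords from the
    cut point [k] to the two ends of arc [n], so the sum telescopes. *)
Lemma local_log_ratioE n : (n < p)%N ->
  0 < local_log_ratio n /\
  expR (local_log_ratio n) = arc_ratio (T n) (T n.+1) (T n.+2) (T (n + p).-1).
Proof.
move=> np; rewrite /local_log_ratio (sum_nonadj (f := log_ratio n))//; last first.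
  by move=> k; rewrite log_ratio_shift.
pose F k := ln (half_sin (T n.+1) (T k) / half_sin (T n) (T k)).
have pos i j : (i < j)%N -> (j < i + p)%N -> 0 < half_sin (T i) (T j).
  by move=> ij ji; apply: half_sin_gt0; [exact: lift_angle_lt|exact: lift_angle_lt_turn].
have E k : (n.+2 <= k < (n + p).-1)%N -> log_ratio n k = F k.+1 - F k.
  move=> /andP[k1 k2].
  have [h1 h2 h3 h4] : [/\ 0 < half_sin (T n) (T k), 0 < half_sin (T n.+1) (T k),
      0 < half_sin (T n) (T k.+1) & 0 < half_sin (T n.+1) (T k.+1)].
    by split; apply: pos; lia.
  rewrite /F -ln_div ?posrE ?divr_gt0// /log_ratio; congr ln; rewrite /arc_ratio.
  by field; rewrite !gt_eqF.
rewrite big_nat (eq_bigr _ E) -big_nat telescope_sumr; last by lia.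
have [h1 h2 h3 h4] : [/\ 0 < half_sin (T n) (T n.+2), 0 < half_sin (T n.+1) (T n.+2),
    0 < half_sin (T n) (T (n + p).-1) & 0 < half_sin (T n.+1) (T (n + p).-1)].
  by split; apply: pos; lia.
have X1 : 1 < arc_ratio (T n) (T n.+1) (T n.+2) (T (n + p).-1).
  apply: arc_ratio_gt1; [exact: lift_angle_ltS|exact: lift_angle_ltS| |].
    by apply: lift_angle_lt; lia.
  by apply: lift_angle_lt_turn; lia.
have -> : F (n + p).-1 - F n.+2 = ln (arc_ratio (T n) (T n.+1) (T n.+2) (T (n + p).-1)).
  rewrite /F -ln_div ?posrE ?divr_gt0//; congr ln; rewrite /arc_ratio.
  by field; rewrite !gt_eqF.
by split; [exact: ln_gt0|rewrite lnK// posrE; exact: lt_trans X1].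
Qed.

Lemma Wbar_pair_bounds m n : (m < n < p)%N -> nonadj p m n ->
  ((log_width (log_ratio m n))%:E <= Wbar_pair p th m n)%E /\
  (Wbar_pair p th m n <= (log_width (log_ratio m n) + width_gap R)%:E)%E.
Proof.
move=> mnp; rewrite nonadj_lt// => /andP[h1 h2].
have [_ e] := log_ratioE h1 h2.
rewrite /Wbar_pair !arc_lift /log_width e.
have [a b c d] : [/\ T m < T m.+1, T m.+1 < T n, T n < T n.+1 & T n.+1 < T m + 2 * pi].
  by split; [exact: lift_angle_ltS|exact: lift_angle_lt|exact: lift_angle_ltS|exact: lift_angle_lt_turn].
by split; [exact: arc_width_ge|exact: arc_width_le].
Qed.

Lemma Wbar_loc_bounds n : (n < p)%N ->
  ((log_width (local_log_ratio n))%:E <= Wbar_loc p th n)%E /\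
  (Wbar_loc p th n <= (log_width (local_log_ratio n) + width_gap R)%:E)%E.
Proof.
move=> np; have [_ e] := local_log_ratioE np.
rewrite /Wbar_loc arc_lift nonadj_union_lift// /log_width e.
have [a b c d] : [/\ T n < T n.+1, T n.+1 < T n.+2, T n.+2 < T (n + p).-1
    & T (n + p).-1 < T n + 2 * pi].
  split; [exact: lift_angle_ltS|exact: lift_angle_ltS|apply: lift_angle_lt; lia|].
  by apply: lift_angle_lt_turn; lia.
by split; [exact: arc_width_ge|exact: arc_width_le].
Qed.

Lemma Wbar_pair_le_loc m n : (m < p)%N -> (n < p)%N -> nonadj p m n ->
  (Wbar_pair p th m n <= Wbar_loc p th m)%E /\ (Wbar_pair p th m n <= Wbar_loc p th n)%E.
Proof.
move=> mp np mn; split.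
  by apply: width_subset => // w wn; exists n => //; rewrite /= np nonadj_sym.
by apply: width_joining_le => // w wm; exists m.
Qed.
End marking.

(** * The sum of 1 - 1 / X over a marking *)

Section defect_sum.
Variables (R : realType) (q : nat) (th : nat -> R).
Let p := q.+1.
Hypotheses (p3 : (3 < p)%N) (M : ideal_marking p th).
Let T := lift_angle p th.
Let c := (T 0 + T q) / 2.
Let C k := cos ((T k - c) / 2).

Let half_itv k : (k <= q)%N -> - (pi / 2) < (T k - c) / 2 < pi / 2.
Proof.
move=> kq; have h1 : T 0 <= T k by exact: lift_angle_le.
have h2 : T k <= T q by exact: lift_angle_le.
have h3 : T q < T 0 + 2 * pi by apply: lift_angle_lt_turn.
by have p0 := pi_gt0 R; rewrite /c; apply/andP; split; lra.
Qed.

(** A tangent coordinate centred at the midpoint of the angles of cut points 0 and q, so the last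
    arc contains infinity. Beyond q it continues by unit steps, to be increasing on all indices as
    the cross-ratio lemmas ask. *)
Definition marking_coord (k : nat) : R :=
  if (k <= q)%N then tan ((T k - c) / 2) else tan ((T q - c) / 2) + (k - q)%:R.
Let y := marking_coord.

(** The factors [C] cancel in every cross-ratio, which carries chords over to differences of
    coordinates. *)
Let CE i j : (i <= q)%N -> (j <= q)%N -> half_sin (T i) (T j) = C i * C j * (y j - y i).
Proof.
move=> iq jq; have ci : C i != 0 by rewrite gt_eqF// cos_gt0_pihalf// half_itv.
have cj : C j != 0 by rewrite gt_eqF// cos_gt0_pihalf// half_itv.
rewrite /y /marking_coord iq jq tanB//.
rewrite (_ : (T j - c) / 2 - (T i - c) / 2 = (T j - T i) / 2); last by field.
by rewrite -/(half_sin (T i) (T j)) -/(C i) -/(C j); field; rewrite ci cj.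
Qed.

Let C_gt0 k : (k <= q)%N -> 0 < C k.
Proof. by move=> kq; rewrite cos_gt0_pihalf// half_itv. Qed.

Lemma marking_coord_lt : {homo marking_coord : i j / (i < j)%N >-> i < j}.
Proof.
apply: homo_ltn; first exact: lt_trans.
move=> k; have [kq|qk] := ltnP k q; last first.
  have -> : marking_coord k = tan ((T q - c) / 2) + (k - q)%:R.
    rewrite /marking_coord; case: ifP => // kq; have -> : k = q by lia.
    by rewrite subnn addr0.
  by rewrite /marking_coord ifF ?ltrD2l ?ltr_nat; lia.
have h1 := C_gt0 (ltnW kq); have h2 := C_gt0 kq.
have : 0 < half_sin (T k) (T k.+1).
  apply: half_sin_gt0; first exact: lift_angle_ltS.
  by apply: lift_angle_lt_turn => //; move: p3; rewrite /p; lia.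
rewrite (CE (ltnW kq) kq) pmulr_rgt0; last exact: mulr_gt0.
by rewrite subr_gt0.
Qed.

Let y_lt i j : (i < j)%N -> y i < y j. Proof. exact: marking_coord_lt. Qed.

Let defect_in i j : (i.+1 < j < q)%N -> 1 - expR (- log_ratio p th i j) = phi_in y i j.
Proof.
move=> /andP[ij jq].
have [|_ e] := log_ratioE p3 M ij; first by rewrite /p; lia.
rewrite expRN e /arc_ratio !CE; [|lia..].
have ci := C_gt0 (ltac:(lia) : (i <= q)%N); have cj := C_gt0 (ltac:(lia) : (j <= q)%N).
have ci1 := C_gt0 (ltac:(lia) : (i.+1 <= q)%N); have cj1 := C_gt0 jq.
have h1 : y i < y i.+1 by exact: y_lt.
have h2 : y i.+1 < y j by exact: y_lt.
have h3 : y j < y j.+1 by exact: y_lt.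
rewrite /phi_in -/y; move: (y i) (y i.+1) (y j) (y j.+1) h1 h2 h3 => a b d f h1 h2 h3.
field; rewrite !gt_eqF// subr_gt0; lra.
Qed.

Let defect_cl i : (0 < i)%N -> (i.+1 < q)%N ->
  1 - expR (- log_ratio p th i q) = phi_cl y q i.
Proof.
move=> i0 iq.
have [|_ e] := log_ratioE p3 M iq; first by rewrite /p; lia.
(* The last arc ends one turn after the first cut point; the shift and the exchange of arguments
   each change the sign. *)
have hq k : half_sin (T k) (T q.+1) = half_sin (T 0%N) (T k).
  have e0 : T q.+1 = T 0%N + 2 * pi by rewrite -(lift_angle_shift th p3) add0n.
  by rewrite e0 half_sin_shift -half_sinC.
rewrite expRN e /arc_ratio !hq !CE; [|lia..].
have ci := C_gt0 (ltac:(lia) : (i <= q)%N); have cj := C_gt0 (leqnn q).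
have ci1 := C_gt0 (ltac:(lia) : (i.+1 <= q)%N); have c0 := C_gt0 (leq0n q).
have h0 : y 0%N < y i by exact: y_lt.
have h1 : y i < y i.+1 by exact: y_lt.
have h2 : y i.+1 < y q by exact: y_lt.
rewrite /phi_cl -/y; move: (y 0%N) (y i) (y i.+1) (y q) h0 h1 h2 => a b d f h0 h1 h2.
move: ci cj ci1 c0; move: (C i) (C q) (C i.+1) (C 0%N) => k1 k2 k3 k4 ? ? ? ?.
field; rewrite !gt_eqF//; lra.
Qed.

Lemma sum_defect_le :
  \sum_(m < p) \sum_(n < p | (m < n)%N && nonadj p m n) (1 - expR (- log_ratio p th m n))
    <= 4 * p%:R.
Proof.
apply: (@le_trans _ _ (4 * q%:R)); last by rewrite ler_pM2l// ler_nat.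
apply: le_trans (phi_total_le marking_coord_lt q).
rewrite (exchange_big_dep xpredT)//= /phi_total big_ord_recr/=.
apply: lerD.
  apply: ler_sum => j _; rewrite big_mkord.
  rewrite (big_ord_widen_cond p xpredT (fun i => phi_in marking_coord i j)); last first.
    by have := ltn_ord j; rewrite /p; lia.
  rewrite le_eqVlt; apply/orP; left; apply/eqP; apply: eq_big => [i|i].
    have jq := ltn_ord j; have [ij|ji] := ltnP i j; last by rewrite /=; lia.
    rewrite (nonadj_lt p3) /p; last by rewrite ij /=; lia.
    by lia.
  move=> /andP[ij]; rewrite nonadj_lt//; last by have := ltn_ord j; rewrite /p ij /=; lia.
  by move=> /andP[h1 h2]; apply: defect_in; rewrite h1 ltn_ord.
rewrite (big_nat_widenl _ 0)//= big_mkord.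
rewrite (big_ord_widen_cond p (fun i => (0 < i)%N) (fun i => phi_cl marking_coord q i)); last first.
  by rewrite /p; lia.
rewrite le_eqVlt; apply/orP; left; apply/eqP; apply: eq_big => [i|i].
  have [iq|qi] := ltnP i q; last by rewrite /=; lia.
  rewrite (nonadj_lt p3) /p; last by rewrite iq /=; lia.
  by lia.
move=> /andP[iq]; rewrite nonadj_lt//; last by rewrite iq /p /=; lia.
by move=> /andP[h1 h2]; apply: defect_cl => //; have h3 : (q.+1 < i + q.+1)%N := h2; lia.
Qed.
End defect_sum.

(** * Truncated widths in terms of log cross-ratios *)

Section weights.
Variable R : realType.

(* At most one index: monotonicity.  At least two: the product of the
   modified ratios loses a factor of at least 2 for every merge. *)
Lemma sum_excess_le (I : finType) (P : pred I) (b lam : I -> R) (B : R) :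
  (forall i, P i -> [/\ 0 <= lam i, b i <= log_width (lam i) + width_gap R & b i <= B]) ->
  log_width (\sum_(i | P i) lam i) <= B ->
  \sum_(i | P i) Num.max (b i - 2) 0 <= Num.max (B - 2) 0.
Proof.
move=> H HB.
pose s := [seq i <- index_enum I | P i && (2 < b i)].
have sP i : i \in s -> P i /\ 2 < b i by rewrite mem_filter => /andP[/andP[]].
have -> : \sum_(i | P i) Num.max (b i - 2) 0 = \sum_(i <- s) (b i - 2).
  rewrite big_filter big_mkcondr; apply: eq_bigr => i _.
  by case: ltP => h; [rewrite max_l// subr_ge0 ltW|rewrite max_r// subr_le0].
have lamS : \sum_(i <- s) lam i <= \sum_(i | P i) lam i.
  rewrite big_filter big_mkcondr; apply: ler_sum => i Pi.
  by case: ifP => // _; have [] := H i Pi.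
have [s0|[[i si]|s2]] : s = [::] \/ (exists i, s = [:: i]) \/ (1 < size s)%N.
  by case: (s) => [|i [|j t]]; [left|right; left; exists i|right; right].
- by rewrite s0 big_nil le_max lexx orbT.
- rewrite si big_seq1 le_max lerD2r; apply/orP; left.
  have [Pi _] : P i /\ 2 < b i by apply: sP; rewrite si inE.
  by have [_ _ ->] := H i Pi.
have lam0 : all (>= 0) [seq lam i | i <- s].
  by apply/allP => _ /mapP[i /sP[Pi _] ->]; have [] := H i Pi.
have sn : [seq lam i | i <- s] != [::] by move: s2; case: (s).
have [_] := sum_log_width_le lam0 sn; rewrite size_map => /(_ s2).
rewrite !big_map => K; rewrite le_max; apply/orP; left.
apply: (@le_trans _ _ (\sum_(i <- s) (log_width (lam i) + width_gap R - 2))).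
  rewrite big_seq [leRHS]big_seq; apply: ler_sum => i /sP[Pi _].
  by have [_ h _] := H i Pi; rewrite lerD2r.
apply: (le_trans K); rewrite lerD2r; apply: le_trans HB; apply: log_width_le => //.
rewrite big_seq; apply: sumr_ge0 => i /sP[Pi _]; by have [] := H i Pi.
Qed.

(** The local width is at most (sum of [lam]) / pi plus a constant. That sum is additive, so
    [ln_width_le] converts it term by term, leaving one constant per index of the marking. *)
Lemma sum_excess_ge (I : finType) (P : pred I) (b lam : I -> R) (B : R) :
  (forall i, P i -> 0 <= lam i /\ log_width (lam i) <= b i) ->
  0 <= B -> B <= log_width (\sum_(i | P i) lam i) + width_gap R ->
  Num.max (B - 2) 0 <= \sum_(i | P i) (Num.max (b i - 2) 0 + 4 * (1 - expR (- lam i)))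
    + (ln 2 / pi + width_gap R).
Proof.
move=> H B0 HB; have L0 : 0 <= \sum_(i | P i) lam i.
  by apply: sumr_ge0 => i /H[].
apply: (@le_trans _ _ B); first by rewrite ge_max B0 andbT; lra.
apply: (le_trans HB); rewrite [leRHS]addrA lerD2r; apply: (le_trans (log_width_le_ln L0)).
rewrite mulrDl lerD2r mulr_suml; apply: ler_sum => i /H[l0 lb].
apply: (le_trans (ln_width_le l0)); rewrite lerD2r.
by apply: le_max2 => //; rewrite lerD2r.
Qed.
End weights.

(** * Local and pair weights *)

Lemma sum_defect (R : realType) p (th : nat -> R) : (3 < p)%N -> ideal_marking p th ->
  \sum_(m < p) \sum_(n < p | (m < n)%N && nonadj p m n) (1 - expR (- log_ratio p th m n))
    <= 4 * p%:R.
Proof. by case: p => // q; exact: sum_defect_le. Qed.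

Section totals.
Variables (R : realType) (p : nat) (th : nat -> R).
Hypotheses (p3 : (3 < p)%N) (M : ideal_marking p th).

(** Ordered by index, hence symmetric by construction: [pair_sum] involves only pairs with m < n. *)
Let b m n : R := fine (Wbar_pair p th (minn m n) (maxn m n)).
Let bl n : R := fine (Wbar_loc p th n).
Let w m n : R := Num.max (b m n - 2) 0.
Let wl n : R := Num.max (bl n - 2) 0.
Let lam := log_ratio p th.

Let fin_between (x y : R) (z : \bar R) : (x%:E <= z)%E -> (z <= y%:E)%E -> (fine z)%:E = z.
Proof. by case: z => [z| |] // _; rewrite leye_eq. Qed.

Let bC m n : b m n = b n m.
Proof. by rewrite /b minnC maxnC. Qed.

Let WlocE n : (n < p)%N -> Wbar_loc p th n = (bl n)%:E.
Proof. by move=> np; have [h1 h2] := Wbar_loc_bounds p3 M np; rewrite (fin_between h1 h2). Qed.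

Let WpairE m n : (m < n < p)%N -> nonadj p m n -> Wbar_pair p th m n = (b m n)%:E.
Proof.
move=> mnp mn; have [h1 h2] := Wbar_pair_bounds p3 M mnp mn.
have mn' : (m <= n)%N by case/andP: mnp => /ltnW.
by rewrite /b (minn_idPl mn') (maxn_idPr mn') (fin_between h1 h2).
Qed.

Let b_bounds m n : (m < p)%N -> (n < p)%N -> nonadj p m n ->
  [/\ 0 <= lam m n, log_width (lam m n) <= b m n,
      b m n <= log_width (lam m n) + width_gap R & b m n <= bl m].
Proof.
move=> mp np mn.
have key i j : (i < j < p)%N -> nonadj p i j -> [/\ 0 <= lam i j, log_width (lam i j) <= b i j,
    b i j <= log_width (lam i j) + width_gap R & b i j <= bl i /\ b i j <= bl j].
  move=> ijp ij; have /andP[iltj jp] := ijp; have ip := ltn_trans iltj jp.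
  have [h1 h2] := Wbar_pair_bounds p3 M ijp ij.
  have [h3 h4] := Wbar_pair_le_loc th ip jp ij.
  move: h1 h2 h3 h4; rewrite WpairE// !WlocE// !lee_fin => h1 h2 h3 h4.
  by split=> //; exact: log_ratio_ge0.
have [h|h|h] := ltngtP m n.
- by have [? ? ? [? ?]] := key m n (introT andP (conj h np)) mn; split.
- have nm : nonadj p n m by rewrite nonadj_sym.
  have [] := key n m (introT andP (conj h mp)) nm.
  by rewrite bC /lam log_ratioC => ? ? ? [? ?]; split.
- by move: mn; rewrite /nonadj h eqxx.
Qed.

Let wC m n : w m n = w n m. Proof. by rewrite /w bC. Qed.

Let total_weightE : total_weight p th = (\sum_(n < p) wl n)%:E.
Proof.
rewrite /total_weight -sumEFin; apply: eq_bigr => n _.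
by rewrite /W_loc WlocE// -EFinB -EFin_max.
Qed.

Let pair_sumE : (2%:E * pair_sum p th)%E =
  (\sum_(n < p) \sum_(m < p | nonadj p n m) w n m)%:E.
Proof.
rewrite sum_ordered_pairs// EFinM /pair_sum; congr (_ * _)%E.
rewrite -sumEFin; apply: eq_bigr => m _; rewrite -sumEFin; apply: eq_bigr => n /andP[mn na].
have mnp : (m < n < p)%N by rewrite mn ltn_ord.
by rewrite /W_pair (WpairE mnp na) -EFinB -EFin_max.
Qed.

Lemma pair_sum_le_total : (2%:E * pair_sum p th <= total_weight p th)%E.
Proof.
rewrite pair_sumE total_weightE lee_fin; apply: ler_sum => n _.
apply: (@sum_excess_le R _ (fun m : 'I_p => nonadj p n m) (fun m : 'I_p => b n m) (fun m : 'I_p => lam n m)).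
  by move=> m nm; have [] := b_bounds (ltn_ord n) (ltn_ord m) nm.
have [h _] := Wbar_loc_bounds p3 M (ltn_ord n).
by move: h; rewrite WlocE// lee_fin.
Qed.

(** The 32 is 4 from [ln_width_le], times 2 for ordered pairs, times 4 from [sum_defect]; the rest
    of the constant is the loss per local width. *)
Lemma total_le_pair_sum :
  (total_weight p th - ((32 + (ln 2 / pi + width_gap R)) * p%:R)%:E <= 2%:E * pair_sum p th)%E.
Proof.
rewrite pair_sumE total_weightE -EFinB lee_fin lerBlDr.
pose phi m n : R := 1 - expR (- lam m n).
apply: (@le_trans _ _ (\sum_(n < p) (\sum_(m < p | nonadj p n m) (w n m + 4 * phi n m)
   + (ln 2 / pi + width_gap R)))).
  apply: ler_sum => n _; have [h1 h2] := Wbar_loc_bounds p3 M (ltn_ord n).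
  move: h1 h2; rewrite WlocE// !lee_fin => h1 h2.
  apply: (@sum_excess_ge R _ (fun m : 'I_p => nonadj p n m) (fun m : 'I_p => b n m)
    (fun m : 'I_p => lam n m)).
  - by move=> m nm; have [] := b_bounds (ltn_ord n) (ltn_ord m) nm.
  - apply: le_trans h1; apply: log_width_ge0.
    by have [/ltW] := local_log_ratioE p3 M (ltn_ord n).
  - exact: h2.
rewrite big_split/= sumr_const card_ord -[X in _ + X <= _]mulr_natr [in leRHS]mulrDl [leRHS]addrA lerD2r.
under eq_bigr do rewrite big_split/= -mulr_sumr.
rewrite big_split/= lerD2l -mulr_sumr sum_ordered_pairs; last first.
  by move=> m n; rewrite /phi /lam log_ratioC.
by have := sum_defect p3 M; rewrite -/lam; lra.
Qed.
End totals.

Unset Implicit Arguments.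
Local Close Scope classical_set_scope.
Local Open Scope ring_scope.

Theorem theorem3p7 (R : realType) :
  exists C : R, forall (p : nat) (th : nat -> R),
    (4 <= p)%N -> ideal_marking p th ->
    (total_weight p th - (C * p%:R)%:E <= 2%:E * pair_sum p th)%E /\
    (2%:E * pair_sum p th <= total_weight p th)%E.
Proof.
exists (32 + (ln 2 / pi + width_gap R)) => p th p4 M.
by split; [exact: total_le_pair_sum|exact: pair_sum_le_total].
Qed.
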